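(* Let $n\ge 2$ and let $D_F\subset\mathbb{C}^n$ be a bounded strongly pseudoconvex Hartogs domain with its Kähler metric $g_F$ (as defined in the context), and let $g_B$ be the Bergman metric of $D_F$. Assume that $g_B=\lambda g_F$ for some $\lambda\in\mathbb{R}^+$. Then $g_F$ is Kähler–Einstein, and therefore $(D_F,g_F)$ is holomorphically isometric to an open subset of the complex hyperbolic space $\mathbb{C}H^n$.
   Context: Let $b\in\mathbb{R}^+\cup\{+\infty\}$ and let $F:[0,b)\to(0,+\infty)$ be a non-increasing smooth function (smooth up to $0$). The $n$-dimensional Hartogs domain associated to $F$ is $$D_F=\{(z_0,z)\in\mathbb{C}^n : |z_0|^2<b,\ \|z\|^2<F(|z_0|^2)\},$$ where $z=(z_1,\dots,z_{n-1})$ and $\|z\|^2=|z_1|^2+\cdots+|z_{n-1}|^2$. Standing assumption: $D_F$ is strongly pseudoconvex, which in this paper is understood as (and is equivalent to) the condition $$\left(\frac{xF'(x)}{F(x)}\right)'<0\quad\text{for all }x\in[0,b),$$ and is also equivalent to the condition that $$\omega_F=-\frac{i}{2}\,\partial\overline{\partial}\log\left(F(|z_0|^2)-\|z\|^2\right)$$ is a Kähler form on $D_F$. The metric $g_F$ is the Kähler metric associated to $\omega_F$, i.e. the Kähler metric with potential $-\log(F(|z_0|^2)-\|z\|^2)$ (normalized as $g_F=2\,\mathrm{Re}\sum_{j,k=0}^{n-1}h_{j\bar k}\,dz_j\otimes d\bar z_k$ with $h_{j\bar k}=-\frac{\partial^2}{\partial z_j\partial\bar z_k}\log(F(|z_0|^2)-\|z\|^2)$;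 the same normalization is used for every $F$). The Bergman metric $g_B$ on $D_F$ is the Kähler metric with Kähler potential $\log K(z_0,z;z_0,z)$ (with the same normalization of metric versus potential), where $K$ is the Bergman kernel of $D_F$. The complex hyperbolic space $\mathbb{C}H^n$ is the unit ball $B^n\subset\mathbb{C}^n$ with the metric $g_{hyp}=g_F$ obtained for $F(x)=1-x$, $0\le x<1$, $b=1$. *)

(* Defs.v *)
From HB Require Import structures.
From mathcomp Require Import all_boot all_order all_algebra.
From mathcomp Require Import all_classical all_reals all_analysis.
From mathcomp Require Export complex.
Import Order.TTheory GRing.Theory Num.Theory numFieldNormedType.Exports.

Set Implicit Arguments.
Unset Strict Implicit.
Unset Printing Implicit Defensive.

Local Open Scope classical_set_scope.
Local Open Scope ring_scope.
Local Open Scope complex_scope.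

(* The n-fold product of a sigma-finite measure, on n-tuples. *)
Section FiniteProductMeasure.
Context {d : measure_display} {T : measurableType d} {R : realType}.

Definition tcons (n : nat) (p : T * n.-tuple T) : n.+1.-tuple T :=
  [tuple of p.1 :: p.2].

Definition tuncons (n : nat) (t : n.+1.-tuple T) : T * n.-tuple T :=
  (thead t, [tuple of behead t]).

Lemma measurable_tcons (n : nat) :
  measurable_fun [set: T * n.-tuple T] (@tcons n).
Proof. exact: measurable_cons. Qed.

HB.instance Definition _ (n : nat) :=
  isMeasurableFun.Build _ _ _ _ (@tcons n) (@measurable_tcons n).

Lemma measurable_tuncons (n : nat) :
  measurable_fun [set: n.+1.-tuple T] (@tuncons n).
Proof.
apply: measurable_fun_pair; first exact: measurable_tnth.
exact: measurable_behead.
Qed.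

Section Cons.
Variables (mu : {sigma_finite_measure set T -> \bar R}) (n : nat).
Variable nu : {sigma_finite_measure set (n.-tuple T) -> \bar R}.

Definition tuple_measure_cons : set (n.+1.-tuple T) -> \bar R :=
  pushforward (mu \x nu)%E (@tcons n).

Let m0 : tuple_measure_cons set0 = 0%E.
Proof. by rewrite /tuple_measure_cons /pushforward preimage_set0 measure0. Qed.

Let m_ge0 A : (0 <= tuple_measure_cons A)%E.
Proof. exact: measure_ge0. Qed.

Let m_additive : semi_sigma_additive tuple_measure_cons.
Proof. exact: measure_semi_sigma_additive. Qed.

HB.instance Definition _ := isMeasure.Build _ _ _
  tuple_measure_cons m0 m_ge0 m_additive.

Let m_sigma_finite : sigma_finite [set: n.+1.-tuple T] tuple_measure_cons.
Proof.
have /sigma_finiteP[F [TF ndF Foo]] := sigma_finiteT mu.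
have /sigma_finiteP[G [TG ndG Goo]] := sigma_finiteT nu.
exists (fun k => @tuncons n @^-1` (F k `*` G k)).
  rewrite predeqE => t; split => // _.
  have [i _ Fi] : (\bigcup_i F i) (tuncons t).1 by rewrite -TF.
  have [j _ Gj] : (\bigcup_i G i) (tuncons t).2 by rewrite -TG.
  exists (maxn i j) => //; split.
  - by move: Fi; exact/subsetPset/ndF/leq_maxl.
  - by move: Gj; exact/subsetPset/ndG/leq_maxr.
move=> k; have [? ?] := Foo k; have [? ?] := Goo k; split.
  rewrite -[X in measurable X]setTI; apply: measurable_tuncons => //.
  exact: measurableX.
rewrite /tuple_measure_cons /pushforward -comp_preimage.
rewrite (_ : @tuncons n \o @tcons n = id).
  by rewrite preimage_id product_measure1E// lte_mul_pinfty// ge0_fin_numE.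
apply/funext => -[x t]; rewrite /tuncons /tcons /= theadE; congr pair.
exact: val_inj.
Qed.

HB.instance Definition _ := Measure_isSigmaFinite.Build _ _ _
  tuple_measure_cons m_sigma_finite.
End Cons.

Fixpoint tuple_measure (mu : {sigma_finite_measure set T -> \bar R}) (n : nat) :
    {sigma_finite_measure set (n.-tuple T) -> \bar R} :=
  if n is k.+1 then tuple_measure_cons mu (tuple_measure mu k)
  else \d_[tuple].
End FiniteProductMeasure.

Section HartogsFunctions.
Context {R : realType}.
Implicit Types (D : set R) (b : \bar R) (f F : R -> R).

(* Derivatives of functions defined on D only; one-sided at an endpoint of D. *)
Definition difference_quotient f x : R -> R := fun y => (f y - f x) / (y - x).

Definition derivable_within D f x : Prop :=
  cvg (difference_quotient f x @ within D x^').

Definition derive_within D f : R -> R :=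
  fun x => lim (difference_quotient f x @ within D x^').

Definition smooth_within D f : Prop :=
  forall k x, D x -> derivable_within D (iter k (derive_within D) f) x.

Definition base_interval b : set R := [set x | 0 <= x /\ (x%:E < b)%E].

(* (x F'(x) / F(x))' < 0 on [0, b[, the form in which strong pseudoconvexity of
   the Hartogs domain is understood. *)
Definition strong_pseudoconvexity_condition b F : Prop :=
  let I := base_interval b in
  forall x, I x ->
    derive_within I (fun t => t * derive_within I F t / F t) x < 0.

End HartogsFunctions.

Section ComplexSpace.
Context {R : realType} {m : nat}.
Implicit Types (z w u v : 'rV[R[i]]_m) (D : set 'rV[R[i]]_m).

Definition sqmod (a : R[i]) : R := complex.Re a ^+ 2 + complex.Im a ^+ 2.

(* The point of C^m with real coordinates t = (x_0, y_0, x_1, y_1, ...). *)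
Definition complex_point (t : m.*2.-tuple (measurableTypeR R)) : 'rV[R[i]]_m :=
  \row_(j < m) (nth 0 t j.*2 +i* nth 0 t j.*2.+1).

Definition lebesgue_measureC :
    {measure set (m.*2.-tuple (measurableTypeR R)) -> \bar R} :=
  tuple_measure (@lebesgue_measure R) m.*2.

Definition integralC D (f : 'rV[R[i]]_m -> R[i]) : R[i] :=
  (\int[lebesgue_measureC]_(t in complex_point @^-1` D)
     complex.Re (f (complex_point t))) +i*
  (\int[lebesgue_measureC]_(t in complex_point @^-1` D)
     complex.Im (f (complex_point t))).

(* Derivative at t = 0, for real t, of f (z + t v). *)
Definition real_derive v (f : 'rV[R[i]]_m -> R[i]) z : R[i] :=
  derive1 (fun t : R => complex.Re (f (z + t%:C *: v))) 0 +i*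
  derive1 (fun t : R => complex.Im (f (z + t%:C *: v))) 0.

(* Wirtinger operators (d/dx_j - i d/dy_j) / 2 and (d/dx_j + i d/dy_j) / 2. *)
Definition dz (j : 'I_m) (f : 'rV[R[i]]_m -> R[i]) z : R[i] :=
  (real_derive (delta_mx 0 j) f z
   - 'i * real_derive ('i *: delta_mx 0 j) f z) / 2.

Definition dzbar (j : 'I_m) (f : 'rV[R[i]]_m -> R[i]) z : R[i] :=
  (real_derive (delta_mx 0 j) f z
   + 'i * real_derive ('i *: delta_mx 0 j) f z) / 2.

Definition complex_hessian (phi : 'rV[R[i]]_m -> R) z : 'M[R[i]]_m :=
  \matrix_(j, k) dz j (dzbar k (fun w => (phi w)%:C)) z.

(* 2 Re (\sum_(j, k) h_jk dz_j (x) dzbar_k), where h is the complex Hessian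
   of the potential phi. *)
Definition potential_metric (phi : 'rV[R[i]]_m -> R) z u v : R :=
  2 * complex.Re
    (\sum_j \sum_k complex_hessian phi z j k * u 0 j * (v 0 k)^*).

(* The Ricci form of a Kaehler metric with components h is
   - i d dbar (log det h); with the normalization of potential_metric, the
   Ricci tensor is thus the symmetric form with potential - log det h. *)
Definition ricci_tensor (phi : 'rV[R[i]]_m -> R) :
    'rV[R[i]]_m -> 'rV[R[i]]_m -> 'rV[R[i]]_m -> R :=
  potential_metric
    (fun z => - ln (complex.Re (\det (complex_hessian phi z)))).

Definition kahler_einstein D (phi : 'rV[R[i]]_m -> R) : Prop :=
  exists c : R, forall z, D z -> forall u v,
    ricci_tensor phi z u v = c * potential_metric phi z u v.

End ComplexSpace.

(* The topology of R[i] given by its norm. *)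
HB.instance Definition _ (R : realType) :=
  PseudoPointedMetric.copy R[i] (R[i])^o.

Section HolomorphicMaps.
(* The ambient space is C^n with n = m + 1. *)
Context {R : realType} {m : nat}.
Local Notation Cm := 'rV[R[i]]_m.+1.
Implicit Types D E U : set Cm.

(* Differentiability is over the field R[i]. *)
Definition holomorphic_on (W : normedModType R[i]) D (f : Cm -> W) : Prop :=
  forall z, D z -> differentiable f z.

Definition bergman_space D : set (Cm -> R[i]) :=
  [set f | holomorphic_on D (f : Cm -> R[i]^o) /\
    (\int[lebesgue_measureC]_(t in complex_point @^-1` D)
        (sqmod (f (complex_point t)))%:E < +oo)%E].

(* The kernel with the reproducing property; it is unique on D. *)
Definition is_bergman_kernel D (K : Cm -> Cm -> R[i]) : Prop :=
  forall w, D w ->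
    bergman_space D (K ^~ w) /\
    forall f, bergman_space D f ->
      f w = integralC D (fun z => f z * (K z w)^*).

Definition bergman_metric (K : Cm -> Cm -> R[i]) : Cm -> Cm -> Cm -> R :=
  potential_metric (fun z => ln (complex.Re (K z z))).

Definition holomorphically_isometric_to_open_subset
    D (g : Cm -> Cm -> Cm -> R) E (h : Cm -> Cm -> Cm -> R) : Prop :=
  exists (U : set Cm) (Phi Psi : Cm -> Cm),
    [/\ open U /\ U `<=` E,
        holomorphic_on D Phi /\ holomorphic_on U Psi,
        (forall z, D z -> U (Phi z) /\ Psi (Phi z) = z),
        (forall w, U w -> D (Psi w) /\ Phi (Psi w) = w) &
        forall z, D z -> forall u v,
          h (Phi z) ('d Phi z u) ('d Phi z v) = g z u v].

Definition fiber_sqnorm (z : Cm) : R := \sum_(j | j != ord0) sqmod (z 0 j).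

Definition hartogs_domain (b : \bar R) (F : R -> R) : set Cm :=
  [set z : Cm | ((sqmod (z 0 ord0))%:E < b)%E /\
           fiber_sqnorm z < F (sqmod (z 0 ord0))].

Definition hartogs_potential (F : R -> R) (z : Cm) : R :=
  - ln (F (sqmod (z 0 ord0)) - fiber_sqnorm z).

Definition hartogs_metric (F : R -> R) : Cm -> Cm -> Cm -> R :=
  potential_metric (hartogs_potential F).

Definition unit_ball : set Cm := [set z : Cm | \sum_j sqmod (z 0 j) < 1].

Definition hyperbolic_metric : Cm -> Cm -> Cm -> R :=
  hartogs_metric (fun x => 1 - x).

End HolomorphicMaps.

(* Main.v *)
Require Import Defs.
From HB Require Import structures.
From mathcomp Require Import all_boot all_order all_algebra.
From mathcomp Require Import all_classical all_reals all_analysis.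
From mathcomp Require Import measurable_realfun ring lra.
Import Order.TTheory GRing.Theory Num.Theory numFieldNormedType.Exports.
Local Open Scope classical_set_scope.
Local Open Scope ring_scope.
Local Open Scope complex_scope.

Set Implicit Arguments.
Unset Strict Implicit.
Unset Printing Implicit Defensive.

(** Restrict everything to the coordinate axis [z_1] of the fibre. Since the domain
is a complete Reinhardt domain, averaging over the rotations of the coordinates
shows that the Bergman kernel is there [K = \sum_k |z_1| ^ 2k / c_k], where [c_k] is
the integral of [|z_1| ^ 2k] over the domain. Integrating over the fibres, which are
balls, [c_k] is a constant times [k! / (k + n - 1)!] times the moment
[\int F ^ (k + n - 1)] of the profile.

With [y = |z_1| ^ 2], the [(1, 1)] component of [g_B = lambda g_F] on this axis is an
equation between the logarithms of [K] and of [F 0 - y]. It integrates to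
[(F 0 - y) K' = lambda K], that is
[c_(k+1) * (lambda + k) = F 0 * (k + 1) * c_k]. This is a recursion
[N (s + 1) * (s + q) = F 0 * (s + 1) * N s] for the moments [N] of [F]. Pseudoconvexity
at [0] gives [F' 0 < 0], so that [N s / F 0 ^ s] lies between two multiples of [1 / s];
this is compatible with the recursion only for [q = 2]. Then [F / F 0] has the moments
of a function [1 - x / A], to which it is therefore equal.

For such [F] the potential is [- ln (F 0 - \sum_i a_i |z_i| ^ 2)]. Its Hessian has
determinant a constant times the power [-(n + 1)] of the argument of the logarithm,
hence the metric is Einstein, and rescaling the coordinates maps it to the
hyperbolic metric. *)

(** * Cauchy's integral formula *)

(** Holomorphy is given as complex differentiability at each point, without continuity of the
    derivative, and the Bergman kernel only through its reproducing property. So the power series on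
    the axis rests on Goursat's bisection argument, and its coefficients come from reproducing the
    powers of [z_1]; no orthonormal basis is used. On the axis the potential of [g_F] involves [F]
    only through [F 0], and the kernel involves it only through its moments, so one diagonal entry
    of the metric identity closes up into a relation on moments. With [n = p + 2] the exponents are
    [s = k + p + 1]: the relation holds from [n0 = p + 1] on, with [q = lambda - (p + 1)], and
    [q = 2] amounts to [lambda = n + 1]. Low moments being out of reach, the profile is recovered
    from high ones: polynomials without low-degree terms, close to step functions, compare the
    lengths of superlevel sets of two functions whose intervals of definition are not known to
    agree. Both functions are nonincreasing, so these lengths determine them. *)

Section IntervalIntegral.
Context {R : realType}.
Implicit Types (a b c d m k : R) (f g : R -> R).

Definition itg a b f : R := \int[@lebesgue_measure R]_(x in `[a, b]) f x.

(** Two-sided continuity, endpoints included: the integrands below are continuous as functions on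
    the line at each point of the closed interval, and subintervals inherit the condition without
    endpoint cases. *)
Definition continuous_itv a b f := forall x, a <= x <= b -> {for x, continuous f}.

Lemma continuous_itv_integrable a b f : continuous_itv a b f ->
  (@lebesgue_measure R).-integrable `[a, b] (EFin \o f).
Proof.
move=> cf; apply: continuous_compact_integrable; first exact: segment_compact.
apply: continuous_in_subspaceT => x; rewrite inE/= in_itv/= => abx.
exact: cf.
Qed.

Lemma sub_continuous_itv a b c d f :
  continuous_itv a b f -> a <= c -> d <= b -> continuous_itv c d f.
Proof.
move=> cf ac db x /andP[cx xd]; apply: cf.
by rewrite (le_trans ac cx) (le_trans xd db).
Qed.

Lemma continuous_itvB a b f g : continuous_itv a b f -> continuous_itv a b g ->
  continuous_itv a b (fun x => f x - g x).
Proof. by move=> cf cg x abx; apply: continuousB; [exact: cf|exact: cg]. Qed.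

Lemma continuous_itvM a b f g : continuous_itv a b f -> continuous_itv a b g ->
  continuous_itv a b (fun x => f x * g x).
Proof. by move=> cf cg x abx; apply: continuousM; [exact: cf|exact: cg]. Qed.

Lemma continuous_itv_cst a b k : continuous_itv a b (fun=> k).
Proof. by move=> x _; exact: cst_continuous. Qed.

Lemma eq_itg a b f g : (forall x, a <= x <= b -> f x = g x) ->
  itg a b f = itg a b g.
Proof.
move=> fg; apply: eq_Rintegral => x; rewrite inE/= in_itv/= => ?; exact: fg.
Qed.

Lemma itgB a b f g : continuous_itv a b f -> continuous_itv a b g ->
  itg a b (fun x => f x - g x) = itg a b f - itg a b g.
Proof.
move=> cf cg; apply: RintegralB => //; exact: continuous_itv_integrable.
Qed.

Lemma itgD a b f g : continuous_itv a b f -> continuous_itv a b g ->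
  itg a b (fun x => f x + g x) = itg a b f + itg a b g.
Proof.
move=> cf cg; apply: RintegralD => //; exact: continuous_itv_integrable.
Qed.

Lemma itgZ a b k f : continuous_itv a b f ->
  itg a b (fun x => k * f x) = k * itg a b f.
Proof. by move=> cf; apply: RintegralZl => //; exact: continuous_itv_integrable. Qed.

Lemma itg_cst a b k : a <= b -> itg a b (fun=> k) = k * (b - a).
Proof.
move=> ab; rewrite /itg Rintegral_cst//= lebesgue_measure_itv/= lte_fin.
by case: ltgtP ab => // -> _; rewrite subrr.
Qed.

Lemma le_itg a b f g : continuous_itv a b f -> continuous_itv a b g ->
  (forall x, a <= x <= b -> f x <= g x) -> itg a b f <= itg a b g.
Proof.
by move=> cf cg fg; apply: le_Rintegral => //; exact: continuous_itv_integrable.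
Qed.

Lemma itg_split a m b f : continuous_itv a b f -> a <= m <= b ->
  itg a b f = itg a m f + itg m b f.
Proof.
move=> cf /andP[am mb].
have := @Rintegral_itvB R f (BLeft a) (BRight b) m.
move=> /(_ (continuous_itv_integrable cf)).
rewrite !bnd_simp => /(_ am mb) h.
apply/eqP; rewrite addrC -subr_eq; apply/eqP; rewrite /itg h.
apply: Rintegral_itv_obnd_cbnd.
apply: integrableS (continuous_itv_integrable cf) => //=.
by apply: subset_itv; rewrite bnd_simp.
Qed.

(** Serves Goursat's argument, with [k] the increment of an affine approximation, and, for [k = 0],
    bounds an integral by a supremum. *)
Lemma itg_near_cst a b k e f : a <= b -> continuous_itv a b f ->
  (forall x, a <= x <= b -> `|f x - k| <= e) ->
  `|itg a b f - k * (b - a)| <= e * (b - a).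
Proof.
move=> ab cf fk; rewrite ler_distl.
rewrite -mulrBl -mulrDl -!itg_cst//; apply/andP; split; apply: le_itg => //;
  try exact: continuous_itv_cst; by move=> x /fk; rewrite ler_distl => /andP[].
Qed.

End IntervalIntegral.

(* Differentiability at a single point: no continuity of the partial
   derivatives is required below. *)
Definition differential2 (R : realType) (f : R -> R -> R) (x0 y0 A B : R) :=
  forall e, 0 < e -> exists2 d, 0 < d & forall x y,
    `|x - x0| < d -> `|y - y0| < d ->
    `|f x y - f x0 y0 - A * (x - x0) - B * (y - y0)|
      <= e * (`|x - x0| + `|y - y0|).

(** * Goursat's theorem on a rectangle *)

Section Goursat.
Context {R : realType}.
Implicit Types (P Q : R -> R -> R).

Lemma differential2_lipschitz P x0 y0 A B : differential2 P x0 y0 A B ->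
  exists2 d, 0 < d & exists2 K, 0 < K &
    forall x y, `|x - x0| < d -> `|y - y0| < d ->
    `|P x y - P x0 y0| <= K * (`|x - x0| + `|y - y0|).
Proof.
move=> /(_ 1 ltr01)[d d0 Hd]; exists d => //; exists (`|A| + `|B| + 1).
  by rewrite ltr_wpDl// addr_ge0.
move=> x y xd yd; have := Hd x y xd yd; rewrite mul1r => h.
have -> : P x y - P x0 y0 =
    P x y - P x0 y0 - A * (x - x0) - B * (y - y0)
    + (A * (x - x0) + B * (y - y0)) by ring.
rewrite (le_trans (ler_normD _ _))//.
have h2 : `|A * (x - x0) + B * (y - y0)| <= `|A| * `|x - x0| + `|B| * `|y - y0|.
  by rewrite -!normrM ler_normD.
have := normr_ge0 A; have := normr_ge0 B.
have := normr_ge0 (x - x0); have := normr_ge0 (y - y0).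
nra.
Qed.

Lemma lipschitz_at_continuous (f : R -> R) x0 d K : 0 < d -> 0 < K ->
  (forall x, `|x - x0| < d -> `|f x - f x0| <= K * `|x - x0|) ->
  {for x0, continuous f}.
Proof.
move=> d0 K0 H; apply/cvgrPdist_le => /= e e0.
exists (Num.min d (e / K)) => /=; first by rewrite lt_min d0 divr_gt0.
move=> x /=; rewrite lt_min distrC [`|f _ - _|]distrC => /andP[xd xe].
by rewrite (le_trans (H _ xd))// mulrC -ler_pdivlMr// ltW.
Qed.

Lemma differential2_continuousl P x0 y0 A B :
  differential2 P x0 y0 A B -> {for x0, continuous (P^~ y0)}.
Proof.
move=> /differential2_lipschitz[d d0 [K K0 H]].
apply: (lipschitz_at_continuous d0 K0) => x xd.
by have := H x y0 xd; rewrite subrr normr0 addr0; exact.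
Qed.

Lemma differential2_continuousr P x0 y0 A B :
  differential2 P x0 y0 A B -> {for y0, continuous (P x0)}.
Proof.
move=> /differential2_lipschitz[d d0 [K K0 H]].
apply: (lipschitz_at_continuous d0 K0) => y yd.
by have := H x0 y; rewrite subrr normr0 add0r; exact.
Qed.

Variables (P Q : R -> R -> R) (a0 b0 c0 d0 : R).
Hypothesis closedPQ : forall x y, a0 <= x <= b0 -> c0 <= y <= d0 ->
  exists A B C, differential2 P x y A B /\ differential2 Q x y B C.

(** The integral of [P dx + Q dy] along the boundary of a rectangle, counterclockwise. The form is
    closed because [closedPQ] uses the same [B] for the [y]-derivative of [P] and the [x]-derivative
    of [Q]. *)
Let W a b c d := itg a b (fun x => P x c - P x d) +
  itg c d (fun y => Q b y - Q a y).

Let contP y : c0 <= y <= d0 -> continuous_itv a0 b0 (P^~ y).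
Proof.
move=> yI x xI; have [A [B [C [h _]]]] := closedPQ xI yI.
exact: differential2_continuousl h.
Qed.

Let contQ x : a0 <= x <= b0 -> continuous_itv c0 d0 (Q x).
Proof.
move=> xI y yI; have [A [B [C [_ h]]]] := closedPQ xI yI.
exact: differential2_continuousr h.
Qed.

Let W_splitx a m b c d : a0 <= a -> a <= m -> m <= b -> b <= b0 ->
    c0 <= c -> c <= d -> d <= d0 -> W a b c d = W a m c d + W m b c d.
Proof.
move=> a0a am mb bb0 c0c cd dd0; rewrite /W.
have cP y : c <= y <= d -> continuous_itv a b (P^~ y).
  by move=> ?; apply: (@sub_continuous_itv _ a0 b0) => //; apply: contP; lra.
have cQ x : a <= x <= b -> continuous_itv c d (Q x).
  by move=> ?; apply: (@sub_continuous_itv _ c0 d0) => //; apply: contQ; lra.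
rewrite (@itg_split _ a m b); last 2 first.
- by apply: continuous_itvB; apply: cP; lra.
- by rewrite am mb.
rewrite (_ : itg c d (fun y => Q b y - Q a y) =
  itg c d (fun y => Q m y - Q a y) + itg c d (fun y => Q b y - Q m y)).
  by rewrite addrACA.
by rewrite !itgB; [ring|apply: cQ; lra..].
Qed.

Let W_splity a b c m d : a0 <= a -> a <= b -> b <= b0 ->
    c0 <= c -> c <= m -> m <= d -> d <= d0 -> W a b c d = W a b c m + W a b m d.
Proof.
move=> a0a ab bb0 c0c cm md dd0; rewrite /W.
have cP y : c <= y <= d -> continuous_itv a b (P^~ y).
  by move=> ?; apply: (@sub_continuous_itv _ a0 b0) => //; apply: contP; lra.
have cQ x : a <= x <= b -> continuous_itv c d (Q x).
  by move=> ?; apply: (@sub_continuous_itv _ c0 d0) => //; apply: contQ; lra.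
rewrite (@itg_split _ c m d); last 2 first.
- by apply: continuous_itvB; apply: cQ; lra.
- by rewrite cm md.
rewrite (_ : itg a b (fun x => P x c - P x d) =
  itg a b (fun x => P x c - P x m) + itg a b (fun x => P x m - P x d)).
  by rewrite addrACA.
by rewrite !itgB; [ring|apply: cP; lra..].
Qed.

(** Near [(x, y)] both functions are affine up to [e / 2] times the size [s] of the rectangle. The
    affine parts contribute [B * (c - d) * (b - a) + B * (b - a) * (d - c) = 0]; the errors on
    opposite sides add up to at most [e * s] per unit length. *)
Let W_small x y e : a0 <= x <= b0 -> c0 <= y <= d0 -> 0 < e ->
  exists2 r, 0 < r & forall a b c d, a0 <= a -> a <= x -> x <= b -> b <= b0 ->
    c0 <= c -> c <= y -> y <= d -> d <= d0 -> (b - a) + (d - c) < r ->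
    `|W a b c d| <= e * ((b - a) + (d - c)) ^+ 2.
Proof.
move=> xI yI e0; have [A [B [C [dP dQ]]]] := closedPQ xI yI.
have e20 : 0 < e / 2 by rewrite divr_gt0.
have [r1 r10 H1] := dP _ e20; have [r2 r20 H2] := dQ _ e20.
exists (Num.min r1 r2); first by rewrite lt_min r10 r20.
move=> a b c d a0a ax xb bb0 c0c cy yd dd0; rewrite lt_min => /andP[s1 s2].
have ba0 : 0 <= b - a by rewrite subr_ge0 (le_trans ax).
have dc0 : 0 <= d - c by rewrite subr_ge0 (le_trans cy).
have sx1 : b - a < r1 by rewrite (le_lt_trans _ s1)// lerDl.
have sy1 : d - c < r1 by rewrite (le_lt_trans _ s1)// lerDr.
have sx2 : b - a < r2 by rewrite (le_lt_trans _ s2)// lerDl.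
have sy2 : d - c < r2 by rewrite (le_lt_trans _ s2)// lerDr.
set s := _ + _ in s1 s2 *.
have cP t : c <= t <= d -> continuous_itv a b (P^~ t).
  by move=> ?; apply: (@sub_continuous_itv _ a0 b0) => //; apply: contP; lra.
have cQ t : a <= t <= b -> continuous_itv c d (Q t).
  by move=> ?; apply: (@sub_continuous_itv _ c0 d0) => //; apply: contQ; lra.
have nx t : a <= t <= b -> `|t - x| <= b - a by move=> ?; rewrite ler_norml; lra.
have ny t : c <= t <= d -> `|t - y| <= d - c by move=> ?; rewrite ler_norml; lra.
have e2s : 0 <= e / 2 by lra.
have b1 : `|itg a b (fun t => P t c - P t d) - B * (c - d) * (b - a)|
    <= e * s * (b - a).
  apply: itg_near_cst; first lra.
    by apply: continuous_itvB; apply: cP; lra.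
  move=> t tI; have nt := nx _ tI.
  have nc : `|c - y| <= d - c by apply: ny; lra.
  have nd : `|d - y| <= d - c by apply: ny; lra.
  have h1 : `|P t c - P x y - A * (t - x) - B * (c - y)| <= e / 2 * s.
    apply: le_trans (H1 _ _ (le_lt_trans nt sx1) (le_lt_trans nc sy1)) _.
    by apply: ler_wpM2l => //; rewrite lerD.
  have h2 : `|P t d - P x y - A * (t - x) - B * (d - y)| <= e / 2 * s.
    apply: le_trans (H1 _ _ (le_lt_trans nt sx1) (le_lt_trans nd sy1)) _.
    by apply: ler_wpM2l => //; rewrite lerD.
  rewrite (_ : _ - _ = (P t c - P x y - A * (t - x) - B * (c - y)) -
     (P t d - P x y - A * (t - x) - B * (d - y))); last ring.
  rewrite (le_trans (ler_normB _ _))//; lra.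
have b2 : `|itg c d (fun t => Q b t - Q a t) - B * (b - a) * (d - c)|
    <= e * s * (d - c).
  apply: itg_near_cst; first lra.
    by apply: continuous_itvB; apply: cQ; lra.
  move=> t tI; have nt := ny _ tI.
  have nb : `|b - x| <= b - a by apply: nx; lra.
  have na : `|a - x| <= b - a by apply: nx; lra.
  have h1 : `|Q b t - Q x y - B * (b - x) - C * (t - y)| <= e / 2 * s.
    apply: le_trans (H2 _ _ (le_lt_trans nb sx2) (le_lt_trans nt sy2)) _.
    by apply: ler_wpM2l => //; rewrite lerD.
  have h2 : `|Q a t - Q x y - B * (a - x) - C * (t - y)| <= e / 2 * s.
    apply: le_trans (H2 _ _ (le_lt_trans na sx2) (le_lt_trans nt sy2)) _.
    by apply: ler_wpM2l => //; rewrite lerD.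
  rewrite (_ : _ - _ = (Q b t - Q x y - B * (b - x) - C * (t - y)) -
     (Q a t - Q x y - B * (a - x) - C * (t - y))); last ring.
  rewrite (le_trans (ler_normB _ _))//; lra.
rewrite /W (_ : _ + _ =
  (itg a b (fun t => P t c - P t d) - B * (c - d) * (b - a)) +
  (itg c d (fun t => Q b t - Q a t) - B * (b - a) * (d - c))); last ring.
rewrite (le_trans (ler_normD _ _))// (le_trans (lerD b1 b2))//.
by rewrite -mulrDr -mulrA -/s -expr2.
Qed.

Let inside (p : R * R) u v :=
  [/\ a0 <= p.1, p.1 + u <= b0, c0 <= p.2 & p.2 + v <= d0].

Let bad e (p : R * R) u v :=
  e * (u + v) ^+ 2 < `|W p.1 (p.1 + u) p.2 (p.2 + v)|.

(** [W] is additive over the four quarters, while [(u + v) ^+ 2] is four times the bound allowed for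
    a quarter, so the quarters cannot all be good. *)
Let bad_half e p u v : 0 <= u -> 0 <= v -> inside p u v -> bad e p u v ->
  exists q : R * R, [/\ p.1 <= q.1, q.1 + u / 2 <= p.1 + u,
    p.2 <= q.2, q.2 + v / 2 <= p.2 + v & bad e q (u / 2) (v / 2)].
Proof.
move: p => [a c] u0 v0 [/= h1 h2 h3 h4] pbad.
apply: contrapT => /forallNP none.
have good i j : (i == 0) || (i == u / 2) -> (j == 0) || (j == v / 2) ->
    `|W (a + i) (a + i + u / 2) (c + j) (c + j + v / 2)|
    <= e * (u / 2 + v / 2) ^+ 2.
  move=> hi hj; rewrite leNgt; apply/negP => hbad.
  have [i1 i2] : 0 <= i /\ i + u / 2 <= u by case/orP: hi => /eqP ->; lra.
  have [j1 j2] : 0 <= j /\ j + v / 2 <= v by case/orP: hj => /eqP ->; lra.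
  by apply: (none (a + i, c + j)); split => //=; lra.
move: pbad; rewrite /bad /=; apply/negP; rewrite -leNgt.
rewrite (@W_splitx _ (a + u / 2)); try lra.
rewrite (@W_splity _ _ _ (c + v / 2)); try lra.
rewrite (@W_splity (a + u / 2) _ _ (c + v / 2)); try lra.
have g00 := good 0 0; have g01 := good 0 (v / 2).
have g10 := good (u / 2) 0; have g11 := good (u / 2) (v / 2).
move: g00 g01 g10 g11; rewrite !eqxx !orbT /= !addr0.
have -> : a + u / 2 + u / 2 = a + u by lra.
have -> : c + v / 2 + v / 2 = c + v by lra.
move=> /(_ isT isT) g00 /(_ isT isT) g01 /(_ isT isT) g10 /(_ isT isT) g11.
rewrite (le_trans (ler_normD _ _))//.
have n1 := ler_normD (W a (a + u / 2) c (c + v / 2))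
  (W a (a + u / 2) (c + v / 2) (c + v)).
have n2 := ler_normD (W (a + u / 2) (a + u) c (c + v / 2))
  (W (a + u / 2) (a + u) (c + v / 2) (c + v)).
have -> : (u + v) ^+ 2 = 4 * (u / 2 + v / 2) ^+ 2 by field.
lra.
Qed.

(** If [W] were nonzero, successive bisection would give nested bad rectangles shrinking to a point,
    where [W_small] contradicts badness. *)
Theorem goursat_rectangle : a0 <= b0 -> c0 <= d0 -> W a0 b0 c0 d0 = 0.
Proof.
move=> ab cd; apply/eqP; rewrite -normr_le0 leNgt; apply/negP => W0.
pose u := b0 - a0; pose v := d0 - c0.
have u0 : 0 <= u by rewrite subr_ge0.
have v0 : 0 <= v by rewrite subr_ge0.
(* The factor 2 makes the whole rectangle strictly bad; the summand 1 keeps the denominator positive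
   when the rectangle is degenerate. *)
pose e := `|W a0 b0 c0 d0| / (2 * ((u + v) ^+ 2 + 1)).
have uv0 : 0 < 2 * ((u + v) ^+ 2 + 1) by have := sqr_ge0 (u + v); lra.
have e0 : 0 < e by rewrite divr_gt0.
have bad0 : bad e (a0, c0) u v.
  rewrite /bad /= !subrKC.
  rewrite /e mulrAC ltr_pdivrMr// ltr_pM2l//.
  by have := sqr_ge0 (u + v); lra.
pose un n := u / 2 ^+ n; pose vn n := v / 2 ^+ n.
have unS n : un n.+1 = un n / 2 by rewrite /un exprSr invfM mulrA.
have vnS n : vn n.+1 = vn n / 2 by rewrite /vn exprSr invfM mulrA.
have un0 n : 0 <= un n by rewrite divr_ge0 ?exprn_ge0.
have vn0 n : 0 <= vn n by rewrite divr_ge0 ?exprn_ge0.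
pose step n (p q : R * R) := [/\ p.1 <= q.1, q.1 + un n.+1 <= p.1 + un n,
    p.2 <= q.2, q.2 + vn n.+1 <= p.2 + vn n &
    inside q (un n.+1) (vn n.+1) /\ bad e q (un n.+1) (vn n.+1)].
(* Badness is assumed under the existential, so that choice gives a successor to every corner and
   the sequence can be defined before its members are known to be bad. *)
have next n p : exists q, inside p (un n) (vn n) /\ bad e p (un n) (vn n) ->
    step n p q.
  have [[pin pbad]|np] := pselect (inside p (un n) (vn n) /\ bad e p (un n) (vn n)); last by exists p.
  have [q [q1 q2 q3 q4 q5]] := bad_half (un0 n) (vn0 n) pin pbad.
  exists q => _; split; rewrite ?unS ?vnS//; split => //.
  by case: pin => ? ? ? ?; split; lra.
pose nxt n p := sval (cid (next n p)).
pose p := fix p n := if n is k.+1 then nxt k (p k) else (a0, c0).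
have pP n : inside (p n) (un n) (vn n) /\ bad e (p n) (un n) (vn n).
  elim: n => [|n ih].
    rewrite /un /vn expr0 !divr1; split => //.
    by split => /=; rewrite ?subrKC.
  by have [] := svalP (cid (next n (p n))) ih.
have pS n : step n (p n) (p n.+1) := svalP (cid (next n (p n))) (pP n).
pose x := lim ((fun n => (p n).1) @ \oo); pose y := lim ((fun n => (p n).2) @ \oo).
have ndx : nondecreasing_seq (fun n => (p n).1).
  by apply/nondecreasing_seqP => n; case: (pS n).
have ndy : nondecreasing_seq (fun n => (p n).2).
  by apply/nondecreasing_seqP => n; case: (pS n).
have nix : nonincreasing_seq (fun n => (p n).1 + un n).
  by apply/nonincreasing_seqP => n; case: (pS n).
have niy : nonincreasing_seq (fun n => (p n).2 + vn n).
  by apply/nonincreasing_seqP => n; case: (pS n).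
(* By nestedness every left end lies before every right end, so the limit of the left ends belongs
   to all the rectangles. *)
have crossx n k : (p n).1 <= (p k).1 + un k.
  rewrite (le_trans (ndx n (maxn n k) (leq_maxl _ _)))//.
  by rewrite (le_trans _ (nix k (maxn n k) (leq_maxr _ _)))// lerDl.
have crossy n k : (p n).2 <= (p k).2 + vn k.
  rewrite (le_trans (ndy n (maxn n k) (leq_maxl _ _)))//.
  by rewrite (le_trans _ (niy k (maxn n k) (leq_maxr _ _)))// lerDl.
have cvx : cvgn (fun n => (p n).1).
  apply: nondecreasing_is_cvgn => //; exists b0 => _ [n _ <-].
  by have [[_ + _ _] _] := pP n; have := un0 n; lra.
have cvy : cvgn (fun n => (p n).2).
  apply: nondecreasing_is_cvgn => //; exists d0 => _ [n _ <-].
  by have [[_ _ _ +] _] := pP n; have := vn0 n; lra.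
have lox n : (p n).1 <= x by exact: nondecreasing_cvgn_le.
have loy n : (p n).2 <= y by exact: nondecreasing_cvgn_le.
have hix n : x <= (p n).1 + un n by apply: limr_le => //; near=> k; exact: crossx.
have hiy n : y <= (p n).2 + vn n by apply: limr_le => //; near=> k; exact: crossy.
have xI : a0 <= x <= b0.
  by have := lox 0%N; have := hix 0%N; rewrite /un expr0 divr1 /= /u; lra.
have yI : c0 <= y <= d0.
  by have := loy 0%N; have := hiy 0%N; rewrite /vn expr0 divr1 /= /v; lra.
have [r r0 H] := W_small xI yI e0.
have [n nr] : exists n, un n + vn n < r.
  have : (fun n => (u + v) * (2^-1) ^+ n) @ \oo --> (u + v) * 0.
    by apply: cvgM; [exact: cvg_cst|apply: cvg_expr; rewrite ger0_norm; lra].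
  rewrite mulr0 => /cvgrPdist_lt/(_ _ r0)[n _ /(_ n (leqnn n))] /=.
  rewrite sub0r normrN ger0_norm; last first.
    apply: mulr_ge0; first exact: addr_ge0.
    by rewrite exprn_ge0 ?invr_ge0.
  by rewrite exprVn mulrDl => ?; exists n.
have [[i1 i2 i3 i4] bn] := pP n.
move: bn; rewrite /bad; apply/negP; rewrite -leNgt.
have := H (p n).1 ((p n).1 + un n) (p n).2 ((p n).2 + vn n).
rewrite (addrC (p n).1) (addrC (p n).2) !addrK; apply => //.
- by rewrite addrC; exact: hix.
- by rewrite addrC.
- by rewrite addrC; exact: hiy.
- by rewrite addrC.
Unshelve. all: by end_near. Qed.

End Goursat.


(** * Modulus and limits in the complex numbers *)

Section ComplexModulus.
Context {R : realType}.
Implicit Types (x y z w : R[i]) (r s : R).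

(** The norm of [R[i]] takes its values in [R[i]]; its real part allows estimates in the ordered
    field [R]. *)
Definition cabs z : R := complex.Re `|z|.

Lemma cabsE z : (cabs z)%:C = `|z|.
Proof. by rewrite /cabs normc_def. Qed.

Lemma ofreal_le r s : (r%:C <= s%:C) = (r <= s).
Proof. exact: lecR. Qed.

Lemma ofreal_inj : injective (fun r : R => r%:C).
Proof. by move=> r s []. Qed.

Lemma cabs_ge0 z : 0 <= cabs z.
Proof. by rewrite -ofreal_le cabsE normr_ge0. Qed.

Lemma cabsM z w : cabs (z * w) = cabs z * cabs w.
Proof. by apply: ofreal_inj; rewrite rmorphM/= !cabsE normrM. Qed.

Lemma cabs0 : cabs 0 = 0.
Proof. by apply: ofreal_inj; rewrite cabsE normr0. Qed.

Lemma cabs1 : cabs 1 = 1.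
Proof. by apply: ofreal_inj; rewrite cabsE normr1. Qed.

Lemma cabs_eq0 z : (cabs z == 0) = (z == 0).
Proof.
by rewrite -[RHS]normr_eq0 -cabsE; apply/eqP/eqP => [->//|/ofreal_inj].
Qed.

Lemma cabsV z : cabs z^-1 = (cabs z)^-1.
Proof. by apply: ofreal_inj; rewrite fmorphV/= !cabsE normfV. Qed.

Lemma cabsX z n : cabs (z ^+ n) = cabs z ^+ n.
Proof. by elim: n => [|n ih]; rewrite ?cabs1 // !exprS cabsM ih. Qed.

Lemma cabsN z : cabs (- z) = cabs z.
Proof. by rewrite /cabs normrN. Qed.

Lemma cabs_dist z w : cabs (z - w) = cabs (w - z).
Proof. by rewrite -cabsN opprB. Qed.

Lemma ler_cabsD z w : cabs (z + w) <= cabs z + cabs w.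
Proof. by rewrite -ofreal_le rmorphD/= !cabsE ler_normD. Qed.

Lemma ler_cabsB z w : cabs (z - w) <= cabs z + cabs w.
Proof. by rewrite -(cabsN w) ler_cabsD. Qed.

Lemma lerB_cabs z w : cabs z - cabs w <= cabs (z - w).
Proof. by rewrite lerBlDr -[in X in X <= _](subrK w z) ler_cabsD. Qed.

Lemma cabs_ofreal r : cabs r%:C = `|r|.
Proof. by rewrite /cabs normc_def/= expr0n/= addr0 sqrtr_sqr. Qed.

Lemma cabs_sqr z : cabs z ^+ 2 = sqmod z.
Proof.
by apply: ofreal_inj; rewrite rmorphXn/= cabsE /sqmod add_Re2_Im2.
Qed.

Lemma ReB z w : complex.Re (z - w) = complex.Re z - complex.Re w.
Proof. by case: z w => ? ? []. Qed.

Lemma ImB z w : complex.Im (z - w) = complex.Im z - complex.Im w.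
Proof. by case: z w => ? ? []. Qed.

Lemma ReD z w : complex.Re (z + w) = complex.Re z + complex.Re w.
Proof. by case: z w => ? ? []. Qed.

Lemma ImD z w : complex.Im (z + w) = complex.Im z + complex.Im w.
Proof. by case: z w => ? ? []. Qed.

Lemma ReMr z r : complex.Re (z * r%:C) = complex.Re z * r.
Proof. by case: z => a b /=; rewrite mulr0 subr0. Qed.

Lemma ImMr z r : complex.Im (z * r%:C) = complex.Im z * r.
Proof. by case: z => a b /=; rewrite mulr0 add0r. Qed.

Lemma Re_le_cabs z : `|complex.Re z| <= cabs z.
Proof. by rewrite -ofreal_le cabsE normc_ge_Re. Qed.

Lemma Im_le_cabs z : `|complex.Im z| <= cabs z.
Proof.
rewrite -(@ler_pXn2r _ 2%N) ?nnegrE ?cabs_ge0// cabs_sqr /sqmod.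
by rewrite real_normK ?num_real// lerDr sqr_ge0.
Qed.

Lemma cabs_le_ReIm z : cabs z <= `|complex.Re z| + `|complex.Im z|.
Proof.
rewrite -(@ler_pXn2r _ 2%N) ?nnegrE ?cabs_ge0 ?addr_ge0// cabs_sqr /sqmod.
rewrite sqrrD -[X in X + _ <= _]real_normK ?num_real//.
rewrite -[X in _ + X <= _]real_normK ?num_real//.
by rewrite addrAC lerDl mulrn_wge0// mulr_ge0.
Qed.

(** In the order of [R[i]], [0 < e] forces a zero imaginary part. Complex epsilons and radii are
    therefore real ones, which is what translates the topology of [R[i]] into estimates on
    [cabs]. *)
Lemma gt0_ofreal (e : R[i]) : 0 < e -> exists2 r, 0 < r & e = r%:C.
Proof.
move=> e0; exists (complex.Re e); last by rewrite RRe_real// gtr0_real.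
by case: e e0 => a b; rewrite ltcE /= => /andP[].
Qed.

Lemma cvg_cabs {T : Type} {F : set_system T} {FF : Filter F} (f : T -> R[i]) z :
  (f @ F --> z) <-> (forall e, 0 < e -> \forall t \near F, cabs (f t - z) < e).
Proof.
have E := @cvgrPdist_lt R[i] (R[i])^o T F FF f z.
split=> [/E h e e0|h].
  have := h e%:C; rewrite ltcR => /(_ e0); apply: filterS => t.
  by rewrite -cabsE ltcR cabs_dist.
apply/E => _ /gt0_ofreal[e e0 ->].
by apply: filterS (h e e0) => t; rewrite -cabsE ltcR cabs_dist.
Qed.

Lemma nbhs_cabs z (P : set R[i]) :
  nbhs z P <-> exists2 e, 0 < e & forall w, cabs (w - z) < e -> P w.
Proof.
have E := @nbhs_ballP R[i] (R[i])^o z P.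
split=> [|[e e0 H]].
  move=> /E[e /= /gt0_ofreal[r r0 ->] H]; exists r => // w wz; apply: H.
  by rewrite -ball_normE /= -cabsE ltcR cabs_dist.
apply/E; exists e%:C => /=; first by rewrite ltcR.
by move=> w; rewrite -ball_normE /= -cabsE ltcR cabs_dist; exact: H.
Qed.

Lemma cvg_ReIm {T : Type} {F : set_system T} {FF : Filter F} (f g : T -> R) (a b : R) :
  f @ F --> a -> g @ F --> b -> (fun t => f t +i* g t) @ F --> a +i* b.
Proof.
move=> /cvgrPdist_lt fa /cvgrPdist_lt gb; apply/cvg_cabs => e e0.
have e20 : 0 < e / 2 by rewrite divr_gt0.
near=> t; apply: le_lt_trans (cabs_le_ReIm _) _ => /=.
rewrite [e]splitr; apply: ltrD; rewrite distrC; near: t;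
  [exact: fa|exact: gb].
Unshelve. all: by end_near. Qed.

Lemma cvg_Re {T : Type} {F : set_system T} {FF : Filter F} (f : T -> R[i]) z :
  f @ F --> z -> complex.Re (f t) @[t --> F] --> complex.Re z.
Proof.
move=> /cvg_cabs fz; apply/cvgrPdist_lt => e e0.
apply: filterS (fz e e0) => t; apply: le_lt_trans; rewrite distrC.
by rewrite (le_trans _ (Re_le_cabs _))// ReB.
Qed.

Lemma cvg_Im {T : Type} {F : set_system T} {FF : Filter F} (f : T -> R[i]) z :
  f @ F --> z -> complex.Im (f t) @[t --> F] --> complex.Im z.
Proof.
move=> /cvg_cabs fz; apply/cvgrPdist_lt => e e0.
apply: filterS (fz e e0) => t; apply: le_lt_trans; rewrite distrC.
by rewrite (le_trans _ (Im_le_cabs _))// ImB.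
Qed.

Lemma cvg_ofreal {T : Type} {F : set_system T} {FF : Filter F} (f : T -> R) (a : R) :
  f @ F --> a -> (f t)%:C @[t --> F] --> a%:C.
Proof. by move=> fa; apply: cvg_ReIm => //; exact: cvg_cst. Qed.

Section ComplexLimits.
Context {T : Type} {F : set_system T} {FF : Filter F}.
Implicit Types (f g : T -> R[i]) (a b : R[i]).

Lemma ccvg_cst a : (fun _ : T => a) @ F --> a.
Proof. exact: cvg_cst. Qed.

Lemma ccvgD f g a b : f @ F --> a -> g @ F --> b ->
  (fun t => f t + g t) @ F --> a + b.
Proof. exact: (@cvgD R[i] (R[i])^o). Qed.

Lemma ccvgN f a : f @ F --> a -> (fun t => - f t) @ F --> - a.
Proof. exact: (@cvgN R[i] (R[i])^o). Qed.

Lemma ccvgB f g a b : f @ F --> a -> g @ F --> b ->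
  (fun t => f t - g t) @ F --> a - b.
Proof. move=> fa gb; apply: (ccvgD fa); exact: ccvgN gb. Qed.

Lemma ccvgM f g a b : f @ F --> a -> g @ F --> b ->
  (fun t => f t * g t) @ F --> a * b.
Proof. exact: (@cvgM R[i]). Qed.

Lemma ccvgV f a : a != 0 -> f @ F --> a -> (fun t => (f t)^-1) @ F --> a^-1.
Proof. exact: (@cvgV R[i]). Qed.

Lemma ccvg_near_eq f g a : (\forall t \near F, f t = g t) ->
  g @ F --> a -> f @ F --> a.
Proof.
move=> fg; apply: cvg_trans; apply: near_eq_cvg.
by apply: filterS fg => t ->.
Qed.

End ComplexLimits.


End ComplexModulus.

Arguments ccvg_cst {R T F FF} a.

(* Complex differentiability in Caratheodory's form: the difference quotient
   extends continuously. *)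
Definition cdifferential {R : realType} (g : R[i] -> R[i]) z (d : R[i]) :=
  exists G : R[i] -> R[i], [/\ G @ z --> d, G z = d &
    \forall w \near z, g w = g z + G w * (w - z)].

(** The same form for a complex function of two real parameters. It is stable under products and
    under composition with complex differentiable functions, and its real and imaginary parts are
    differentiable in the sense of [differential2]. *)
Definition cdifferential2 {R : realType} (f : R -> R -> R[i]) x0 y0 (A B : R[i]) :=
  exists a b : R * R -> R[i], [/\ a @ (x0, y0) --> A, b @ (x0, y0) --> B &
    \forall q \near (x0, y0),
      f q.1 q.2 = f x0 y0 + a q * (q.1 - x0)%:C + b q * (q.2 - y0)%:C].

Section ComplexDifferential.
Context {R : realType}.
Implicit Types (f g : R[i] -> R[i]) (z w d : R[i]).

Lemma cdifferential_continuous g z d : cdifferential g z d ->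
  g @ z --> g z.
Proof.
move=> [G [Gd _ gG]].
pose proof (ccvgD (ccvg_cst (g z))
  (ccvgM Gd (ccvgB (@cvg_id _ (nbhs z)) (ccvg_cst z)))) as h.
by rewrite subrr mulr0 addr0 in h; exact (ccvg_near_eq gG h).
Qed.

Lemma cdifferential_inv c z : z != c ->
  cdifferential (fun w => (w - c)^-1) z (- (z - c)^-1 ^+ 2).
Proof.
move=> zc; have zc0 : z - c != 0 by rewrite subr_eq0.
exists (fun w => - ((z - c)^-1 * (w - c)^-1)); rewrite expr2; split.
- exact (ccvgN (ccvgM (ccvg_cst _)
    (ccvgV zc0 (ccvgB (@cvg_id _ (nbhs z)) (ccvg_cst c))))).
- by [].
- 
have : \forall w \near z, w != c.
  apply/nbhs_cabs; exists (cabs (z - c)) => [|w].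
    by rewrite lt_neqAle cabs_ge0 eq_sym cabs_eq0 zc0.
  by apply: contraTneq => ->; rewrite cabs_dist ltxx.
apply: filterS => w wc; have wc0 : w - c != 0 by rewrite subr_eq0.
by field; rewrite zc0 wc0.
Qed.

Lemma cdifferential_id z : cdifferential id z 1.
Proof.
exists (fun=> 1); split; [exact (ccvg_cst (F := nbhs z) _)|by []|].
by near=> w; rewrite mul1r addrC subrK.
Unshelve. all: by end_near. Qed.

Lemma cdifferential_cst c z : cdifferential (fun=> c) z 0.
Proof.
exists (fun=> 0); split; [exact (ccvg_cst (F := nbhs z) _)|by []|].
by near=> w; rewrite mul0r addr0.
Unshelve. all: by end_near. Qed.

Lemma cdifferentialM f g z df dg : cdifferential f z df -> cdifferential g z dg ->
  cdifferential (fun w => f w * g w) z (df * g z + f z * dg).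
Proof.
move=> cf [G [Gd Gz gG]]; have := cdifferential_continuous cf.
case: cf => F' [Fd Fz fF] fc.
exists (fun w => F' w * g z + f w * G w); split.
- exact (ccvgD (ccvgM Fd (ccvg_cst _)) (ccvgM fc Gd)).
- by rewrite Fz Gz.
- by near=> w; rewrite (near gG w)// [in LHS](near fF w)//
    [f w in RHS](near fF w)//; ring.
Unshelve. all: by end_near. Qed.

Lemma cdifferential_comp f g z df dg : cdifferential f (g z) df ->
  cdifferential g z dg -> cdifferential (f \o g) z (df * dg).
Proof.
move=> [F' [Fd Fz fF]] cg; have gc := cdifferential_continuous cg.
case: cg => G [Gd Gz gG].
exists (fun w => F' (g w) * G w); split.
- exact (ccvgM (cvg_comp _ _ gc Fd) Gd).
- by rewrite Fz Gz.
- have fFg : \forall w \near z, f (g w) = f (g z) + F' (g w) * (g w - g z).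
    exact: gc fF.
  near=> w => /=; rewrite [LHS](near fFg w)//; congr (_ + _); rewrite -mulrA.
  by congr (_ * _); rewrite (near gG w)// addrC addKr.
Unshelve. all: by end_near. Qed.

End ComplexDifferential.

Section ComplexDifferential2.
Context {R : realType}.
Implicit Types (f g : R -> R -> R[i]) (x y : R) (A B : R[i]).

Lemma cdifferential2_Re f x y A B : cdifferential2 f x y A B ->
  differential2 (fun s t => complex.Re (f s t)) x y (complex.Re A) (complex.Re B).
Proof.
move=> [a [b [aA bB fab]]] e e0.
pose proof (cvg_Re aA) as ha; move/cvgrPdist_le: ha => /(_ _ e0) aAe.
pose proof (cvg_Re bB) as hb; move/cvgrPdist_le: hb => /(_ _ e0) bBe.
pose proof (filterI fab (filterI aAe bBe)) as h; move/nbhs_ballP: h => [d /= d0 H].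
exists d => // s t sx ty.
have [] := H (s, t); first by split; rewrite /= -ball_normE /= distrC.
move=> /= -> [ae be].
rewrite (_ : _ - _ - _ - _ = (complex.Re (a (s, t)) - complex.Re A) * (s - x) +
  (complex.Re (b (s, t)) - complex.Re B) * (t - y)); last first.
  by rewrite !ReD !ReMr; ring.
apply: (le_trans (ler_normD _ _)); rewrite [e * _]mulrDr.
by apply: lerD; rewrite normrM; apply: ler_wpM2r => //; rewrite distrC.
Qed.

Lemma cdifferential2_Im f x y A B : cdifferential2 f x y A B ->
  differential2 (fun s t => complex.Im (f s t)) x y (complex.Im A) (complex.Im B).
Proof.
move=> [a [b [aA bB fab]]] e e0.
pose proof (cvg_Im aA) as ha; move/cvgrPdist_le: ha => /(_ _ e0) aAe.
pose proof (cvg_Im bB) as hb; move/cvgrPdist_le: hb => /(_ _ e0) bBe.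
pose proof (filterI fab (filterI aAe bBe)) as h; move/nbhs_ballP: h => [d /= d0 H].
exists d => // s t sx ty.
have [] := H (s, t); first by split; rewrite /= -ball_normE /= distrC.
move=> /= -> [ae be].
rewrite (_ : _ - _ - _ - _ = (complex.Im (a (s, t)) - complex.Im A) * (s - x) +
  (complex.Im (b (s, t)) - complex.Im B) * (t - y)); last first.
  by rewrite !ImD !ImMr; ring.
apply: (le_trans (ler_normD _ _)); rewrite [e * _]mulrDr.
by apply: lerD; rewrite normrM; apply: ler_wpM2r => //; rewrite distrC.
Qed.

Lemma cdifferential2_continuous f x y A B : cdifferential2 f x y A B ->
  (fun q : R * R => f q.1 q.2) @ (x, y) --> f x y.
Proof.
move=> [a [b [aA bB fab]]].
have hx : (fun q : R * R => (q.1 - x)%:C) @ (x, y) --> (x - x)%:C.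
  by apply: cvg_ofreal; apply: cvgB; [exact: cvg_fst|exact: cvg_cst].
have hy : (fun q : R * R => (q.2 - y)%:C) @ (x, y) --> (y - y)%:C.
  by apply: cvg_ofreal; apply: cvgB; [exact: cvg_snd|exact: cvg_cst].
pose proof (ccvgD (ccvgD (ccvg_cst (f x y)) (ccvgM aA hx)) (ccvgM bB hy)) as h.
by rewrite !subrr !mulr0 !addr0 in h; exact (ccvg_near_eq fab h).
Qed.

Lemma cdifferential2_cst c x y : cdifferential2 (fun _ _ => c) x y 0 0.
Proof.
exists (fun=> 0), (fun=> 0); split; [exact (ccvg_cst _)..|].
by near=> q; rewrite !mul0r !addr0.
Unshelve. all: by end_near. Qed.

Lemma cdifferential2D f g x y A B C D : cdifferential2 f x y A B ->
  cdifferential2 g x y C D ->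
  cdifferential2 (fun s t => f s t + g s t) x y (A + C) (B + D).
Proof.
move=> [a [b [aA bB fab]]] [c [d [cC dD gcd]]].
exists (fun q => a q + c q), (fun q => b q + d q); split;
  [exact (ccvgD aA cC)|exact (ccvgD bB dD)|].
by near=> q; rewrite (near fab q)// (near gcd q)//; ring.
Unshelve. all: by end_near. Qed.

Lemma cdifferential2M f g x y A B C D : cdifferential2 f x y A B ->
  cdifferential2 g x y C D ->
  cdifferential2 (fun s t => f s t * g s t) x y
    (A * g x y + f x y * C) (B * g x y + f x y * D).
Proof.
move=> df [c [d [cC dD gcd]]]; have fc := cdifferential2_continuous df.
case: df => a [b [aA bB fab]].
exists (fun q => a q * g x y + f q.1 q.2 * c q),
  (fun q => b q * g x y + f q.1 q.2 * d q); split.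
- exact (ccvgD (ccvgM aA (ccvg_cst _)) (ccvgM fc cC)).
- exact (ccvgD (ccvgM bB (ccvg_cst _)) (ccvgM fc dD)).
- near=> q; rewrite (near gcd q)// mulrDr mulrDr.
  by rewrite [in f _ _ * g x y](near fab q)//; ring.
Unshelve. all: by end_near. Qed.

Lemma cdifferential2_comp (g : R[i] -> R[i]) f x y A B d :
  cdifferential g (f x y) d -> cdifferential2 f x y A B ->
  cdifferential2 (fun s t => g (f s t)) x y (d * A) (d * B).
Proof.
move=> [G [Gd Gz gG]] df; have fc := cdifferential2_continuous df.
case: df => a [b [aA bB fab]].
exists (fun q => G (f q.1 q.2) * a q), (fun q => G (f q.1 q.2) * b q); split.
- exact (ccvgM (cvg_comp _ _ fc Gd) aA).
- exact (ccvgM (cvg_comp _ _ fc Gd) bB).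
- have gGf : \forall q \near (x, y), g (f q.1 q.2) =
      g (f x y) + G (f q.1 q.2) * (f q.1 q.2 - f x y).
    exact: fc gG.
  near=> q; rewrite (near gGf q)// -addrA; congr (_ + _).
  by rewrite [X in _ * (X - _)](near fab q)//; ring.
Unshelve. all: by end_near. Qed.

Lemma caratheodory_derivative (u : R -> R) x d : is_derive x 1 u d ->
  exists a : R -> R, a @ x --> d /\ forall s, u s = u x + a s * (s - x).
Proof.
move=> [du ud].
exists (fun s => if s == x then d else (u s - u x) / (s - x)); split; last first.
  move=> s; case: eqVneq => [->|sx]; first by rewrite subrr mulr0 addr0.
  by rewrite divfK ?subr_eq0// addrC subrK.
move: du; rewrite /derivable => /cvg_ex[/= l ul].
have ld : l = d by rewrite -ud /derive; apply/esym/cvg_lim.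
move/cvgrPdist_le : ul => ul.
apply/cvgrPdist_le => e e0; have := ul e e0.
move=> [r /= r0 H]; exists r => //= s /= sr.
case: eqVneq => [_|sx]; first by rewrite subrr normr0 ltW.
have := H (s - x); rewrite /= sub0r normrN distrC => /(_ sr).
by rewrite subr_eq0 => /(_ sx); rewrite /GRing.scale /= mulr1 subrK ld mulrC.
Qed.

Lemma cdifferential2_fst (u v : R -> R) x y du dv :
  is_derive x 1 u du -> is_derive x 1 v dv ->
  cdifferential2 (fun s _ => u s +i* v s) x y (du +i* dv) 0.
Proof.
move=> /caratheodory_derivative[a [ad ua]] /caratheodory_derivative[b [bd vb]].
exists (fun q => a q.1 +i* b q.1), (fun=> 0); split.
- apply: cvg_ReIm.
    by apply: (@cvg_comp _ _ _ fst a _ (nbhs x)); [exact: cvg_fst|exact: ad].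
  by apply: (@cvg_comp _ _ _ fst b _ (nbhs x)); [exact: cvg_fst|exact: bd].
- exact (ccvg_cst _).
- near=> q => /=; rewrite [in LHS]ua [in LHS]vb mul0r addr0.
  by apply/eqP; rewrite eq_complex /=; apply/andP; split; apply/eqP; ring.
Unshelve. all: by end_near. Qed.

Lemma cdifferential2_snd (u v : R -> R) x y du dv :
  is_derive y 1 u du -> is_derive y 1 v dv ->
  cdifferential2 (fun _ s => u s +i* v s) x y 0 (du +i* dv).
Proof.
move=> /caratheodory_derivative[a [ad ua]] /caratheodory_derivative[b [bd vb]].
exists (fun=> 0), (fun q => a q.2 +i* b q.2); split.
- exact (ccvg_cst _).
- apply: cvg_ReIm.
    by apply: (@cvg_comp _ _ _ snd a _ (nbhs y)); [exact: cvg_snd|exact: ad].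
  by apply: (@cvg_comp _ _ _ snd b _ (nbhs y)); [exact: cvg_snd|exact: bd].
- near=> q => /=; rewrite [in LHS]ua [in LHS]vb mul0r addr0.
  by apply/eqP; rewrite eq_complex /=; apply/andP; split; apply/eqP; ring.
Unshelve. all: by end_near. Qed.

End ComplexDifferential2.

(** * Integrals of complex functions over an interval *)

Section ComplexIntervalIntegral.
Context {R : realType}.
Implicit Types (a b : R) (f g : R -> R[i]) (c : R[i]).

Definition cint a b f : R[i] := locked
  (itg a b (fun t => complex.Re (f t)) +i* itg a b (fun t => complex.Im (f t))).

Definition ccontinuous_itv a b f := forall x, a <= x <= b -> f @ x --> f x.

Lemma ccontinuous_itv_Re a b f : ccontinuous_itv a b f ->
  continuous_itv a b (fun t => complex.Re (f t)).
Proof. by move=> cf x /cf h; exact (cvg_Re h). Qed.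

Lemma ccontinuous_itv_Im a b f : ccontinuous_itv a b f ->
  continuous_itv a b (fun t => complex.Im (f t)).
Proof. by move=> cf x /cf h; exact (cvg_Im h). Qed.

Lemma Re_cint a b f :
  complex.Re (cint a b f) = itg a b (fun t => complex.Re (f t)).
Proof. by rewrite /cint -lock. Qed.

Lemma Im_cint a b f :
  complex.Im (cint a b f) = itg a b (fun t => complex.Im (f t)).
Proof. by rewrite /cint -lock. Qed.

Lemma complex_ext (z w : R[i]) : complex.Re z = complex.Re w ->
  complex.Im z = complex.Im w -> z = w.
Proof. by case: z w => ? ? [? ?] /= -> ->. Qed.

Lemma eq_cint a b f g : (forall x, a <= x <= b -> f x = g x) ->
  cint a b f = cint a b g.
Proof.
move=> fg; apply: complex_ext; rewrite ?Re_cint ?Im_cint; apply: eq_itg => x xI;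
  by rewrite fg.
Qed.

Lemma ccontinuous_itvD a b f g : ccontinuous_itv a b f ->
  ccontinuous_itv a b g -> ccontinuous_itv a b (fun t => f t + g t).
Proof. move=> cf cg x xI; exact (ccvgD (cf x xI) (cg x xI)). Qed.

Lemma ccontinuous_itvB a b f g : ccontinuous_itv a b f ->
  ccontinuous_itv a b g -> ccontinuous_itv a b (fun t => f t - g t).
Proof. move=> cf cg x xI; exact (ccvgB (cf x xI) (cg x xI)). Qed.

Lemma ccontinuous_itvM a b f g : ccontinuous_itv a b f ->
  ccontinuous_itv a b g -> ccontinuous_itv a b (fun t => f t * g t).
Proof. move=> cf cg x xI; exact (ccvgM (cf x xI) (cg x xI)). Qed.

Lemma ccontinuous_itv_cst a b c : ccontinuous_itv a b (fun=> c).
Proof. move=> x xI; exact (ccvg_cst _). Qed.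

Lemma ccontinuous_itvX a b f n : ccontinuous_itv a b f ->
  ccontinuous_itv a b (fun t => f t ^+ n).
Proof.
move=> cf; elim: n => [|n ih]; first exact: ccontinuous_itv_cst.
move=> x xI; have := ccontinuous_itvM cf ih xI.
by under eq_fun do rewrite -exprS; rewrite -exprS.
Qed.

Lemma cintD a b f g : ccontinuous_itv a b f -> ccontinuous_itv a b g ->
  cint a b (fun t => f t + g t) = cint a b f + cint a b g.
Proof.
move=> cf cg; apply: complex_ext; rewrite ?ReD ?ImD ?Re_cint ?Im_cint -itgD;
  try (exact: ccontinuous_itv_Re || exact: ccontinuous_itv_Im);
  by apply: eq_itg => x _; rewrite ?ReD ?ImD.
Qed.

Lemma cintZ a b c f : ccontinuous_itv a b f ->
  cint a b (fun t => c * f t) = c * cint a b f.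
Proof.
move=> cf; have cr := ccontinuous_itv_Re cf; have ci := ccontinuous_itv_Im cf.
have zr k : continuous_itv a b (fun t => k * complex.Re (f t)).
  by apply: continuous_itvM => //; exact: continuous_itv_cst.
have zi k : continuous_itv a b (fun t => k * complex.Im (f t)).
  by apply: continuous_itvM => //; exact: continuous_itv_cst.
have mulRe (z w : R[i]) : complex.Re (z * w) =
    complex.Re z * complex.Re w - complex.Im z * complex.Im w.
  by case: z w => ? ? [].
have mulIm (z w : R[i]) : complex.Im (z * w) =
    complex.Re z * complex.Im w + complex.Im z * complex.Re w.
  by case: z w => ? ? [].
apply: complex_ext.
  rewrite mulRe !Re_cint !Im_cint -(itgZ _ cr) -(itgZ _ ci) -itgB; [|exact: zr|exact: zi].
  by apply: eq_itg => x _; rewrite mulRe.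
rewrite mulIm !Re_cint !Im_cint -(itgZ _ ci) -(itgZ _ cr) -itgD; [|exact: zi|exact: zr].
by apply: eq_itg => x _; rewrite mulIm.
Qed.

Lemma cintB a b f g : ccontinuous_itv a b f -> ccontinuous_itv a b g ->
  cint a b (fun t => f t - g t) = cint a b f - cint a b g.
Proof.
move=> cf cg.
have cN := ccontinuous_itvM (@ccontinuous_itv_cst a b (-1)) cg.
rewrite -[- cint a b g]mulN1r -(cintZ (-1) cg) -(cintD cf cN).
by apply: eq_cint => x _; rewrite mulN1r.
Qed.

Lemma cint_cst a b c : a <= b -> cint a b (fun=> c) = (b - a)%:C * c.
Proof.
move=> ab; apply: complex_ext; rewrite [X in _ = _ X]mulrC.
  by rewrite ReMr Re_cint itg_cst.
by rewrite ImMr Im_cint itg_cst.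
Qed.

Lemma ccontinuous_itv_sum a b (F : nat -> R -> R[i]) n :
  (forall k, ccontinuous_itv a b (F k)) ->
  ccontinuous_itv a b (fun t => \sum_(k < n) F k t).
Proof.
move=> cF; elim: n => [|n ih] x xI.
  by under eq_fun do rewrite big_ord0; rewrite big_ord0; exact (ccvg_cst _).
under eq_fun do rewrite big_ord_recr /=; rewrite big_ord_recr /=.
exact (ccvgD (ih x xI) (cF n x xI)).
Qed.

Lemma cint_sum a b (F : nat -> R -> R[i]) n : a <= b ->
  (forall k, ccontinuous_itv a b (F k)) ->
  cint a b (fun t => \sum_(k < n) F k t) = \sum_(k < n) cint a b (F k).
Proof.
move=> ab cF; elim: n => [|n ih].
  by under eq_cint do rewrite big_ord0; rewrite big_ord0 (cint_cst _ ab) mulr0.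
under eq_cint do rewrite big_ord_recr /=; rewrite big_ord_recr /=.
rewrite cintD; [by rewrite ih|exact: ccontinuous_itv_sum|exact: cF].
Qed.

(** The factor 2 comes from bounding the real and imaginary parts separately; only the existence of
    such a constant matters later. *)
Lemma cabs_cint_le a b f M : a <= b -> ccontinuous_itv a b f ->
  (forall x, a <= x <= b -> cabs (f x) <= M) ->
  cabs (cint a b f) <= 2 * M * (b - a).
Proof.
move=> ab cf fM; rewrite (le_trans (cabs_le_ReIm _))// mulrAC mulrC mulrA.
rewrite -(mulrC 2) mulr_natl mulr2n mulrDl Re_cint Im_cint; apply: lerD.
- have := @itg_near_cst _ a b 0 M (fun t => complex.Re (f t)) ab.
  rewrite mul0r subr0 mulrC; apply; first exact: ccontinuous_itv_Re.
  by move=> x /fM; rewrite subr0; exact/le_trans/Re_le_cabs.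
- have := @itg_near_cst _ a b 0 M (fun t => complex.Im (f t)) ab.
  rewrite mul0r subr0 mulrC; apply; first exact: ccontinuous_itv_Im.
  by move=> x /fM; rewrite subr0; exact/le_trans/Im_le_cabs.
Qed.

Lemma ccontinuous_itv_bounded a b f : a <= b -> ccontinuous_itv a b f ->
  exists2 M, 0 <= M & forall x, a <= x <= b -> cabs (f x) <= M.
Proof.
move=> ab cf.
have bnd (u : R -> R) : continuous_itv a b u ->
    exists M, forall x, a <= x <= b -> `|u x| <= M.
  move=> cu; have [|c _ H] := @EVT_max R (fun x => `|u x|) a b ab.
    apply: continuous_in_subspaceT => x; rewrite inE/= in_itv/= => abx.
    by apply: continuous_comp; [exact: cu|exact: norm_continuous].
  by exists `|u c| => x xI; apply: H; rewrite in_itv.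
have [M1 H1] := bnd _ (ccontinuous_itv_Re cf).
have [M2 H2] := bnd _ (ccontinuous_itv_Im cf).
have le x : a <= x <= b -> cabs (f x) <= M1 + M2.
  by move=> xI; rewrite (le_trans (cabs_le_ReIm _))// lerD ?H1 ?H2.
exists (M1 + M2) => //.
by rewrite (le_trans (cabs_ge0 (f a)))// le// lexx.
Qed.

Lemma cdifferential2_continuousr (f : R -> R -> R[i]) x y A B :
  cdifferential2 f x y A B -> f x @ y --> f x y.
Proof.
move=> df.
have h : (fun t : R => (x, t)) @ y --> (x, y).
  exact (@cvg_pair _ _ _ (nbhs y) (nbhs x) (nbhs y) _ _ _ _ _
    (cvg_cst x) (@cvg_id _ (nbhs y))).
exact (cvg_comp _ _ h (cdifferential2_continuous df)).
Qed.

(* The closed form [P dx + Q dy] has the same integral over both ends of a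
   cylinder. *)
Lemma goursat_periodic (P Q : R -> R -> R[i]) (a b c d : R) : a <= b -> c <= d ->
  (forall x y, a <= x <= b -> c <= y <= d ->
     exists A B C, cdifferential2 P x y A B /\ cdifferential2 Q x y B C) ->
  (forall x, P x c = P x d) ->
  cint c d (Q a) = cint c d (Q b).
Proof.
move=> ab cd H per.
have cQ x : a <= x <= b -> ccontinuous_itv c d (Q x).
  move=> xI y yI; have [A [B [C [_ h]]]] := H x y xI yI.
  exact: cdifferential2_continuousr h.
have aI : a <= a <= b by rewrite lexx.
have bI : a <= b <= b by rewrite lexx andbT.
apply: complex_ext.
- have := @goursat_rectangle R (fun s t => complex.Re (P s t))
    (fun s t => complex.Re (Q s t)) a b c d.
  move=> /(_ _ ab cd) h; apply/esym/eqP; rewrite -subr_eq0 !Re_cint -itgB;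
    try by apply: ccontinuous_itv_Re; exact: cQ.
  (* By periodicity the two sides along which [P] is integrated cancel, so Goursat's identity
     reduces to the two sides carrying [Q]. *)
  rewrite -[X in X == _]add0r -[X in X + _](_ : itg a b (fun=> 0) = 0); last first.
    by rewrite itg_cst// mul0r.
  rewrite (_ : itg a b (fun=> 0) =
    itg a b (fun x => complex.Re (P x c) - complex.Re (P x d))); last first.
    by apply: eq_itg => x _; rewrite per subrr.
  apply/eqP; apply: h => x y xI yI; have [A [B [C [h1 h2]]]] := H x y xI yI.
  exists (complex.Re A), (complex.Re B), (complex.Re C).
  by split; exact: cdifferential2_Re.
- have := @goursat_rectangle R (fun s t => complex.Im (P s t))
    (fun s t => complex.Im (Q s t)) a b c d.
  move=> /(_ _ ab cd) h; apply/esym/eqP; rewrite -subr_eq0 !Im_cint -itgB;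
    try by apply: ccontinuous_itv_Im; exact: cQ.
  rewrite -[X in X == _]add0r -[X in X + _](_ : itg a b (fun=> 0) = 0); last first.
    by rewrite itg_cst// mul0r.
  rewrite (_ : itg a b (fun=> 0) =
    itg a b (fun x => complex.Im (P x c) - complex.Im (P x d))); last first.
    by apply: eq_itg => x _; rewrite per subrr.
  apply/eqP; apply: h => x y xI yI; have [A [B [C [h1 h2]]]] := H x y xI yI.
  exists (complex.Im A), (complex.Im B), (complex.Im C).
  by split; exact: cdifferential2_Im.
Qed.

End ComplexIntervalIntegral.

(** * The unit circle and orthogonality of its characters *)

Section UnitCircle.
Context {R : realType}.

Definition expi (t : R) : R[i] := cos t +i* sin t.

Lemma expi0 : expi 0 = 1.
Proof. by rewrite /expi cos0 sin0. Qed.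

Lemma expi2pi : expi (2 * pi) = 1.
Proof. by rewrite /expi mulr_natl cos2pi sin2pi. Qed.

Lemma expiD s t : expi (s + t) = expi s * expi t.
Proof.
rewrite /expi cosD sinD; apply: complex_ext => //=.
by rewrite addrC; congr (_ + _); rewrite mulrC.
Qed.

Lemma expiX t n : expi t ^+ n = expi (n%:R * t).
Proof.
elim: n => [|n ih]; first by rewrite expr0 mul0r expi0.
by rewrite exprS ih -expiD -natr1 mulrDl mul1r addrC.
Qed.

Lemma expi_expiN t : expi t * expi (- t) = 1.
Proof. by rewrite -expiD subrr expi0. Qed.

Lemma expi_neq0 t : expi t != 0.
Proof.
apply/eqP => h; have := expi_expiN t; rewrite h mul0r => /eqP.
by rewrite eq_sym oner_eq0.
Qed.

Lemma expiV t : (expi t)^-1 = expi (- t).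
Proof.
by rewrite -[LHS]mulr1 -(expi_expiN t) mulKf// expi_neq0.
Qed.

Lemma cabs_expi t : cabs (expi t) = 1.
Proof.
apply/eqP; rewrite -(@eqrXn2 _ 2%N) ?cabs_ge0//; apply/eqP.
by rewrite cabs_sqr /sqmod /= cos2Dsin2 expr1n.
Qed.

Lemma expi_cvg (t : R) : expi @ t --> expi t.
Proof. by apply: cvg_ReIm; [exact: continuous_cos|exact: continuous_sin]. Qed.

Lemma itg_FTC (a b : R) (f F : R -> R) : a < b ->
  (forall x : R, is_derive x (1 : R) F (f x)) -> continuous f -> itg a b f = F b - F a.
Proof.
move=> ab dF cf.
have cF : continuous F.
  move=> x; apply: differentiable_continuous; apply/derivable1_diffP.
  by have [] := dF x.
rewrite /itg /Rintegral (@continuous_FTC2 _ f F a b)//.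
- exact: continuous_subspaceT.
- split; [by move=> x _; have [] := dF x| |].
    exact: cvg_at_right_filter (cF a).
  exact: cvg_at_left_filter (cF b).
- move=> x _; rewrite derive1E; exact: (@derive_val _ _ _ _ _ _ _ (dF x)).
Qed.

Lemma cint_expi_freq (k : R) : k != 0 -> expi (k * (2 * pi)) = 1 ->
  cint 0 (2 * pi) (fun t => expi (k * t)) = 0.
Proof.
move=> kn0 [per2 per1].
have pi2 : 0 < 2 * pi :> R by rewrite mulr_gt0// pi_gt0.
have cc : continuous (fun t : R => k * t).
  by move=> t; apply: cvgM; [exact: cvg_cst|exact: cvg_id].
apply: complex_ext; rewrite ?Re_cint ?Im_cint /=.
- have dF (x : R) : is_derive x (1 : R) (fun t => k^-1 * sin (k * t))
      (cos (k * x)).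
    apply: is_derive_eq.
    by rewrite /GRing.scale/= !(mulr1,mulr0,addr0) mulrCA mulVf ?mulr1.
  rewrite (itg_FTC pi2 dF); first by rewrite per1 !mulr0 sin0 mulr0 subrr.
  by move=> t; apply: continuous_comp; [exact: cc|exact: continuous_cos].
- have dF (x : R) : is_derive x (1 : R) (fun t => - (k^-1 * cos (k * t)))
      (sin (k * x)).
    apply: is_derive_eq.
    by rewrite /GRing.scale/= !(mulr1,mulr0,addr0); field.
  rewrite (itg_FTC pi2 dF); first by rewrite per2 !mulr0 cos0 subrr.
  by move=> t; apply: continuous_comp; [exact: cc|exact: continuous_sin].
Qed.

Lemma cint_expi_ortho j k :
  cint 0 (2 * pi) (fun t => expi t ^+ j * (expi t)^-1 ^+ k) =
  (if j == k then (2 * pi)%:C else 0).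
Proof.
have E t : expi t ^+ j * (expi t)^-1 ^+ k = expi ((j%:R - k%:R) * t).
  by rewrite expiV !expiX -expiD mulrN mulrBl.
rewrite (eq_cint (g := fun t => expi ((j%:R - k%:R) * t))); last first.
  by move=> t _; exact: E.
have pi2 : 0 <= 2 * pi :> R by rewrite mulr_ge0// pi_ge0.
case: eqVneq => [->|jk].
  rewrite (eq_cint (g := fun=> 1)); last by move=> t _; rewrite subrr mul0r expi0.
  by rewrite (cint_cst _ pi2) subr0 mulr1.
apply: cint_expi_freq; first by rewrite subr_eq0 eqr_nat.
by rewrite -E expi2pi invr1 !expr1n mulr1.
Qed.

End UnitCircle.

(** * Cauchy's formula on the unit disc *)

Section Cauchy.
Context {R : realType}.
Implicit Types (g h : R[i] -> R[i]) (z w : R[i]).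

Lemma cdifferential2_eq (f : R -> R -> R[i]) x y A B A' B' :
  cdifferential2 f x y A B -> A = A' -> B = B' -> cdifferential2 f x y A' B'.
Proof. by move=> ? <- <-. Qed.

(** A contraction of the unit circle ([s = 1]) to the point [z] ([s = 0]) along segments. It stays
    in the closed disc when [z] does, and replaces the small circles around [z] of the usual
    proof. *)
Definition homothety z (s t : R) : R[i] := z + s%:C * (expi t - z).

Lemma cdifferential2_expi x y :
  cdifferential2 (fun _ t : R => expi t) x y 0 ('i * expi y).
Proof.
have := @cdifferential2_snd R cos sin x y _ _ (is_derive_cos y) (is_derive_sin y).
move=> /cdifferential2_eq; apply; first by [].
apply: complex_ext => /=; first by rewrite mul0r mul1r sub0r.
by rewrite mul0r mul1r add0r.
Qed.

Lemma cdifferential2_ofreal x y : cdifferential2 (fun s _ : R => s%:C) x y 1 0.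
Proof.
have := @cdifferential2_fst R id (fun=> 0) x y _ _ (is_derive_id x 1)
  (is_derive_cst 0 x 1).
by move=> /cdifferential2_eq; apply.
Qed.

Lemma cdifferential2_homothety z x y :
  cdifferential2 (homothety z) x y (expi y - z) (x%:C * ('i * expi y)).
Proof.
have h1 := cdifferential2D (cdifferential2_expi x y) (cdifferential2_cst (- z) x y).
have h2 := cdifferential2M (cdifferential2_ofreal x y) h1.
have h3 := cdifferential2D (cdifferential2_cst z x y) h2.
move: h3 => /cdifferential2_eq; apply; last by ring.
by ring.
Qed.

Lemma cabs_homothety z s t : 0 <= s -> s <= 1 -> cabs z <= 1 ->
  cabs (homothety z s t) <= 1.
Proof.
move=> s0 s1 z1.
have -> : homothety z s t = (1 - s)%:C * z + s%:C * expi t.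
  by rewrite rmorphB rmorph1 /homothety; ring.
rewrite (le_trans (ler_cabsD _ _))// !cabsM !cabs_ofreal cabs_expi mulr1.
rewrite !ger0_norm ?subr_ge0//.
by rewrite -[leRHS](subrK s 1) lerD2r ler_piMr// subr_ge0.
Qed.

Variable z0 : R[i].
Hypothesis z0_lt1 : cabs z0 < 1.

Lemma expiB_neq0 t : expi t - z0 != 0.
Proof.
apply: contraTneq z0_lt1 => /eqP; rewrite subr_eq0 => /eqP <-.
by rewrite cabs_expi ltxx.
Qed.

(** The Cauchy form [dw / (i (w - z0))] at [w = expi t]. Along [homothety z0 s] both [w - z0] and
    the [t]-derivative of [w] are multiplied by [s], so the quotient does not depend on [s]. *)
Definition cauchy_quotient (t : R) : R[i] := expi t * (expi t - z0)^-1.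

Lemma cdifferential2_quotient x y : exists B,
  cdifferential2 (fun _ t : R => cauchy_quotient t) x y 0 B.
Proof.
have e0 : expi y != z0 by rewrite -subr_eq0 expiB_neq0.
have h := cdifferential2_comp (f := fun _ t => expi t) (x := x)
  (cdifferential_inv e0) (cdifferential2_expi x y).
have h2 := cdifferential2M (cdifferential2_expi x y) h.
eexists; move: h2 => /cdifferential2_eq; apply; last reflexivity.
by rewrite mulr0 mul0r mulr0 addr0.
Qed.

Lemma ccontinuous_quotient a b : ccontinuous_itv a b cauchy_quotient.
Proof.
move=> x _; have [B h] := cdifferential2_quotient 0 x.
exact: cdifferential2_continuousr h.
Qed.

Lemma cabs_quotient t : cabs (cauchy_quotient t) <= (1 - cabs z0)^-1.
Proof.
rewrite cabsM cabs_expi mul1r cabsV lef_pV2 ?posrE ?subr_gt0//.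
  by rewrite -(cabs_expi t) lerB_cabs.
by rewrite lt_neqAle cabs_ge0 eq_sym cabs_eq0 expiB_neq0.
Qed.

Let twopi_ge0 : 0 <= 2 * pi :> R.
Proof. by rewrite mulr_ge0// pi_ge0. Qed.

Section Formula.
Variable g : R[i] -> R[i].
Hypothesis dg : forall w, cabs w <= 1 -> exists d, cdifferential g w d.

Lemma ccontinuous_homothety s a b : 0 <= s <= 1 ->
  ccontinuous_itv a b (fun t => g (homothety z0 s t)).
Proof.
move=> /andP[s0 s1] x _.
have [d hd] := dg (cabs_homothety x s0 s1 (ltW z0_lt1)).
exact: cdifferential2_continuousr (cdifferential2_comp hd (cdifferential2_homothety z0 s x)).
Qed.

(** The closed form [g(w) dw / (i (w - z0))] is pulled back by the homotopy; it is periodic in [t],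
    and [e > 0] avoids the pole at [s = 0]. *)
Lemma cint_homothety_constant e : 0 < e -> e <= 1 ->
  cint 0 (2 * pi) (fun t => g (homothety z0 e t) * cauchy_quotient t) =
  cint 0 (2 * pi) (fun t => g (homothety z0 1 t) * cauchy_quotient t).
Proof.
move=> e0 e1.
(* The [ds] component: [dw / ds = expi t - z0] divided by [w - z0 = s (expi t - z0)] leaves [1 / s],
   and the ['i] is that of the Cauchy form. *)
pose P (s t : R) := g (homothety z0 s t) * ((s%:C - 0)^-1 * ('i)^-1).
apply: (@goursat_periodic R P
  (fun s t => g (homothety z0 s t) * cauchy_quotient t)) => //; last first.
  by move=> x; rewrite /P /homothety expi0 expi2pi.
move=> x y /andP[ex x1] _.
have x0 : 0 < x by exact: lt_le_trans ex.
have [d hd] := dg (cabs_homothety y (ltW x0) x1 (ltW z0_lt1)).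
have hg := cdifferential2_comp hd (cdifferential2_homothety z0 x y).
have xC0 : x%:C != 0.
  by apply/eqP => /(@ofreal_inj R x 0) x00; rewrite x00 ltxx in x0.
have hx := cdifferential2_comp (cdifferential_inv xC0) (cdifferential2_ofreal x y).
have hxi := cdifferential2M hx (cdifferential2_cst ('i)^-1 x y).
have hP := cdifferential2M hg hxi.
have [B hq] := cdifferential2_quotient x y.
have hQ := cdifferential2M hg hq.
have i0 : 'i != 0 :> R[i] by apply/eqP => -[/eqP]; rewrite oner_eq0.
(* The common mixed derivative. For [P], the factor [s 'i expi t] of [dw / dt] cancels against
   [1 / (s 'i)]; for [Q], the factor [expi t - z0] of [dw / ds] cancels against the quotient. *)
eexists; exists (d * expi y); eexists; split.
  move: hP => /cdifferential2_eq; apply; first reflexivity.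
  by rewrite subr0; field; rewrite xC0 i0.
move: hQ => /cdifferential2_eq; apply; last reflexivity.
rewrite mulr0 addr0 /cauchy_quotient.
by field; exact: expiB_neq0.
Qed.

(** The circle may be contracted until [g] is as close to [g z0] as desired, while the kernel stays
    bounded by [(1 - cabs z0)^-1]. *)
Theorem cauchy_kernel :
  cint 0 (2 * pi) (fun t => g (expi t) * cauchy_quotient t) =
  g z0 * cint 0 (2 * pi) cauchy_quotient.
Proof.
have cq := @ccontinuous_quotient 0 (2 * pi).
have gc : (fun t => g (expi t)) = (fun t => g (homothety z0 1 t)).
  by apply/funext => t; rewrite /homothety mul1r addrC subrK.
apply/eqP; rewrite -subr_eq0 -cabs_eq0 eq_le cabs_ge0 andbT leNgt.
apply/negP; set D := cabs _ => D0.
(* [K - 1] is the bound of [cabs_cint_le] for the kernel alone; with [eta = D / (2 * K)] the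
   difference of the two sides would be below its own modulus [D]. *)
pose K := 2 * (1 - cabs z0)^-1 * (2 * pi - 0) + 1.
have K0 : 0 < K.
  rewrite /K subr0 ltr_wpDl// mulr_ge0// mulr_ge0// invr_ge0 subr_ge0.
  exact: ltW.
pose eta := D / (2 * K).
have eta0 : 0 < eta by rewrite divr_gt0// mulr_gt0.
have [d0 hd] := dg (ltW z0_lt1); pose proof (cdifferential_continuous hd) as H.
have [r r0 gr] : exists2 r, 0 < r &
    forall w, cabs (w - z0) < r -> cabs (g w - g z0) < eta.
  apply/nbhs_cabs; exact (proj1 (cvg_cabs (F := nbhs z0) g (g z0)) H eta eta0).
pose e := Num.min 1 (r / 3).
have e0 : 0 < e by rewrite lt_min ltr01 divr_gt0.
have e1 : e <= 1 by rewrite ge_min lexx.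
(* Since [cabs (expi t - z0) < 2], the contracted circle lies within [2 * r / 3] of [z0]. *)
have er : e <= r / 3 by rewrite ge_min lexx orbT.
have close t : cabs (g (homothety z0 e t) - g z0) <= eta.
  apply/ltW/gr; rewrite /homothety addrC addKr cabsM cabs_ofreal gtr0_norm//.
  have := ler_cabsB (expi t) z0; rewrite cabs_expi => h.
  have : e * cabs (expi t - z0) <= r / 3 * 2.
    by apply: ler_pM; rewrite ?cabs_ge0 ?(ltW e0)//; move: z0_lt1 => ?; lra.
  lra.
have eI : 0 <= e <= 1 by rewrite (ltW e0).
have cgh := @ccontinuous_homothety e 0 (2 * pi) eI.
have cghq := ccontinuous_itvM cgh cq.
have cmz := ccontinuous_itvM (@ccontinuous_itv_cst R 0 (2 * pi) (g z0)) cq.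
have cmz' := ccontinuous_itvM
  (ccontinuous_itvD cgh (@ccontinuous_itv_cst R 0 (2 * pi) (- g z0))) cq.
have DE : cint 0 (2 * pi) (fun t => g (expi t) * cauchy_quotient t) -
    g z0 * cint 0 (2 * pi) cauchy_quotient =
    cint 0 (2 * pi) (fun t => (g (homothety z0 e t) - g z0) * cauchy_quotient t).
  rewrite -(cintZ (g z0) cq).
  rewrite (eq_cint (f := fun t => g (expi t) * _)
     (g := fun t => g (homothety z0 1 t) * cauchy_quotient t)); last first.
    by move=> t _; rewrite /homothety mul1r addrC subrK.
  rewrite -(cint_homothety_constant e0 e1) -(cintB cghq cmz).
  by apply: eq_cint => t _; rewrite mulrBl.
have : D <= 2 * (eta * (1 - cabs z0)^-1) * (2 * pi - 0).
  rewrite /D DE; apply: cabs_cint_le => // t _.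
  by rewrite cabsM ler_pM ?cabs_ge0// cabs_quotient.
have -> : 2 * (eta * (1 - cabs z0)^-1) * (2 * pi - 0) = eta * (K - 1).
  by rewrite /K addrK; ring.
apply/negP; rewrite -ltNge.
have : eta * K = D / 2 by rewrite /eta; field; rewrite gt_eqF.
rewrite mulrBr mulr1 => ->; lra.
Qed.

End Formula.

(** Finite geometric expansion of [1 / (1 - z0 / expi t)], with exact remainder. *)
Lemma cauchy_quotient_sum n t : cauchy_quotient t =
  \sum_(k < n) z0 ^+ k * (expi t)^-1 ^+ k +
  z0 ^+ n * (expi t)^-1 ^+ n * cauchy_quotient t.
Proof.
have rec : cauchy_quotient t = 1 + z0 * (expi t)^-1 * cauchy_quotient t.
  rewrite /cauchy_quotient; field.
  by rewrite expi_neq0 expiB_neq0.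
elim: n => [|n ih]; first by rewrite big_ord0 !expr0 mul1r mul1r add0r.
by rewrite big_ord_recr /= [LHS]ih [in LHS]rec !exprSr; ring.
Qed.

Lemma ccontinuous_expiV a b : ccontinuous_itv a b (fun t => (@expi R t)^-1).
Proof.
move=> x _; rewrite expiV.
have -> : (fun t => (@expi R t)^-1) = (fun t => expi (- t)).
  by apply/funext => t; rewrite expiV.
have h : (fun t : R => - t) @ x --> - x by apply: cvgN; exact: cvg_id.
exact (cvg_comp _ _ h (@expi_cvg R (- x))).
Qed.

(** Without the usual factor [1 / (2 pi)], hence the powers of [2 * pi] in the statements that
    follow. *)
Definition fourier (u : R -> R[i]) k : R[i] :=
  cint 0 (2 * pi) (fun t => u t * (expi t)^-1 ^+ k).

Lemma cauchy_quotient_series (u : R -> R[i]) M :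
  ccontinuous_itv 0 (2 * pi) u ->
  (forall t, 0 <= t <= 2 * pi -> cabs (u t) <= M) ->
  forall n, cabs (cint 0 (2 * pi) (fun t => u t * cauchy_quotient t) -
    \sum_(k < n) z0 ^+ k * fourier u k) <=
    2 * (M * (1 - cabs z0)^-1) * (2 * pi) * cabs z0 ^+ n.
Proof.
move=> cu uM n.
have cq := @ccontinuous_quotient 0 (2 * pi).
have ce k := ccontinuous_itvX (n := k) (@ccontinuous_expiV 0 (2 * pi)).
have cue k := ccontinuous_itvM cu (ce k).
have cuez k := ccontinuous_itvM (@ccontinuous_itv_cst R 0 (2 * pi) (z0 ^+ k)) (cue k).
have -> : \sum_(k < n) z0 ^+ k * fourier u k =
    cint 0 (2 * pi) (fun t => \sum_(k < n) z0 ^+ k * (u t * (expi t)^-1 ^+ k)).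
  rewrite (cint_sum n twopi_ge0 cuez); apply: eq_bigr => k _.
  by rewrite (cintZ _ (cue k)).
rewrite -(cintB (ccontinuous_itvM cu cq) (ccontinuous_itv_sum (n := n) cuez)).
have -> : 2 * (M * (1 - cabs z0)^-1) * (2 * pi) * cabs z0 ^+ n =
   2 * (M * (cabs z0 ^+ n * (1 - cabs z0)^-1)) * (2 * pi - 0) by ring.
apply: (cabs_cint_le twopi_ge0).
  exact: (ccontinuous_itvB (ccontinuous_itvM cu cq)
    (ccontinuous_itv_sum (n := n) cuez)).
move=> t tI.
have -> : u t * cauchy_quotient t -
    \sum_(k < n) z0 ^+ k * (u t * (expi t)^-1 ^+ k) =
    u t * (z0 ^+ n * (expi t)^-1 ^+ n * cauchy_quotient t).
  rewrite [in LHS](cauchy_quotient_sum n) mulrDr addrC addrA mulr_sumr.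
  rewrite -sumrN -big_split /= big1 ?add0r// => k _; ring.
have := cabs_quotient t; move: (cauchy_quotient t) => q qM.
rewrite !cabsM !cabsX cabsV cabs_expi invr1 expr1n mulr1.
apply: ler_pM; [exact: cabs_ge0| |exact: uM|].
  by apply: mulr_ge0; [exact/exprn_ge0/cabs_ge0|exact: cabs_ge0].
by apply: ler_wpM2l; [exact/exprn_ge0/cabs_ge0|exact: qM].
Qed.

End Cauchy.

(** * Power series expansion on a disc *)

Section CauchySeries.
Context {R : realType}.
Implicit Types (g h : R[i] -> R[i]) (z w : R[i]).

Let twopi_ge0 : 0 <= 2 * pi :> R.
Proof. by rewrite mulr_ge0// pi_ge0. Qed.

Lemma twopi_neq0 : (2 * pi)%:C != 0 :> R[i].
Proof.
apply/eqP => /(@ofreal_inj R _ 0)/eqP; rewrite gt_eqF//.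
by rewrite mulr_gt0// pi_gt0.
Qed.

Lemma geometric_le0 (x K r : R) : 0 <= r -> r < 1 ->
  (forall n, (0 < n)%N -> x <= K * r ^+ n) -> x <= 0.
Proof.
move=> r0 r1 H.
have : (fun n => K * r ^+ n) @ \oo --> K * 0.
  by apply: cvgM; [exact: cvg_cst|apply: cvg_expr; rewrite ger0_norm].
rewrite mulr0 => h; have -> : 0 = lim ((fun n => K * r ^+ n) @ \oo).
  by apply/esym/cvg_lim.
apply: limr_ge; first by apply/cvg_ex; exists 0.
by exists 1%N => // n /= n1; exact: H.
Qed.

Lemma cabs_geometric_eq z w (K r : R) m : 0 <= r -> r < 1 ->
  (forall n, (m < n)%N -> cabs (z - w) <= K * r ^+ n) -> z = w.
Proof.
move=> r0 r1 H; apply/eqP; rewrite -subr_eq0 -cabs_eq0 eq_le cabs_ge0 andbT.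
apply: (@geometric_le0 _ (K * r ^+ m) r) => // n n0.
by rewrite -mulrA -exprD; apply: H; rewrite -[X in (X < _)%N]addn0 ltn_add2l.
Qed.

(** For the constant function 1 only the Fourier coefficient of index 0 survives in the series, and
    the remainder is geometric. *)
Lemma cint_cauchy_quotient z : cabs z < 1 ->
  cint 0 (2 * pi) (cauchy_quotient z) = (2 * pi)%:C.
Proof.
move=> z1.
have u1 (t : R) : 0 <= t <= 2 * pi -> cabs (1 : R[i]) <= 1 by rewrite cabs1.
have H := cauchy_quotient_series z1 (@ccontinuous_itv_cst R 0 (2 * pi) 1) u1.
apply: (@cabs_geometric_eq _ _ _ (cabs z) 0%N (cabs_ge0 z) z1) => n n0.
have := H n; rewrite (eq_cint (g := cauchy_quotient z)); last first.
  by move=> t _; rewrite mul1r.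
rewrite (_ : \sum_(k < n) _ = (2 * pi)%:C); first exact.
case: n n0 => // n _; rewrite big_ord_recl big1 => [|k _].
  rewrite addr0 expr0 mul1r /fourier.
  have := @cint_expi_ortho R 0 0; rewrite eqxx => <-.
  by apply: eq_cint => t _; rewrite expr0.
rewrite /fourier; have := @cint_expi_ortho R 0 (lift ord0 k).
rewrite /= => E; rewrite [X in _ * X](_ : _ = 0) ?mulr0//.
Qed.

Section UnitDisc.
Variable g : R[i] -> R[i].
Hypothesis dg : forall w, cabs w <= 1 -> exists d, cdifferential g w d.

Lemma ccontinuous_scale_expi z a b : cabs z <= 1 ->
  ccontinuous_itv a b (fun t => g (z * expi t)).
Proof.
move=> z1 x _.
have zx : cabs (z * expi x) <= 1 by rewrite cabsM cabs_expi mulr1.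
have [d /cdifferential_continuous h] := dg zx.
exact (cvg_comp _ _ (ccvgM (ccvg_cst z) (@expi_cvg R x)) h).
Qed.

(** [M] does not depend on [z]: the estimate is later integrated along the circle through [z], where
    its right-hand side is constant. *)
Lemma cauchy_series : exists2 M, 0 <= M & forall z, cabs z < 1 -> forall n,
  cabs ((2 * pi)%:C * g z -
     \sum_(k < n) z ^+ k * fourier (fun t => g (expi t)) k) <=
    M * (1 - cabs z)^-1 * cabs z ^+ n.
Proof.
have cg : ccontinuous_itv 0 (2 * pi) (fun t => g (expi t)).
  have := @ccontinuous_scale_expi 1 0 (2 * pi); rewrite cabs1 => /(_ (lexx _)).
  by under eq_fun do rewrite mul1r.
have [M M0 H] := ccontinuous_itv_bounded twopi_ge0 cg.
exists (2 * M * (2 * pi)); first by rewrite mulr_ge0// mulr_ge0.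
move=> z z1 n; have := cauchy_quotient_series z1 cg H n.
rewrite (cauchy_kernel z1 dg) (cint_cauchy_quotient z1) [g z * _]mulrC.
move=> /le_trans; apply.
by rewrite (_ : 2 * _ * _ = 2 * M * (2 * pi) * (1 - cabs z)^-1)//; ring.
Qed.

(** Inserting the series on the circle of radius [cabs z] and integrating term by term leaves only
    the term [j = k], by orthogonality. This makes the coefficients independent of the radius. *)
Lemma fourier_scale z k : cabs z < 1 ->
  fourier (fun t => g (z * expi t)) k = z ^+ k * fourier (fun t => g (expi t)) k.
Proof.
move=> z1; have [M M0 H] := cauchy_series.
have cz := @ccontinuous_scale_expi z 0 (2 * pi) (ltW z1).
have ce : ccontinuous_itv 0 (2 * pi) (@expi R) by move=> x _; exact: expi_cvg.
have cV := ccontinuous_itvX (n := k) (@ccontinuous_expiV R 0 (2 * pi)).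
set a := fourier (fun t => g (expi t)) in H *.
pose term j (t : R) := z ^+ j * a j * (expi t ^+ j * (expi t)^-1 ^+ k).
have ct0 j : ccontinuous_itv 0 (2 * pi) (fun t : R => expi t ^+ j * (expi t)^-1 ^+ k).
  exact (ccontinuous_itvM (ccontinuous_itvX (n := j) ce) cV).
have ct j : ccontinuous_itv 0 (2 * pi) (term j).
  exact: (ccontinuous_itvM (@ccontinuous_itv_cst R 0 (2 * pi) (z ^+ j * a j)) (ct0 j)).
have cu := ccontinuous_itvM cz cV.
have c2u := ccontinuous_itvM (@ccontinuous_itv_cst R 0 (2 * pi) (2 * pi)%:C) cu.
apply: (mulfI twopi_neq0).
apply: (@cabs_geometric_eq _ _ (2 * (M * (1 - cabs z)^-1) * (2 * pi - 0))
  (cabs z) k (cabs_ge0 _) z1) => n kn.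
have -> : (2 * pi)%:C * (z ^+ k * a k) =
    cint 0 (2 * pi) (fun t => \sum_(j < n) term j t).
  rewrite (cint_sum n twopi_ge0 ct) (bigD1 (Ordinal kn))//= big1 => [|j jk].
    rewrite addr0 /term (cintZ _ (ct0 k)) cint_expi_ortho eqxx.
    by rewrite mulrC.
  rewrite /term (cintZ _ (ct0 j)) cint_expi_ortho.
  have -> : (j == k :> nat) = false.
    by apply/negbTE; apply: contra jk => /eqP jk; apply/eqP/val_inj.
  by rewrite mulr0.
rewrite {1}/fourier -(cintZ _ cu).
rewrite -(cintB c2u (ccontinuous_itv_sum (n := n) ct)).
have -> : 2 * (M * (1 - cabs z)^-1) * (2 * pi - 0) * cabs z ^+ n =
  2 * (M * (1 - cabs z)^-1 * cabs z ^+ n) * (2 * pi - 0) by ring.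
apply: (cabs_cint_le twopi_ge0).
  exact: (ccontinuous_itvB c2u (ccontinuous_itv_sum (n := n) ct)).
move=> t _.
have zt : cabs (z * expi t) = cabs z by rewrite cabsM cabs_expi mulr1.
have := H (z * expi t); rewrite zt => /(_ z1 n).
have -> : (2 * pi)%:C * (g (z * expi t) * (expi t)^-1 ^+ k) -
    \sum_(j < n) term j t =
  ((2 * pi)%:C * g (z * expi t) - \sum_(j < n) (z * expi t) ^+ j * a j) *
    (expi t)^-1 ^+ k.
  rewrite mulrBl mulrA mulr_suml; congr (_ - _); apply: eq_bigr => j _.
  by rewrite /term exprMn; ring.
by rewrite cabsM cabsX cabsV cabs_expi invr1 expr1n mulr1.
Qed.

End UnitDisc.

Variables (h : R[i] -> R[i]) (rho : R).
Hypothesis dh : forall w, cabs w < rho -> exists d, cdifferential h w d.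

(** The expansion on the unit disc is transported to circles of radius [s < rho]. The coefficients
    are read off on the circle of radius [rho / 2], and [fourier_scale] shows that any other radius
    gives the same ones. *)
Theorem power_series_expansion : 0 < rho -> exists c : nat -> R[i],
  forall z, cabs z < rho ->
    (forall k, fourier (fun t => h (z * expi t)) k = (2 * pi)%:C * (z ^+ k * c k))
    /\ exists K r, [/\ 0 <= r, r < 1 &
      forall n, cabs (h z - \sum_(k < n) z ^+ k * c k) <= K * r ^+ n].
Proof.
move=> rho0.
pose g (s : R) w := h (s%:C * w).
have dg s : 0 < s -> s < rho ->
    forall w, cabs w <= 1 -> exists d, cdifferential (g s) w d.
  move=> s0 s1 w w1.
  have sw : cabs (s%:C * w) < rho.
    rewrite cabsM cabs_ofreal gtr0_norm// (le_lt_trans _ s1)//.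
    by rewrite ler_piMr// ltW.
  have [d hd] := dh sw; eexists.
  exact: (cdifferential_comp hd
    (cdifferentialM (cdifferential_cst s%:C w) (cdifferential_id w))).
pose a s := fourier (fun t => g s (expi t)).
pose r2 := rho / 2.
have r20 : 0 < r2 by rewrite divr_gt0.
have r2rho : r2 < rho by rewrite ltr_pdivrMr// ltr_pMr// ltr1n.
have ofr0 (s : R) : 0 < s -> s%:C != 0.
  by move=> s0; apply/eqP => /(@ofreal_inj R s 0) s00; rewrite s00 ltxx in s0.
pose c k := a r2 k / (r2%:C ^+ k * (2 * pi)%:C).
exists c => z zrho.
(* A radius below [rho] that exceeds both [cabs z] and the reference radius, so that both can be
   compared with it. *)
pose s := (Num.max (cabs z) r2 + rho) / 2.
have ms : Num.max (cabs z) r2 < rho by rewrite gt_max zrho.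
have zs : Num.max (cabs z) r2 < s by rewrite /s ltr_pdivlMr//; lra.
have srho : s < rho by rewrite /s ltr_pdivrMr//; lra.
have [cz rs] : cabs z < s /\ r2 < s by move: zs; rewrite gt_max => /andP[].
have s0 : 0 < s by exact: lt_trans rs.
have sC := ofr0 _ s0; have r2C := ofr0 _ r20.
have scale w k : cabs w < s ->
    fourier (fun t => h (w * expi t)) k = (w / s%:C) ^+ k * a s k.
  move=> ws.
  have w1 : cabs (w / s%:C) < 1.
    by rewrite cabsM cabsV cabs_ofreal gtr0_norm// ltr_pdivrMr// mul1r.
  rewrite -(fourier_scale (dg s s0 srho) k w1).
  apply: eq_cint => t _; congr (_ * _); rewrite /g; congr (h _).
  by rewrite mulrA mulrCA divff// mulr1.
have ark k : a r2 k = (r2%:C / s%:C) ^+ k * a s k.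
  rewrite -scale; last by rewrite cabs_ofreal gtr0_norm.
  by [].
have cE k : (2 * pi)%:C * (z ^+ k * c k) = (z / s%:C) ^+ k * a s k.
  have := twopi_neq0; have := expf_neq0 k sC; have := expf_neq0 k r2C.
  rewrite /c ark !exprMn !exprVn.
  move: (s%:C ^+ k) (r2%:C ^+ k) ((2 * pi)%:C) => x y p y0 x0 p0.
  by field; rewrite x0 y0 p0.
split; first by move=> k; rewrite scale.
have w1 : cabs (z / s%:C) < 1.
  by rewrite cabsM cabsV cabs_ofreal gtr0_norm// ltr_pdivrMr// mul1r.
have [M M0 H] := cauchy_series (dg s s0 srho).
exists ((2 * pi)^-1 * (M * (1 - cabs (z / s%:C))^-1)), (cabs (z / s%:C)).
split=> // [|n]; first exact: cabs_ge0.
have := H _ w1 n.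
have -> : g s (z / s%:C) = h z by rewrite /g mulrCA divff// mulr1.
have -> : \sum_(k < n) (z / s%:C) ^+ k * fourier (fun t => g s (expi t)) k =
   (2 * pi)%:C * \sum_(k < n) z ^+ k * c k.
  by rewrite mulr_sumr; apply: eq_bigr => k _; rewrite cE.
have tp : 0 < 2 * pi :> R by rewrite mulr_gt0// pi_gt0.
rewrite -mulrBr [X in X <= _]cabsM [cabs (2 * pi)%:C]cabs_ofreal gtr0_norm// => hh.
by rewrite -mulrA ler_pdivlMl.
Qed.

End CauchySeries.

(** * Lebesgue measure on the plane and on tuples *)

Section PlaneIntegral.
Context {R : realType}.
Local Open Scope ereal_scope.
Local Notation RR := (measurableTypeR R).
Local Notation mu := (@lebesgue_measure R).
Implicit Types (a b c s : R).

Lemma measurable_affine c a : measurable_fun setT (fun x : RR => (c * x + a)%R : RR).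
Proof. by apply: measurable_funD => //; exact: measurable_funM. Qed.

(** The image of Lebesgue measure under the affine map, multiplied by [c], agrees with Lebesgue
    measure on half-open intervals, hence everywhere. *)
Lemma ge0_integral_affine c a (f : RR -> \bar R) : (0 < c)%R ->
  measurable_fun setT f -> (forall x, 0 <= f x) ->
  c%:E * \int[mu]_x f (c * x + a)%R = \int[mu]_x f x.
Proof.
move=> c0 mf f0; have mA := measurable_affine c a.
pose phi (x : RR) := (c * x + a)%R : RR.
pose nu0 : {measure set RR -> \bar R} :=
  mscale (NngNum (ltW c0)) (pushforward mu phi).
pose nu := nu0 mA.
have munu A : measurable A -> mu A = nu A.
  apply: lebesgue_measure_unique => X /ocitvP[->|[[u v] /= uv ->]].
    by rewrite !measure0.
  rewrite /nu /mscale /= /pushforward.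
  have -> : phi @^-1` `]u, v] = `]((u - a) / c)%R, ((v - a) / c)%R]%classic.
    apply/seteqP; split => x /=; rewrite !in_itv/= ltr_pdivrMr// ler_pdivlMr//;
    by rewrite ltrBlDr lerBrDr mulrC.
  rewrite !lebesgue_measure_itv/= !lte_fin ltr_pM2r ?invr_gt0// ltrD2r uv.
  rewrite -!EFinD -EFinM; congr EFin.
  by field; rewrite gt_eqF.
rewrite [RHS](eq_measure_integral nu); last by move=> A mAA _; exact: munu.
rewrite [RHS]ge0_integral_mscale//; congr (_ * _).
by rewrite [RHS]ge0_integral_pushforward.
Qed.

Lemma ge0_integral_translation a (f : RR -> \bar R) :
  measurable_fun setT f -> (forall x, 0 <= f x) ->
  \int[mu]_x f (x + a)%R = \int[mu]_x f x.
Proof.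
move=> mf f0; rewrite -(ge0_integral_affine a ltr01 mf f0) mul1e.
by under [RHS]eq_integral do rewrite mul1r.
Qed.

(** An iterated integral, the form in which integrals over tuples unfold two coordinates at a
    time. *)
Definition plane_integral (f : RR * RR -> \bar R) : \bar R :=
  \int[mu]_x \int[mu]_y f (x, y).

Implicit Types (f : RR * RR -> \bar R).

Lemma eq_plane_integral f g : f =1 g -> plane_integral f = plane_integral g.
Proof. by move=> fg; congr plane_integral; apply/funext. Qed.

Lemma measurable_plane_linear (p q r t : R) :
  measurable_fun setT (fun z : RR * RR =>
    ((p * z.1 + q * z.2)%R : RR, (r * z.1 + t * z.2)%R : RR)).
Proof.
apply: measurable_fun_pair; apply: measurable_funD;
  by apply: measurable_funM => //.
Qed.

Lemma measurable_plane_comp f (p q r t : R) : measurable_fun setT f ->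
  measurable_fun setT (fun z : RR * RR =>
    f ((p * z.1 + q * z.2)%R, (r * z.1 + t * z.2)%R)).
Proof. by move=> mf; apply: measurableT_comp mf (measurable_plane_linear _ _ _ _). Qed.

Lemma plane_shear2 f b : measurable_fun setT f -> (forall z, 0 <= f z) ->
  plane_integral (fun z => f (z.1, b * z.1 + z.2)%R) = plane_integral f.
Proof.
move=> mf f0; apply: eq_integral => x _ /=.
under eq_integral do rewrite addrC.
rewrite (ge0_integral_translation (b * x) (f := fun y => f (x, y)))//.
exact: measurableT_comp mf (measurable_pair1 x).
Qed.

(** Here the outer variable is translated, so the order of integration is exchanged first. *)
Lemma plane_shear1 f b : measurable_fun setT f -> (forall z, 0 <= f z) ->
  plane_integral (fun z => f (z.1 + b * z.2, z.2)%R) = plane_integral f.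
Proof.
move=> mf f0; rewrite /plane_integral (fubini_tonelli f mf f0).
have mfs : measurable_fun setT (fun z : RR * RR => f (z.1 + b * z.2, z.2)%R).
  have := measurable_plane_comp 1 b 0 1 mf.
  by apply: eq_measurable_fun => z _; rewrite !mul1r mul0r add0r.
rewrite (fubini_tonelli _ mfs (fun z => f0 _)).
apply: eq_integral => y _ /=.
rewrite (ge0_integral_translation (b * y) (f := fun x => f (x, y)))//.
exact: measurableT_comp mf (measurable_pair2 y).
Qed.

(* A rotation is the product of three shears. *)
Lemma plane_rotation_aux f c s : (c ^+ 2 + s ^+ 2 = 1)%R -> (1 + c)%R != 0%R ->
  measurable_fun setT f -> (forall z, 0 <= f z) ->
  plane_integral (fun z => f (c * z.1 - s * z.2, s * z.1 + c * z.2)%R) =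
  plane_integral f.
Proof.
(* [t] is the tangent of half the angle, and the shears have coefficients [- t], [s], [- t]. It is
   infinite for the half turn, whence the condition on [1 + c]. *)
move=> cs c1 mf f0; pose t := (s / (1 + c))%R.
have ts : (t * s = 1 - c)%R.
  rewrite /t mulrAC -expr2 (_ : s ^+ 2 = (1 - c) * (1 + c))%R ?mulfK//.
  by rewrite (_ : (1 - c) * (1 + c) = 1 - c ^+ 2)%R; [lra|ring].
have tc : (t * (1 + c) = s)%R by rewrite /t divfK.
pose f1 (z : RR * RR) := f (z.1 + (- t) * z.2, z.2)%R.
pose f2 (z : RR * RR) := f1 (z.1, s * z.1 + z.2)%R.
have mf1 : measurable_fun setT f1.
  have := measurable_plane_comp 1 (- t) 0 1 mf.
  by apply: eq_measurable_fun => z _; rewrite /f1 !mul1r mul0r add0r.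
have mf2 : measurable_fun setT f2.
  have := measurable_plane_comp 1 0 s 1 mf1.
  by apply: eq_measurable_fun => z _; rewrite /f2 !mul1r mul0r addr0.
transitivity (plane_integral (fun z => f2 (z.1 + (- t) * z.2, z.2)%R)).
  apply: eq_plane_integral => -[x y]; rewrite /f2 /f1 /=; congr (f (_, _)).
    have e : (t * (2 - t * s) = s)%R by rewrite ts -[RHS]tc; ring.
    transitivity ((1 - t * s) * x - t * (2 - t * s) * y)%R; last by ring.
    by rewrite e ts; ring.
  by rewrite (_ : c = 1 - t * s)%R; [ring|rewrite ts; ring].
transitivity (plane_integral f2).
  exact: (plane_shear1 (- t) mf2 (fun z => f0 _)).
transitivity (plane_integral f1).
  exact: (plane_shear2 s mf1 (fun z => f0 _)).
exact: (plane_shear1 (- t) mf f0).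
Qed.

Theorem plane_rotation f c s : (c ^+ 2 + s ^+ 2 = 1)%R ->
  measurable_fun setT f -> (forall z, 0 <= f z) ->
  plane_integral (fun z => f (c * z.1 - s * z.2, s * z.1 + c * z.2)%R) =
  plane_integral f.
Proof.
move=> cs mf f0; have [c1|] := eqVneq (1 + c)%R 0%R; last first.
  by move=> c1; exact: plane_rotation_aux.
have cE : (c = -1)%R by lra.
have s0 : (s = 0)%R.
  by apply/eqP; rewrite -sqrf_eq0; apply/eqP; move: cs; rewrite cE; lra.
(* The half turn is obtained by applying the quarter turn [c = 0], [s = 1] twice. *)
have h1 : (0 ^+ 2 + 1 ^+ 2 = 1 :> R)%R by lra.
have h2 : (1 + 0 != 0 :> R)%R by rewrite addr0 oner_eq0.
rewrite -(plane_rotation_aux h1 h2 mf f0).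
have mfr : measurable_fun setT (fun z : RR * RR =>
    f (0 * z.1 - 1 * z.2, 1 * z.1 + 0 * z.2)%R).
  have := measurable_plane_comp 0 (- 1) 1 0 mf.
  by apply: eq_measurable_fun => z _; rewrite mulNr.
rewrite -(plane_rotation_aux h1 h2 mfr (fun z => f0 _)).
apply: eq_plane_integral => -[x y] /=; congr (f (_, _)).
  by rewrite cE s0; ring.
by rewrite cE s0; ring.
Qed.

Lemma plane_scale f r : (0 < r)%R ->
  measurable_fun setT f -> (forall z, 0 <= f z) ->
  (r ^+ 2)%:E * plane_integral (fun z => f (r * z.1, r * z.2)%R) =
  plane_integral f.
Proof.
move=> r0 mf f0; rewrite /plane_integral expr2 EFinM -muleA.
have mfr : measurable_fun setT (fun z : RR * RR => f (z.1, r * z.2)%R).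
  have := measurable_plane_comp 1 0 0 r mf.
  by apply: eq_measurable_fun => z _; rewrite mul1r !mul0r addr0 add0r.
have mfrr : measurable_fun setT (fun z : RR * RR => f (r * z.1, r * z.2)%R).
  have := measurable_plane_comp r 0 0 r mf.
  by apply: eq_measurable_fun => z _; rewrite !mul0r addr0 add0r.
have mF g : measurable_fun setT g -> (forall z, 0 <= g z) ->
    measurable_fun setT (fun x : RR => \int[mu]_y g (x, y)).
  by move=> mg g0; exact: measurable_fun_fubini_tonelli_F.
have i0 (g : RR * RR -> \bar R) x : (forall z, 0 <= g z) -> 0 <= \int[mu]_y g (x, y).
  by move=> g0; exact: integral_ge0.
have in1 x : r%:E * \int[mu]_y f (x, r * y)%R = \int[mu]_y f (x, y).
  rewrite -(ge0_integral_affine 0 r0 (f := fun y => f (x, y)))//.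
    by under [in RHS]eq_integral do rewrite addr0.
  exact: measurableT_comp mf (measurable_pair1 x).
rewrite -[RHS](ge0_integral_affine 0 r0); last 2 first.
- exact: mF.
- by move=> x; exact: i0.
congr (_ * _); rewrite -ge0_integralZl//; last 3 first.
- exact: (mF _ mfrr).
- by move=> x _; exact: (i0 (fun z => f (r * z.1, r * z.2)%R)).
- by rewrite lee_fin ltW.
by apply: eq_integral => x _; rewrite addr0; exact: (in1 (r * x)%R).
Qed.

Definition sqnorm2 (z : RR * RR) : RR := (z.1 ^+ 2 + z.2 ^+ 2)%R.

Lemma measurable_sqnorm2 : measurable_fun setT sqnorm2.
Proof. by apply: measurable_funD; apply: measurable_funX. Qed.

Definition disc_area (u : R) : \bar R :=
  plane_integral (fun z => (\1_[set z | (sqnorm2 z <= u)%R] z)%:E).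

Lemma measurable_disc u : measurable [set z | (sqnorm2 z <= u)%R].
Proof.
rewrite -[X in measurable X]setTI (_ : [set z | _] = sqnorm2 @^-1` `]-oo, u]).
  by apply: measurable_sqnorm2.
by apply/seteqP; split => z /=; rewrite in_itv.
Qed.

Lemma disc_areaE u : disc_area u = (mu \x mu) [set z | (sqnorm2 z <= u)%R].
Proof.
have mD := measurable_disc u.
have m1 : measurable_fun setT
    (fun z : RR * RR => (\1_[set z | (sqnorm2 z <= u)%R] z)%:E : \bar R).
  by apply/measurable_EFinP; exact: measurable_indic.
rewrite -[in RHS](setIT [set z | _]) -(integral_indic _ measurableT mD).
have p0 (z : RR * RR) :
    0 <= (\1_[set z : RR * RR | (sqnorm2 z <= u)%R] z)%:E :> \bar R.
  by rewrite lee_fin.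
by rewrite (fubini_tonelli1 _ m1 p0).
Qed.

Lemma disc_area_scale u : (0 < u)%R -> disc_area u = u%:E * disc_area 1.
Proof.
move=> u0; have r0 : (0 < Num.sqrt u)%R by rewrite sqrtr_gt0.
have m1 : measurable_fun setT
    (fun z : RR * RR => (\1_[set z | (sqnorm2 z <= u)%R] z)%:E : \bar R).
  by apply/measurable_EFinP; apply: measurable_indic; exact: measurable_disc.
rewrite /disc_area -(plane_scale r0 m1); last by move=> z; rewrite lee_fin.
rewrite (sqr_sqrtr (ltW u0)); congr (_ * _); apply: eq_plane_integral => z /=.
have e : (sqnorm2 (Num.sqrt u * z.1, Num.sqrt u * z.2) = u * sqnorm2 z)%R.
  by rewrite /sqnorm2 /= !exprMn (sqr_sqrtr (ltW u0)) mulrDr.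
rewrite !indicE; set b1 := _ \in _; set b2 := _ \in _.
suff -> : b1 = b2 by [].
by rewrite /b1 /b2; apply/idP/idP; rewrite !inE /= e ger_pMr.
Qed.

Lemma disc_area1_fin : disc_area 1 \is a fin_num.
Proof.
rewrite ge0_fin_numE; last by rewrite disc_areaE.
rewrite disc_areaE; apply: (@le_lt_trans _ _ ((mu \x mu) (`[(-1)%R, 1%R] `*` `[(-1)%R, 1%R]))).
  apply: le_measure; rewrite ?inE; [exact: measurable_disc|exact: measurableX|].
  move=> [x y]; rewrite /sqnorm2 /= !in_itv /= => h.
  have bnd (t w : R) : (t ^+ 2 + w ^+ 2 <= 1)%R -> (-1 <= t <= 1)%R.
    move=> tw; rewrite -ler_norml -(@ler_pXn2r _ 2%N) ?nnegrE// expr1n.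
    by rewrite real_normK ?num_real// (le_trans _ tw)// lerDl sqr_ge0.
  by split; [exact: bnd h|apply: (bnd _ x); rewrite addrC].
rewrite product_measure1E//= lebesgue_measure_itv/= lte_fin ifT; last by lra.
by rewrite -EFinD -EFinM ltry.
Qed.

Lemma disc_area1_gt0 : 0 < disc_area 1.
Proof.
rewrite disc_areaE.
apply: (@lt_le_trans _ _ ((mu \x mu) (`[0%R, (2^-1)%R] `*` `[0%R, (2^-1)%R]))).
  rewrite product_measure1E//= lebesgue_measure_itv/= lte_fin.
  rewrite ifT; last by lra.
  by rewrite -EFinD -EFinM lte_fin; lra.
apply: le_measure; rewrite ?inE; [exact: measurableX|exact: measurable_disc|].
move=> [x y]; rewrite /sqnorm2 /= !in_itv /= => -[/andP[x0 x1] /andP[y0 y1]].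
nra.
Qed.

Lemma disc_area0 : disc_area 0 = 0.
Proof.
rewrite disc_areaE (_ : [set z | _] = [set 0%R] `*` [set 0%R]).
  rewrite product_measure1E//; exact: (etrans (congr1 _ (lebesgue_measure_set1 _)) (mule0 _)).
apply/seteqP; split => -[x y]; rewrite /sqnorm2 /=.
  move=> h; have := sqr_ge0 x; have := sqr_ge0 y => y0 x0.
  have xx : (x ^+ 2 = 0)%R by lra.
  have yy : (y ^+ 2 = 0)%R by lra.
  by split; apply/eqP; rewrite -sqrf_eq0; apply/eqP.
by move=> [-> ->]; rewrite expr0n addr0.
Qed.

Lemma disc_area_lt0 u : (u < 0)%R -> disc_area u = 0.
Proof.
move=> u0; rewrite disc_areaE (_ : [set z | _] = set0) ?measure0//.
apply/seteqP; split => // z /=; apply/negP; rewrite -ltNge.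
by rewrite (lt_le_trans u0)// /sqnorm2 addr_ge0// sqr_ge0.
Qed.

(* This is [pi], but only its positivity matters. *)
Definition kappa : R := fine (disc_area 1).

Lemma kappa_gt0 : (0 < kappa)%R.
Proof. by rewrite fine_gt0// disc_area1_gt0 -ge0_fin_numE ?disc_area1_fin// ltW// disc_area1_gt0. Qed.

Lemma disc_areaP u : disc_area u = (kappa * Num.max 0 u)%R%:E.
Proof.
have [u0|u0|->] := ltgtP u 0%R.
- by rewrite disc_area_lt0// mulr0.
- by rewrite disc_area_scale// -[in LHS](fineK disc_area1_fin) -EFinM mulrC.
- by rewrite disc_area0 mulr0.
Qed.

Lemma annulus_area a b : (a < b)%R ->
  (mu \x mu) (sqnorm2 @^-1` `]a, b]) =
  (kappa * (Num.max 0 b - Num.max 0 a))%R%:E.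
Proof.
have F u : (mu \x mu) [set z | (sqnorm2 z <= u)%R] = (kappa * Num.max 0 u)%R%:E.
  by rewrite -disc_areaE disc_areaP.
move=> ab; have -> : sqnorm2 @^-1` `]a, b] =
    [set z | (sqnorm2 z <= b)%R] `\` [set z | (sqnorm2 z <= a)%R].
  apply/seteqP; split => z /=; rewrite in_itv /=.
    by move=> /andP[az zb]; split => //; apply/negP; rewrite -ltNge.
  by move=> [zb /negP]; rewrite -ltNge => az; apply/andP.
rewrite measureD; last 3 first.
- exact: measurable_disc.
- exact: measurable_disc.
- apply: (le_lt_trans _ (ltry (kappa * Num.max 0 b)%R)).
  by rewrite le_eqVlt; apply/orP; left; apply/eqP/F.
rewrite setIidr; last by move=> z /= /le_trans; apply; exact: ltW.
transitivity ((kappa * Num.max 0 b)%R%:E - (kappa * Num.max 0 a)%R%:E).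
  by congr (_ - _); exact: F.
by rewrite -EFinB mulrBr.
Qed.

(** The part of an interval that squared norms never reach. It completes the areas of annuli to a
    measure on the whole line. *)
Lemma negative_part_length a b : (a < b)%R ->
  mu (`]a, b] `&` `]-oo, 0%R[) = (b - a - (Num.max 0 b - Num.max 0 a))%R%:E.
Proof.
have mp (u : R) : (0 <= u)%R -> Num.max 0%R u = u by move=> ?; apply/max_idPr.
have mn (u : R) : (u <= 0)%R -> Num.max 0%R u = 0%R by move=> ?; apply/max_idPl.
move=> ab; have [a0|a0] : (0 <= a)%R \/ (a < 0)%R by case: (lerP 0%R a); [left|right].
  rewrite (mp _ a0) (mp b); last exact: le_trans (ltW ab).
  rewrite subrr (_ : _ `&` _ = set0); first exact: measure0.
  apply/seteqP; split => // x /=; rewrite !in_itv/= => -[/andP[ax _] x0].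
  by move: (lt_trans (le_lt_trans a0 ax) x0); rewrite ltxx.
rewrite (mn a (ltW a0)) subr0; have [b0|b0] : (0 <= b)%R \/ (b < 0)%R by case: (lerP 0%R b); [left|right].
  rewrite (mp _ b0) (_ : _ `&` _ = `]a, 0%R[%classic).
    rewrite /= lebesgue_measure_itv/= lte_fin a0 -EFinB; congr EFin; ring.
  apply/seteqP; split => x /=; rewrite !in_itv/=; first by move=> [/andP[-> _] ->].
  by move=> /andP[-> x0]; rewrite (ltW (lt_le_trans x0 b0)).
rewrite (mn _ (ltW b0)) subr0 (_ : _ `&` _ = `]a, b]%classic).
  by rewrite /= lebesgue_measure_itv/= lte_fin ab EFinB.
apply/seteqP; split => x /=; rewrite !in_itv/=; first by case.
by move=> /andP[ax xb]; rewrite ax xb (le_lt_trans xb b0).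
Qed.

(** Areas of annuli show that [sqnorm2] pushes plane measure to [kappa] times Lebesgue measure on
    the half-line. To apply the uniqueness of Lebesgue measure on the line, [kappa] times its
    restriction to the negative half-line is added; this part does not see [g], which vanishes
    there. *)
Theorem plane_integral_radial (f : RR -> \bar R) :
  measurable_fun setT f -> (forall x, 0 <= f x) ->
  plane_integral (fun z => f (sqnorm2 z)) =
  kappa%:E * \int[mu]_(u in `[0%R, +oo[) f u.
Proof.
move=> mf f0.
have mneg : measurable (`]-oo, 0%R[ : set RR) by [].
pose k0 : {nonneg R} := NngNum (ltW kappa_gt0).
pose nu0 : {measure set RR -> \bar R} := pushforward (mu \x mu) sqnorm2.
pose nu := nu0 measurable_sqnorm2.
pose nu2 : {measure set RR -> \bar R} := mscale k0 (mrestr mu mneg).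
pose rho : {measure set RR -> \bar R} := measure_add nu nu2.
have kV0 : (0 <= kappa^-1)%R by rewrite invr_ge0 ltW// kappa_gt0.
pose rho' : {measure set RR -> \bar R} := mscale (NngNum kV0) rho.
have E A : measurable A -> mu A = rho' A.
  apply: lebesgue_measure_unique => X /ocitvP[->|[[a b] /= ab ->]].
    by rewrite !measure0.
  have -> : rho' `]a, b]%classic =
    (kappa^-1)%:E * ((mu \x mu) (sqnorm2 @^-1` `]a, b]) +
       kappa%:E * mu (`]a, b] `&` `]-oo, 0%R[)).
    exact: (congr1 (fun x => (kappa^-1)%:E * x)
      (measure_addE nu nu2 `]a, b]%classic)).
  rewrite annulus_area// negative_part_length//.
  rewrite lebesgue_measure_itv/= lte_fin ab.
  set p := Num.max 0%R b; set q := Num.max 0%R a.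
  have e : (b - a = kappa^-1 * (kappa * (p - q) + kappa * (b - a - (p - q))))%R.
    by field; rewrite gt_eqF// kappa_gt0.
  exact: (congr1 EFin e).
pose g := f \_ `[0%R, +oo[.
have g0 x : 0 <= g x by rewrite /g patchE; case: ifP.
have mg : measurable_fun setT g.
  by apply/(measurable_restrictT _ _).1 => //; exact: measurable_funS mf.
have -> : plane_integral (fun z => f (sqnorm2 z)) = \int[nu]_x g x.
  rewrite [RHS](ge0_integral_pushforward measurable_sqnorm2)//.
  rewrite preimage_setT [RHS](fubini_tonelli1 (g \o sqnorm2)); last 2 first.
  - exact: measurableT_comp mg measurable_sqnorm2.
  - by move=> z; exact: g0.
  apply: eq_integral => x _; apply: eq_integral => y _ /=.
  by rewrite /g patchE ifT// inE/= in_itv/= andbT /sqnorm2 addr_ge0// sqr_ge0.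
have -> : \int[mu]_(u in `[0%R, +oo[) f u = \int[rho']_x g x.
  by rewrite integral_mkcond; apply: eq_measure_integral => A mA _; exact: E.
rewrite [X in _ * X]ge0_integral_mscale// muleA -EFinM /= mulfV ?gt_eqF ?kappa_gt0//.
rewrite mul1e [RHS]ge0_integral_measure_add// [X in _ + X](_ : _ = 0) ?adde0//.
rewrite ge0_integral_mscale// [X in _ * X](_ : _ = 0) ?mule0//.
rewrite (ae_eq_integral (cst 0)) ?integral0//.
exists (`[0%R, +oo[%classic); split => //.
  rewrite /= /mrestr (_ : _ `&` _ = set0) ?measure0//.
  apply/seteqP; split => // x /=; rewrite !in_itv/= andbT => -[x0].
  by rewrite ltNge x0.
move=> x /= gx; apply: contrapT => xI; apply: gx => _.
by rewrite /g patchE ifF//; apply/negP; rewrite inE.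
Qed.

End PlaneIntegral.

(** * Integration over tuples and coordinate rotations *)

Section TupleIntegral.
Context {R : realType}.
Local Open Scope ereal_scope.
Local Notation RR := (measurableTypeR R).
Local Notation mu := (@lebesgue_measure R).
Local Notation lambda n := (@tuple_measure _ RR R mu n).

Lemma integral_tuple_cons n (f : n.+1.-tuple RR -> \bar R) :
  measurable_fun setT f -> (forall t, 0 <= f t) ->
  \int[lambda n.+1]_t f t = \int[mu]_x \int[lambda n]_t f (tcons (x, t)).
Proof.
move=> mf f0.
have -> : \int[lambda n.+1]_t f t = \int[mu \x lambda n]_z (f \o @tcons _ RR n) z.
  exact: (ge0_integral_pushforward (@measurable_tcons _ RR n)
    (mu \x lambda n) measurableT mf (fun t _ => f0 t)).
have mft : measurable_fun setT (f \o @tcons _ RR n).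
  exact (measurableT_comp mf (@measurable_tcons _ RR n)).
by rewrite (fubini_tonelli1 _ mft (fun z => f0 _)).
Qed.

Lemma measurable_tconsr n (x : RR) :
  measurable_fun setT (fun t : n.-tuple RR => tcons (x, t)).
Proof.
apply: measurableT_comp; first exact: measurable_tcons.
exact: measurable_pair1.
Qed.

Lemma measurable_tcons2r n (x y : RR) :
  measurable_fun setT (fun t : n.-tuple RR => tcons (x, tcons (y, t))).
Proof. exact (measurableT_comp (@measurable_tconsr _ x) (@measurable_tconsr n y)). Qed.

Lemma integral_tuple_cons2 n (f : n.+2.-tuple RR -> \bar R) :
  measurable_fun setT f -> (forall t, 0 <= f t) ->
  \int[lambda n.+2]_t f t =
  plane_integral (fun z => \int[lambda n]_t f (tcons (z.1, tcons (z.2, t)))).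
Proof.
move=> mf f0; rewrite integral_tuple_cons//; apply: eq_integral => x _.
rewrite (integral_tuple_cons (f := fun t => f (tcons (x, t))))//.
exact (measurableT_comp mf (@measurable_tconsr _ x)).
Qed.

Lemma measurable_integral_tail n (f : n.+2.-tuple RR -> \bar R) :
  measurable_fun setT f -> (forall t, 0 <= f t) ->
  measurable_fun setT (fun z : RR * RR =>
    \int[lambda n]_t f (tcons (z.1, tcons (z.2, t)))).
Proof.
move=> mf f0.
have mg : measurable_fun setT (fun z : (RR * RR) * n.-tuple RR =>
    f (tcons (z.1.1, tcons (z.1.2, z.2)))).
  apply: (measurableT_comp mf).
  apply: measurableT_comp; first exact: measurable_tcons.
  apply: measurable_fun_pair; first exact: measurableT_comp.
  apply: measurableT_comp; first exact: measurable_tcons.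
  by apply: measurable_fun_pair => //; exact: measurableT_comp.
exact: (@measurable_fun_fubini_tonelli_F _ _ _ _ _ (lambda n) _ mg (fun z => f0 _)).
Qed.

(** Entries [2 k] and [2 k + 1] are the real and imaginary parts of the [k]-th complex coordinate,
    which is multiplied by [c k + i s k]. *)
Definition rot m (c s : nat -> R) (t : m.*2.-tuple RR) : m.*2.-tuple RR :=
  [tuple (if odd i then s i./2 * nth 0 t i.-1 + c i./2 * nth 0 t i
          else c i./2 * nth 0 t i - s i./2 * nth 0 t i.+1)%R | i < m.*2].

Lemma nth_rot m c s (t : m.*2.-tuple RR) i : (i < m.*2)%N ->
  nth 0%R (rot c s t) i =
  (if odd i then s i./2 * nth 0 t i.-1 + c i./2 * nth 0 t i
   else c i./2 * nth 0 t i - s i./2 * nth 0 t i.+1)%R.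
Proof. by move=> im; rewrite (nth_mktuple _ _ (Ordinal im)). Qed.

Lemma rot_tcons2 m c s (x y : RR) (t : m.*2.-tuple RR) :
  @rot m.+1 c s (tcons (x, tcons (y, t))) =
  tcons ((c 0%N * x - s 0%N * y)%R, tcons ((s 0%N * x + c 0%N * y)%R,
    rot (fun i => c i.+1) (fun i => s i.+1) t)).
Proof.
have := @nth_rot m (fun i => c i.+1) (fun i => s i.+1) t.
move: (rot (fun i => c i.+1) _ t) => r hr.
apply: val_inj; apply: (@eq_from_nth _ 0%R) => [|i].
  by rewrite !size_tuple.
rewrite size_tuple => im; rewrite nth_rot//.
case: i im => [|[|i]] im //=.
rewrite hr; last by move: im; rewrite doubleS !ltnS.
rewrite negbK; case: ifP => //=.
by case: i {im} => [//|i].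
Qed.

Lemma measurable_nth n i : measurable_fun setT (fun t : n.-tuple RR => nth 0%R t i : RR).
Proof.
have [ni|ni] := ltnP i n; last first.
  have -> : (fun t : n.-tuple RR => nth 0%R t i : RR) = cst 0%R.
    by apply/funext => t; rewrite nth_default ?size_tuple.
  exact: measurable_cst.
have -> : (fun t : n.-tuple RR => nth 0%R t i : RR) =
    (fun t : n.-tuple RR => tnth t (Ordinal ni)).
  by apply/funext => t; rewrite (tnth_nth 0%R).
exact: measurable_tnth.
Qed.

(** Measurability jointly in the angles and the point, as required for Fubini over the angle. *)
Lemma measurable_rot_joint d (T : measurableType d) m (c s : nat -> T -> RR)
    (u : T -> m.*2.-tuple RR) :
  (forall i, measurable_fun setT (c i)) -> (forall i, measurable_fun setT (s i)) ->
  measurable_fun setT u ->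
  measurable_fun setT (fun z => rot (c^~ z) (s^~ z) (u z)).
Proof.
move=> mc ms mu_; apply/measurable_fun_tnthP => i.
have mn k : measurable_fun setT (fun z => nth 0%R (u z) k : RR).
  exact (measurableT_comp (@measurable_nth m.*2 k) mu_).
have [oi|ei] := boolP (odd i).
  have -> : (tnth (T := RR))^~ i \o (fun z => rot (c^~ z) (s^~ z) (u z)) =
    (fun z => (s i./2 z * nth 0 (u z) i.-1 + c i./2 z * nth 0 (u z) i)%R).
    by apply/funext => z; rewrite /= tnth_mktuple oi.
  apply: measurable_funD; apply: measurable_funM;
    [exact: ms|exact: mn|exact: mc|exact: mn].
have -> : (tnth (T := RR))^~ i \o (fun z => rot (c^~ z) (s^~ z) (u z)) =
    (fun z => (c i./2 z * nth 0 (u z) i - s i./2 z * nth 0 (u z) i.+1)%R).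
  by apply/funext => z; rewrite /= tnth_mktuple (negbTE ei).
apply: measurable_funB; apply: measurable_funM;
  [exact: mc|exact: mn|exact: ms|exact: mn].
Qed.

Lemma measurable_rot m c s : measurable_fun setT (@rot m c s).
Proof.
apply: (measurable_rot_joint (c := fun i _ => c i) (s := fun i _ => s i) (u := id)) => //.
Qed.

(** The first complex coordinate is a plane rotated by [plane_rotation]; induction handles the
    remaining ones inside the inner integral. *)
Theorem integral_rot m c s (f : m.*2.-tuple RR -> \bar R) :
  (forall i, c i ^+ 2 + s i ^+ 2 = 1)%R ->
  measurable_fun setT f -> (forall t, 0 <= f t) ->
  \int[lambda m.*2]_t f (rot c s t) = \int[lambda m.*2]_t f t.
Proof.
elim: m c s f => [|m ih] c s f cs mf f0.
  by apply: eq_integral => t _; congr f; rewrite [RHS]tuple0 [LHS]tuple0.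
have mfr : measurable_fun setT (fun t => f (@rot m.+1 c s t)).
  exact (measurableT_comp mf (@measurable_rot m.+1 c s)).
rewrite (integral_tuple_cons2 mfr (fun t => f0 _)) (integral_tuple_cons2 mf f0).
have mtail := measurable_integral_tail mf f0.
rewrite -[RHS](plane_rotation (cs 0%N) mtail); last by move=> z; exact: integral_ge0.
apply: eq_plane_integral => -[x y] /=.
under eq_integral do rewrite rot_tcons2.
have mfc := measurableT_comp mf
  (@measurable_tcons2r m.*2 (c 0%N * x - s 0%N * y)%R (s 0%N * x + c 0%N * y)%R).
exact: (ih (fun i => c i.+1) (fun i => s i.+1) _ (fun i => cs i.+1) mfc
  (fun t => f0 _)).
Qed.

End TupleIntegral.

(** * The Bergman kernel on a coordinate axis *)

Section RotationAverage.
Context {R : realType}.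
Local Open Scope ereal_scope.
Local Notation RR := (measurableTypeR R).
Local Notation mu := (@lebesgue_measure R).
Local Notation lambda n := (@tuple_measure _ RR R mu n).

Lemma integral_rot_signed m c s (f : m.*2.-tuple RR -> \bar R) :
  (forall i, c i ^+ 2 + s i ^+ 2 = 1)%R ->
  measurable_fun setT f ->
  \int[lambda m.*2]_t f (rot c s t) = \int[lambda m.*2]_t f t.
Proof.
move=> cs mf; rewrite -[LHS]/(\int[lambda m.*2]_t (f \o rot c s) t).
rewrite [LHS]integralE [RHS]integralE funepos_comp funeneg_comp; congr (_ - _).
  exact (integral_rot cs (measurable_funepos mf) (funepos_ge0 f)).
exact (integral_rot cs (measurable_funeneg mf) (funeneg_ge0 f)).
Qed.

(** A circle action with weights [w]: coordinate [i] turns by the angle [w i * a]. *)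
Definition rota m (w : nat -> R) (a : R) : m.*2.-tuple RR -> m.*2.-tuple RR :=
  rot (fun i => cos (w i * a)) (fun i => sin (w i * a)).

Lemma measurable_rota_joint d (T : measurableType d) m w (p : T -> RR)
    (q : T -> m.*2.-tuple RR) :
  measurable_fun setT p -> measurable_fun setT q ->
  measurable_fun setT (fun z => rota w (p z) (q z)).
Proof.
move=> mp mq; have mw i : measurable_fun setT (fun z => (w i * p z)%R : RR).
  exact: measurable_funM.
apply: (measurable_rot_joint (c := fun i z => cos (w i * p z))
  (s := fun i z => sin (w i * p z)) (u := q)) => [i|i|//].
  exact: (measurableT_comp (continuous_measurable_fun (@continuous_cos R)) (mw i)).
exact: (measurableT_comp (continuous_measurable_fun (@continuous_sin R)) (mw i)).
Qed.

(** Fubini on the product of the space with the interval of angles. Joint integrability holds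
    because by invariance every angle gives the same integral of the absolute value. *)
Lemma rota_average m w (g : m.*2.-tuple RR -> R) :
  (lambda m.*2).-integrable setT (EFin \o g) ->
  let G t := \int[mu]_(a in `[0%R, (2 * pi)%R]) (g (rota w a t))%:E in
  (lambda m.*2).-integrable setT G /\
  \int[lambda m.*2]_t G t = (2 * pi)%:E * \int[lambda m.*2]_t (g t)%:E.
Proof.
move=> ig G; have /integrableP[mg ltg] := ig.
have mG : measurable_fun setT g by apply/measurable_EFinP.
pose I : set RR := `[0%R, (2 * pi)%R]%classic.
have mI : measurable I by exact: measurable_itv.
pose f (z : m.*2.-tuple RR * RR) := (\1_I z.2 * g (rota w z.2 z.1))%R%:E.
have mf : measurable_fun setT f.
  apply/measurable_EFinP; apply: measurable_funM.
    exact: (measurableT_comp (measurable_indic mI) measurable_snd).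
  apply: (measurableT_comp mG).
  exact: (measurable_rota_joint w measurable_snd measurable_fst).
have cs a i : (cos (w i * a) ^+ 2 + sin (w i * a) ^+ 2 = 1 :> R)%R.
  exact: cos2Dsin2.
(* The parameter [h] is used twice: as the absolute value, for integrability, and as the identity,
   for the value. *)
have slice (h : R -> R) a : measurable_fun setT h -> (h 0%R = 0%R) ->
    \int[lambda m.*2]_t (h (\1_I a * g (rota w a t)))%R%:E =
    (\1_I a)%:E * \int[lambda m.*2]_t (h (g t))%:E.
  move=> mh h0; rewrite indicE; case: (a \in I); last first.
    rewrite mul0e; under eq_integral do rewrite mul0r h0; exact: integral0.
  rewrite mul1e; under eq_integral do rewrite mul1r.
  apply: (integral_rot_signed (f := fun t => (h (g t))%:E) (cs a)).
  by apply/measurable_EFinP; exact: measurableT_comp mh mG.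
have pi20 : (0 <= 2 * pi :> R)%R by rewrite mulr_ge0// pi_ge0.
have muI : mu I = (2 * pi)%:E.
  rewrite /I /= lebesgue_measure_itv/= lte_fin; case: ltgtP pi20 => // [_ _|<- _] //.
  by rewrite sube0.
have int1 : (lambda m.*2 \x mu).-integrable setT f.
  apply/(integrable21ltyP _ _ mf).
  under eq_integral => a _.
    under eq_integral => t _ do rewrite abse_EFin.
    rewrite (slice (fun x => `|x|%R))//; last exact: normr0.
    over.
  rewrite /= ge0_integralZr//; last 2 first.
  - by apply/measurable_EFinP; exact: measurable_indic.
  - by apply: integral_ge0 => t _; rewrite lee_fin.
  rewrite integral_indic// setIT lte_mul_pinfty//.
    by have -> : mu I \is a fin_num by rewrite muI.
have GE : G = (fun t => \int[mu]_a f (t, a)).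
  apply/funext => t; rewrite /G integral_mkcond; apply: eq_integral => a _.
  by rewrite patchE /f /= indicE; case: ifP => _; rewrite ?mul1r ?mul0r.
split; first by rewrite GE; exact: (integrable_fubini_F int1).
rewrite GE (Fubini int1).
under eq_integral => a _ do rewrite /f /= (slice id) //.
transitivity (\int[mu]_(a in I) (\int[lambda m.*2]_t (g t)%:E)).
  rewrite [RHS]integral_mkcond; apply: eq_integral => a _.
  by rewrite patchE indicE; case: ifP => _; rewrite ?mul1e ?mul0e.
by rewrite integral_cst// muleC; congr (_ * _).
Qed.

End RotationAverage.

Section ComplexRotationAverage.
Context {R : realType} {m : nat}.
Local Notation RR := (measurableTypeR R).
Local Notation mu := (@lebesgue_measure R).
Local Notation lambda n := (@tuple_measure _ RR R mu n).
Local Notation Cm := 'rV[R[i]]_m.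
Implicit Types (D : set Cm) (f : Cm -> R[i]) (w : nat -> R).

Definition rotC w (a : R) (z : Cm) : Cm := \row_j (expi (w j * a) * z 0 j).

Lemma complex_point_rota w a (t : m.*2.-tuple RR) :
  complex_point (rota w a t) = rotC w a (complex_point t).
Proof.
apply/rowP => j; rewrite !mxE.
have j1 : (j.*2.+1 < m.*2)%N by rewrite -doubleS leq_double.
rewrite !nth_rot//; last exact: ltnW.
rewrite /= odd_double /= uphalf_double doubleK.
by apply: complex_ext; rewrite //= addrC.
Qed.

Definition rotation_invariant w D := forall a z, D (rotC w a z) <-> D z.

Definition cintegrable D f :=
  [/\ measurable (@complex_point R m @^-1` D),
      (lambda m.*2).-integrable (@complex_point R m @^-1` D)
        (fun t => (complex.Re (f (complex_point t)))%:E) &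
      (lambda m.*2).-integrable (@complex_point R m @^-1` D)
        (fun t => (complex.Im (f (complex_point t)))%:E)].

Lemma rota_average_on w D (u : Cm -> R) : rotation_invariant w D ->
  let S := @complex_point R m @^-1` D in
  measurable S ->
  (forall z, D z -> continuous_itv 0 (2 * pi) (fun a => u (rotC w a z))) ->
  (lambda m.*2).-integrable S (fun t => (u (complex_point t))%:E) ->
  let U z := itg 0 (2 * pi) (fun a => u (rotC w a z)) in
  (lambda m.*2).-integrable S (fun t => (U (complex_point t))%:E) /\
  \int[lambda m.*2]_(t in S) U (complex_point t) =
  (2 * pi) * \int[lambda m.*2]_(t in S) u (complex_point t).
Proof.
move=> inv S mS cu iu U.
pose g t := (u \o @complex_point R m) \_ S t.
have gE : EFin \o g = (fun t => (u (complex_point t))%:E) \_ S.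
  by apply/funext => t; rewrite /g /= !patchE; case: ifP.
have ig : (lambda m.*2).-integrable setT (EFin \o g).
  by rewrite gE; apply/(integrable_mkcond _ mS).
have [iG GE] := rota_average w ig.
have GU : (fun t => \int[mu]_(a in `[0%R, (2 * pi)%R]) (g (rota w a t))%:E)%E =
    (fun t => (U (complex_point t))%:E) \_ S.
  apply/funext => t; rewrite patchE; case: ifPn => tS; last first.
    rewrite (eq_integral (fun=> 0%E)) ?integral0// => a _.
    rewrite /g patchE ifF//; apply/negbTE; apply: contra tS; rewrite !inE.
    by rewrite /S /= complex_point_rota => /inv.
  rewrite inE in tS.
  (* Continuity in the angle makes the inner integral finite, so that the real number [itg] loses
     nothing of the extended integral. *)
  have ic := continuous_itv_integrable (cu _ tS).
  rewrite /U /itg /Rintegral fineK; last exact: integrable_fin_num.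
  apply: eq_integral => a _.
  have rS : (rota w a t \in S) = true.
    by apply/mem_set; rewrite /S /= complex_point_rota; exact/inv.
  by rewrite /g patchE rS /= complex_point_rota.
rewrite GU in iG GE.
have iU : (lambda m.*2).-integrable S (fun t => (U (complex_point t))%:E).
  exact/(integrable_mkcond _ mS).
split=> //.
have gu : (\int[lambda m.*2]_t (g t)%:E =
    \int[lambda m.*2]_(t in S) (u (complex_point t))%:E)%E.
  by rewrite [RHS]integral_mkcond -gE.
rewrite -integral_mkcond gu in GE.
rewrite /Rintegral GE fineM//.
exact: integrable_fin_num.
Qed.

Theorem integralC_average w D f : rotation_invariant w D ->
  (forall z, D z -> ccontinuous_itv 0 (2 * pi) (fun a => f (rotC w a z))) ->
  cintegrable D f ->
  let F z := cint 0 (2 * pi) (fun a => f (rotC w a z)) in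
  cintegrable D F /\ integralC D F = (2 * pi)%:C * integralC D f.
Proof.
move=> inv cf [mS iRe iIm] F.
have [iRe' eRe] := rota_average_on (u := fun z => complex.Re (f z)) inv mS
  (fun z Dz => ccontinuous_itv_Re (cf z Dz)) iRe.
have [iIm' eIm] := rota_average_on (u := fun z => complex.Im (f z)) inv mS
  (fun z Dz => ccontinuous_itv_Im (cf z Dz)) iIm.
split.
  split=> //.
    by under eq_fun do rewrite Re_cint.
  by under eq_fun do rewrite Im_cint.
rewrite mulrC; apply: complex_ext; rewrite ?Re_mulR ?Im_mulR ?ReMr ?ImMr mulrC /=.
  by rewrite -eRe; apply: eq_Rintegral => t _; rewrite Re_cint.
by rewrite -eIm; apply: eq_Rintegral => t _; rewrite Im_cint.
Qed.

End ComplexRotationAverage.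

(** * Open sets and continuous functions are measurable *)

Section OpenMeasurable.
Context {R : realType}.
Local Notation RR := (measurableTypeR R).

Lemma measurable_box n (q : n.-tuple R) (r : R) :
  measurable [set t : n.-tuple RR | forall i, `|tnth t i - tnth q i| < r].
Proof.
rewrite (_ : [set t | _] = \bigcap_(i in [set: 'I_n])
    [set t : n.-tuple RR | `|tnth t i - tnth q i| < r]); last first.
  by apply/seteqP; split => t /= H i; [move=> _; exact: H|exact: (H i)].
apply: fin_bigcap_measurable => // i _.
rewrite (_ : [set t | _] = (fun t : n.-tuple RR => tnth t i : RR) @^-1`
    `]tnth q i - r, tnth q i + r[%classic).
  rewrite -[X in measurable X]setTI; apply: measurable_tnth => //.
by apply/seteqP; split => t /=; rewrite in_itv/= ltr_distl.
Qed.

Definition box_open n (S : set (n.-tuple RR)) := forall t, S t ->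
  exists2 d, 0 < d & forall t' : n.-tuple RR,
    (forall i, `|tnth t' i - tnth t i| < d) -> S t'.

(** Such a set is the union of the boxes with rational centre and radius [1 / (k + 1)] that it
    contains, and these are countably many. *)
Lemma measurable_box_open n (S : set (n.-tuple RR)) : box_open S -> measurable S.
Proof.
move=> So.
pose box (p : n.-tuple rat * nat) : set (n.-tuple RR) :=
  [set t : n.-tuple RR | forall i, `|tnth t i - ratr (tnth p.1 i)| < p.2.+1%:R^-1].
pose B (k : nat) : set (n.-tuple RR) :=
  if unpickle k is Some p then (if `[< box p `<=` S >] then box p else set0)
  else set0.
have -> : S = \bigcup_k B k.
  apply/seteqP; split => [t St|t [k _]]; last first.
    rewrite /B; case: unpickle => [p|//]; case: asboolP => [pS|_ //]; exact: pS.
  have [d d0 H] := So t St.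
  have [k k1] : exists k : nat, 2 * k.+1%:R^-1 < d.
    exists (Num.bound (2 / d)); rewrite ltr_pdivrMr//.
    have d2 : 0 <= 2 / d by rewrite divr_ge0// ltW.
    rewrite mulrC -ltr_pdivrMr// (lt_le_trans (archi_boundP d2))//.
    by rewrite ler_nat.
  have k0 : 0 < k.+1%:R^-1 :> R by rewrite invr_gt0.
  have ex i : exists q : rat, `|tnth t i - ratr q| < k.+1%:R^-1.
    have [|q] := @rat_in_itvoo R (tnth t i - k.+1%:R^-1) (tnth t i + k.+1%:R^-1).
      by rewrite ltrD2l (lt_trans _ k0)// oppr_lt0.
    by rewrite in_itv/= => h; exists q; rewrite distrC ltr_distl.
  pose q := [tuple sval (cid (ex i)) | i < n].
  have qP i : `|tnth t i - ratr (tnth q i)| < k.+1%:R^-1.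
    by rewrite tnth_mktuple; exact: (svalP (cid (ex i))).
  exists (pickle (q, k)) => //; rewrite /B pickleK ifT//.
  apply/asboolP => t' bt'; apply: H => i.
  have := bt' i; have := qP i; rewrite /= => h1 h2.
  apply: le_lt_trans (ler_distD (ratr (tnth q i)) _ _) _.
  rewrite [X in _ + X]distrC (lt_trans (ltrD h2 h1))//.
  by move: k1; rewrite mulr_natl mulr2n.
apply: bigcupT_measurable => k; rewrite /B; case: unpickle => [p|//].
case: asboolP => [_|_ //].
rewrite (_ : box p = [set t : n.-tuple RR |
   forall i, `|tnth t i - tnth [tuple of map ratr p.1] i| < p.2.+1%:R^-1]).
  exact: measurable_box.
by apply/seteqP; split => t /= H i; have := H i; rewrite tnth_map.
Qed.

Lemma measurable_box_continuous n (S : set (n.-tuple RR)) (g : n.-tuple RR -> R) :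
  box_open S ->
  (forall t, S t -> forall e, 0 < e -> exists2 d, 0 < d & forall t' : n.-tuple RR,
    (forall i, `|tnth t' i - tnth t i| < d) -> `|g t' - g t| < e) ->
  measurable_fun S (g : _ -> RR).
Proof.
move=> So gc; apply: (measurability _ (RGenOInfty.measurableE R)).
move=> _ [_ [c ->] <-]; apply: measurable_box_open => t [St /=].
rewrite in_itv/= andbT => cgt.
have [d1 d10 H1] := So t St.
have [|d2 d20 H2] := gc t St (g t - c); first by rewrite subr_gt0.
exists (Num.min d1 d2); first by rewrite lt_min d10.
move=> t' H; split.
  by apply: H1 => i; rewrite (lt_le_trans (H i))// ge_min lexx.
rewrite /= in_itv/= andbT.
have : `|g t' - g t| < g t - c.
  by apply: H2 => i; rewrite (lt_le_trans (H i))// ge_min lexx orbT.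
by rewrite ltr_distl => /andP[+ _]; rewrite opprB addrCA subrr addr0.
Qed.

End OpenMeasurable.

Section RowTopology.
Context {R : realType} {m : nat}.
Local Notation RR := (measurableTypeR R).
Local Notation Cm := 'rV[R[i]]_m.+1.

Lemma near_rowP (z : Cm) (P : set Cm) :
  nbhs z P <-> exists2 d : R, 0 < d &
    forall w : Cm, (forall j, cabs (w 0 j - z 0 j) < d) -> P w.
Proof.
have E := @nbhs_ballP R[i] _ z P.
split=> [/E[_ /= /gt0_ofreal[d d0 ->] H]|[d d0 H]].
  exists d => // w wz; apply: H; split=> [|i j]; first by rewrite ltcR.
  rewrite !ord1.
  by rewrite -(@ball_normE R[i] (R[i])^o) /= -cabsE ltcR cabs_dist.
apply/E; exists d%:C => /=; first by rewrite ltcR.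
move=> w [_ wz]; apply: H => j; have := wz 0 j.
by rewrite -(@ball_normE R[i] (R[i])^o) /= -cabsE ltcR cabs_dist.
Qed.

Lemma complex_point_close (t t' : m.+1.*2.-tuple RR) (d : R) :
  (forall i, `|tnth t' i - tnth t i| < d / 2) ->
  forall j, cabs (complex_point t' 0 j - complex_point t 0 j) < d.
Proof.
move=> H j; rewrite !mxE.
have j1 : (j.*2.+1 < m.+1.*2)%N by rewrite -doubleS leq_double.
have j0 := ltnW j1.
have := H (Ordinal j0); have := H (Ordinal j1).
rewrite !(tnth_nth 0) /= => h1 h2.
apply: le_lt_trans (cabs_le_ReIm _) _; rewrite ReB ImB /=.
by rewrite [d]splitr ltrD.
Qed.

Lemma box_open_preimage (D : set Cm) : open D -> box_open (@complex_point R m.+1 @^-1` D).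
Proof.
move=> oD t Dt; have : nbhs (complex_point t) D by exact: open_nbhs_nbhs.
move=> /near_rowP[d d0 H]; exists (d / 2); first by rewrite divr_gt0.
by move=> t' tt'; apply: H; exact: complex_point_close.
Qed.

Lemma measurable_preimage (D : set Cm) : open D ->
  measurable (@complex_point R m.+1 @^-1` D).
Proof. by move=> oD; exact (measurable_box_open (box_open_preimage oD)). Qed.

Lemma measurable_continuous_on (D : set Cm) (f : Cm -> R[i]) : open D ->
  (forall z, D z -> f @ z --> f z) ->
  measurable_fun (@complex_point R m.+1 @^-1` D)
    (fun t => complex.Re (f (complex_point t)) : RR) /\
  measurable_fun (@complex_point R m.+1 @^-1` D)
    (fun t => complex.Im (f (complex_point t)) : RR).
Proof.
move=> oD cf.
have close t e : (@complex_point R m.+1 @^-1` D) t -> 0 < e -> exists2 d, 0 < d &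
    forall t' : m.+1.*2.-tuple RR, (forall i, `|tnth t' i - tnth t i| < d) ->
    cabs (f (complex_point t') - f (complex_point t)) < e.
  move=> St e0.
  pose proof (proj1 (cvg_cabs (F := nbhs (complex_point t)) f _) (cf _ St) e e0) as h.
  move: h => /near_rowP[d d0 H]; exists (d / 2); first by rewrite divr_gt0.
  by move=> t' tt'; apply: H; exact: complex_point_close.
split; apply: measurable_box_continuous; try exact: box_open_preimage.
  move=> t St e e0; have [d d0 H] := close t e St e0; exists d => // t' tt'.
  by rewrite -ReB (le_lt_trans (Re_le_cabs _))// H.
move=> t St e e0; have [d d0 H] := close t e St e0; exists d => // t' tt'.
by rewrite -ImB (le_lt_trans (Im_le_cabs _))// H.
Qed.

End RowTopology.

(** * Restriction of holomorphic functions to an axis *)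

Section HolomorphicLines.
Context {R : realType} {m : nat}.
Local Notation Cm := 'rV[R[i]]_m.+1.

(** The difference quotients in the direction [v] converge, and completed by their limit at [z] they
    are the Caratheodory factor. *)
Lemma holomorphic_line (f : Cm -> R[i]) (a v : Cm) (z : R[i]) :
  differentiable (f : Cm -> R[i]^o) (a + z *: v) ->
  exists d, cdifferential (fun s => f (a + s *: v)) z d.
Proof.
move=> df; have dv : derivable (f : Cm -> R[i]^o) (a + z *: v) v by exact: diff_derivable.
have [l hl] := proj1 (cvg_ex _) dv.
pose x := a + z *: v.
exists l.
exists (fun s => if s == z then l else (f (a + s *: v) - f x) / (s - z)).
have hl' e : 0 < e -> exists2 d, 0 < d & forall h : R[i], cabs h < d -> h != 0 ->
    cabs (h^-1 * (f (h *: v + x) - f x) - l) < e.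
  move=> e0; pose proof (proj1 (cvg_cabs _ l) hl e e0) as near0.
  have /nbhs_cabs[d d0 H] := near0.
  exists d => // h hd h0; have := H h; rewrite subr0; exact.
split.
- apply (proj2 (cvg_cabs (F := nbhs z) _ l)) => e e0.
  have [d d0 H] := hl' e e0; apply/nbhs_cabs; exists d => // s sd; case: eqVneq => [_|sz].
    by rewrite subrr cabs0.
  have := H (s - z) sd; rewrite subr_eq0 => /(_ sz).
  rewrite /x (_ : (s - z) *: v + (a + z *: v) = a + s *: v); last first.
    by rewrite scalerBl addrCA subrK.
  by rewrite mulrC.
- by rewrite eqxx.
- apply/nbhs_cabs; exists 1 => // s _; case: eqVneq => [->|sz].
    by rewrite subrr mulr0 addr0.
  by rewrite divfK ?subr_eq0// subrKC.
Qed.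

End HolomorphicLines.

Section SliceSeries.
Context {R : realType} {m : nat}.
Local Notation Cm := 'rV[R[i]]_m.+1.
Local Notation RR := (measurableTypeR R).
Local Notation lambda n := (@tuple_measure _ RR R (@lebesgue_measure R) n).
Variables (D : set Cm) (j : 'I_m.+1) (rho : R).
Local Notation S := (@complex_point R m.+1 @^-1` D).

Definition slice_point (s : R[i]) : Cm := s *: delta_mx 0 j.

Definition complete_reinhardt :=
  forall z w : Cm, D z -> (forall i, cabs (w 0 i) <= cabs (z 0 i)) -> D w.

Hypothesis D_open : open D.
Hypothesis D_reinhardt : complete_reinhardt.
Hypothesis rho_gt0 : 0 < rho.
Hypothesis D_slice : forall s, D (slice_point s) <-> cabs s < rho.

Lemma slice_pointE s i : slice_point s 0 i = (if i == j then s else 0).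
Proof. by rewrite !mxE eqxx /= eq_sym; case: eqVneq; rewrite ?mulr1 ?mulr0. Qed.

Lemma reinhardt_rotation w : rotation_invariant w D.
Proof.
have mod1 a z i : cabs (rotC w a z 0 i) = cabs (z 0 i).
  by rewrite mxE cabsM cabs_expi mul1r.
by move=> a z; split=> Dz; apply: (D_reinhardt Dz) => i; rewrite mod1.
Qed.

Lemma slice_point_in z : D z -> D (slice_point (z 0 j)).
Proof.
move=> Dz; apply: (D_reinhardt Dz) => i; rewrite slice_pointE.
by case: eqVneq => [->//|_]; rewrite cabs0 cabs_ge0.
Qed.

(** Two circle actions: [w1] turns all coordinates but [j] simultaneously, [w2] turns [j] alone.
    Averaging over the first projects to the axis; averaging over the second selects a power. *)
Let w1 (i : nat) : R := if i == j :> nat then 0 else 1.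
Let w2 (i : nat) : R := if i == j :> nat then 1 else 0.

Lemma rotC_others a z :
  rotC w1 a z = slice_point (z 0 j) + expi a *: (z - slice_point (z 0 j)).
Proof.
apply/rowP => i; rewrite !mxE eqxx /= /w1 [i == j :> nat](_ : _ = (i == j))//.
rewrite eq_sym; case: eqVneq => [<-|ij].
  by rewrite mul0r expi0 mul1r mulr1 subrr mulr0 addr0.
by rewrite mul1r mulr0 add0r subr0.
Qed.

Lemma rotC_this a z : rotC w2 a z 0 j = expi a * z 0 j.
Proof. by rewrite mxE /w2 eqxx mul1r. Qed.

Section Function.
Variable f : Cm -> R[i].
Hypothesis f_hol : holomorphic_on D (f : Cm -> R[i]^o).

(** The orbit of [z] under [w1] bounds the disc [A + s *: V], [cabs s <= 1], centred at the
    projection [A] of [z] to the axis and contained in [D] by the Reinhardt property. Cauchy's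
    formula at its centre is the mean value property. *)
Lemma mean_value_others z : D z ->
  cint 0 (2 * pi) (fun a => f (rotC w1 a z)) = (2 * pi)%:C * f (slice_point (z 0 j)).
Proof.
move=> Dz; pose A := slice_point (z 0 j); pose V := z - A.
pose g (s : R[i]) := f (A + s *: V).
have dg s : cabs s <= 1 -> exists d, cdifferential g s d.
  move=> s1; apply: holomorphic_line; apply: f_hol.
  apply: (D_reinhardt Dz) => i; rewrite !mxE eqxx /= eq_sym.
  case: eqVneq => [->|_].
    by rewrite !mulr1 subrr mulr0 addr0.
  by rewrite !mulr0 add0r subr0 cabsM ler_piMl ?cabs_ge0.
have c01 : cabs (0 : R[i]) < 1 by rewrite cabs0 ltr01.
have q0 t : cauchy_quotient 0 t = 1 :> R[i].
  by rewrite /cauchy_quotient subr0 mulfV// expi_neq0.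
have := cauchy_kernel c01 dg; rewrite (cint_cauchy_quotient c01).
rewrite (eq_cint (g := fun a => f (rotC w1 a z))); last first.
  by move=> a _; rewrite q0 mulr1 rotC_others.
by move=> ->; rewrite /g scale0r addr0 mulrC.
Qed.

Lemma holomorphic_continuous z : D z -> f @ z --> f z.
Proof. by move=> Dz; exact: (differentiable_continuous (f_hol Dz)). Qed.

Lemma slice_series : exists c : nat -> R[i],
  forall z, cabs z < rho ->
    (forall k, fourier (fun t => f (slice_point (z * expi t))) k =
       (2 * pi)%:C * (z ^+ k * c k))
    /\ exists K r, [/\ 0 <= r, r < 1 &
      forall n, cabs (f (slice_point z) - \sum_(k < n) z ^+ k * c k) <= K * r ^+ n].
Proof.
apply: (@power_series_expansion R (fun s => f (slice_point s)) rho) => // s s1.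
have := @holomorphic_line R m f 0 (delta_mx 0 j) s.
rewrite add0r => h; have [|d hd] := h; first by apply: f_hol; exact/D_slice.
exists d; move: hd; congr cdifferential; apply/funext => t.
by rewrite add0r.
Qed.

End Function.

Lemma ccontinuous_rotC (w : nat -> R) (h : Cm -> R[i]) z :
  (forall z, D z -> h @ z --> h z) -> D z ->
  ccontinuous_itv 0 (2 * pi) (fun a => h (rotC w a z)).
Proof.
move=> ch Dz x _.
have Dx : D (rotC w x z) by exact/reinhardt_rotation.
have rc : (fun a => rotC w a z) @ x --> rotC w x z.
  move=> P /near_rowP[d d0 H].
  have near1 i : \forall a \near x, cabs (rotC w a z 0 i - rotC w x z 0 i) < d.
    have e : (fun a : R => expi (w i * a)) @ x --> expi (w i * x).
      have hw : (fun a : R => w i * a) @ x --> w i * x.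
        by apply: cvgM; [exact: cvg_cst|exact: cvg_id].
      exact (cvg_comp _ _ hw (@expi_cvg R (w i * x))).
    pose proof (proj1 (cvg_cabs _ _) (ccvgM e (ccvg_cst (z 0 i))) d d0) as h1.
    by apply: filterS h1 => a; rewrite !mxE.
  have : \forall a \near x, forall i, cabs (rotC w a z 0 i - rotC w x z 0 i) < d.
    exact (@filter_forall _ _ _ (nbhs x) _ near1).
  by apply: filterS => a; exact: H.
exact (cvg_comp _ _ rc (ch _ Dx)).
Qed.

Hypothesis D_bounded : exists M : R, forall z, D z -> forall i, cabs (z 0 i) <= M.
Hypothesis D_finite : (lambda m.+1.*2 S < +oo)%E.

Let mS : measurable S.
Proof. exact: measurable_preimage. Qed.

Lemma bounded_integrable (u : Cm -> R) :
  measurable_fun S (fun t => u (complex_point t) : RR) ->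
  (exists M, forall z, D z -> `|u z| <= M) ->
  (lambda m.+1.*2).-integrable S (fun t => (u (complex_point t))%:E).
Proof.
move=> mu_ [M H]; apply: (measurable_bounded_integrable mS D_finite mu_).
exists M; split; first exact: num_real.
by move=> x Mx t St; exact: le_trans (H _ St) (ltW Mx).
Qed.

(** On a domain of finite volume this makes square integrable functions integrable. *)
Lemma cabs_le_sqr (z : R[i]) : cabs z <= sqmod z + 1.
Proof.
rewrite -cabs_sqr; have := sqr_ge0 (cabs z - 1); rewrite sqrrB1.
have := cabs_ge0 z; have := sqr_ge0 (cabs z); lra.
Qed.

Lemma ReIm_conj_mul (z w : R[i]) :
  `|complex.Re (z * w)| <= cabs z * cabs w /\ `|complex.Im (z * w)| <= cabs z * cabs w.
Proof. by rewrite -cabsM Re_le_cabs Im_le_cabs. Qed.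

Definition coord_power k (z : Cm) : R[i] := z 0 j ^+ k.

Lemma continuous_coord (z : Cm) : (fun w : Cm => w 0 j) @ z --> z 0 j.
Proof.
apply (proj2 (cvg_cabs (F := nbhs z) _ _)) => e e0.
by apply/near_rowP; exists e => // w; exact.
Qed.

Lemma continuous_coord_power k (z : Cm) : coord_power k @ z --> coord_power k z.
Proof.
elim: k => [|k ih]; first exact (ccvg_cst (F := nbhs z) 1).
have -> : coord_power k.+1 = (fun w => w 0 j * coord_power k w).
  by apply/funext => w; rewrite /coord_power exprS.
exact (ccvgM (@continuous_coord z) ih).
Qed.

Lemma ccvg_conj {T : Type} {F : set_system T} {FF : Filter F} (f : T -> R[i]) z :
  f @ F --> z -> (fun t => (f t)^*) @ F --> z^*.
Proof.
move=> fz; apply (proj2 (cvg_cabs _ _)) => e e0.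
pose proof (proj1 (cvg_cabs _ _) fz e e0) as h; apply: filterS h => t.
by rewrite -rmorphB /= /cabs norm_conjC.
Qed.

(** The coordinate power is bounded on [D], and [cabs (f z)] is at most the integrable function
    [sqmod (f z) + 1]. *)
Lemma cintegrable_bergman (f : Cm -> R[i]) k : bergman_space D f ->
  cintegrable D (fun z => f z * (coord_power k z)^*).
Proof.
move=> [hf ifin].
have cont z : D z -> (fun z => f z * (coord_power k z)^*) @ z --> f z * (coord_power k z)^*.
  move=> Dz.
  exact (ccvgM (holomorphic_continuous hf Dz) (ccvg_conj (@continuous_coord_power k z))).
have [mRe mIm] := measurable_continuous_on D_open cont.
have [mfR mfI] := measurable_continuous_on D_open (holomorphic_continuous hf).
have [M HM] := D_bounded.
pose M' := Num.max M 0.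
have M0 : 0 <= M' by rewrite le_max lexx orbT.
have powM z : D z -> cabs (coord_power k z)^* <= M' ^+ k.
  move=> Dz; rewrite /cabs norm_conjC -/(cabs _) cabsX.
  by rewrite lerXn2r ?nnegrE ?cabs_ge0// (le_trans (HM _ Dz j))// le_max lexx.
have msq : measurable_fun S (fun t => sqmod (f (complex_point t)) : RR).
  by apply: measurable_funD; apply: measurable_funX.
have isq : (lambda m.+1.*2).-integrable S
    (fun t => ((sqmod (f (complex_point t)) + 1) * M' ^+ k)%:E).
  have i1 : (lambda m.+1.*2).-integrable S (fun t => (sqmod (f (complex_point t)))%:E).
    apply/integrableP; split; first exact/measurable_EFinP.
    under eq_integral => t _ do rewrite gee0_abs ?lee_fin ?addr_ge0 ?sqr_ge0//.
    exact: ifin.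
  have i2 : (lambda m.+1.*2).-integrable S (fun t => (1 : R)%:E).
    apply: (bounded_integrable (u := fun=> 1)); first exact: measurable_cst.
    by exists 1 => z _; rewrite normr1.
  have := integrableZr mS (M' ^+ k) (integrableD mS i1 i2).
  by under eq_fun do rewrite -EFinD -EFinM.
have le z : D z -> cabs (f z) * cabs (coord_power k z)^* <= (sqmod (f z) + 1) * M' ^+ k.
  move=> Dz; apply: ler_pM; rewrite ?cabs_ge0//; last exact: powM.
  exact: cabs_le_sqr.
have sqp z : 0 <= (sqmod (f z) + 1) * M' ^+ k.
  by rewrite mulr_ge0 ?exprn_ge0// addr_ge0// addr_ge0 ?sqr_ge0.
split => //.
  apply: (le_integrable mS _ _ isq); first exact/measurable_EFinP.
  move=> t St /=; rewrite lee_fin [leRHS]ger0_norm//.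
  by rewrite (le_trans _ (le _ St))//; case: (ReIm_conj_mul (f (complex_point t)) (coord_power k (complex_point t))^*).
apply: (le_integrable mS _ _ isq); first exact/measurable_EFinP.
move=> t St /=; rewrite lee_fin [leRHS]ger0_norm//.
by rewrite (le_trans _ (le _ St))//; case: (ReIm_conj_mul (f (complex_point t)) (coord_power k (complex_point t))^*).
Qed.

(* The squared norm of [z_j ^ k] in the Bergman space. *)
Definition coord_moment k : R :=
  \int[lambda m.+1.*2]_(t in S) (sqmod (complex_point t 0 j)) ^+ k.

Lemma measurable_coord_sqmod k :
  measurable_fun S (fun t => (sqmod (complex_point t 0 j)) ^+ k : RR).
Proof.
have [mR mI] := measurable_continuous_on (f := fun z : Cm => z 0 j) D_open
  (fun z _ => @continuous_coord z).
by apply: measurable_funX; apply: measurable_funD; apply: measurable_funX.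
Qed.

Lemma coord_sqmod_bounded k :
  exists M, forall z, D z -> `|sqmod (z 0 j) ^+ k| <= M.
Proof.
have [M HM] := D_bounded; exists ((Num.max M 0 ^+ 2) ^+ k) => z Dz.
have s0 : 0 <= sqmod (z 0 j) by rewrite addr_ge0 ?sqr_ge0.
rewrite ger0_norm ?exprn_ge0// lerXn2r ?nnegrE ?sqr_ge0//.
rewrite -cabs_sqr lerXn2r ?nnegrE ?cabs_ge0// ?le_max ?lexx ?orbT//.
by rewrite (HM _ Dz j).
Qed.

Lemma coord_sqmod_integrable k :
  (lambda m.+1.*2).-integrable S (fun t => (sqmod (complex_point t 0 j) ^+ k)%:E).
Proof.
apply: (bounded_integrable (u := fun z => sqmod (z 0 j) ^+ k)).
  exact: measurable_coord_sqmod.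
exact: coord_sqmod_bounded.
Qed.

Lemma conjM (z w : R[i]) : (z * w)^* = z^* * w^*.
Proof. exact: rmorphM. Qed.

Lemma conjX (z : R[i]) n : (z ^+ n)^* = z^* ^+ n.
Proof. exact: rmorphXn. Qed.

Lemma conj_expi t : (expi t)^* = (expi t)^-1 :> R[i].
Proof. by rewrite expiV /expi cosN sinN. Qed.

Lemma sqmod_mulJ (z : R[i]) : z * z^* = (sqmod z)%:C.
Proof. by case: z => a b; apply: complex_ext; rewrite /sqmod /=; ring. Qed.

Lemma integralC_cstZ (c : R[i]) (u : Cm -> R) :
  (lambda m.+1.*2).-integrable S (fun t => (u (complex_point t))%:E) ->
  integralC D (fun z => c * (u z)%:C) =
  c * (\int[lambda m.+1.*2]_(t in S) u (complex_point t))%:C.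
Proof.
move=> iu; apply: complex_ext; rewrite ?Re_mulR ?Im_mulR ?ReMr ?ImMr /=.
  rewrite -RintegralZl//; apply: eq_Rintegral => t _.
  by case: (c) => a b /=; rewrite mulr0 subr0.
rewrite -RintegralZl//; apply: eq_Rintegral => t _.
by case: (c) => a b /=; rewrite mulr0 add0r.
Qed.

Lemma eq_integralC (f g : Cm -> R[i]) : (forall z, D z -> f z = g z) ->
  integralC D f = integralC D g.
Proof.
by move=> fg; rewrite /integralC; congr (_ +i* _); apply: eq_Rintegral => t;
  rewrite inE => St; rewrite fg.
Qed.

(* Averaging over the rotations of the coordinates leaves only the [k]-th term
   of the expansion of [f] along the slice. *)
Lemma pairing_coord_power (f : Cm -> R[i]) : bergman_space D f ->
  exists c : nat -> R[i],
    (forall k, integralC D (fun z => f z * (coord_power k z)^*) =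
       c k * (coord_moment k)%:C) /\
    forall s, cabs s < rho -> exists K r, [/\ 0 <= r, r < 1 &
      forall n, cabs (f (slice_point s) - \sum_(k < n) s ^+ k * c k) <= K * r ^+ n].
Proof.
move=> bf; have hf := bf.1; have [c Hc] := slice_series hf.
exists c; split=> [k|s s1]; last by have [_] := Hc s s1.
pose F (z : Cm) := f z * (coord_power k z)^*.
have cF z : D z -> F @ z --> F z.
  move=> Dz.
  exact (ccvgM (holomorphic_continuous hf Dz) (ccvg_conj (@continuous_coord_power k z))).
(* First average: [w1] fixes the coordinate [j], hence the power, and replaces [f] by its value on
   the axis. *)
have [iF1 eF1] := integralC_average (reinhardt_rotation w1)
  (fun z Dz => ccontinuous_rotC (w := w1) cF Dz) (cintegrable_bergman k bf).
pose G (z : Cm) := (2 * pi)%:C * f (slice_point (z 0 j)) * (coord_power k z)^*.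
have F1E z : D z -> cint 0 (2 * pi) (fun a => F (rotC w1 a z)) = G z.
  move=> Dz; rewrite /G -(mean_value_others hf Dz) [RHS]mulrC.
  have cfr : ccontinuous_itv 0 (2 * pi) (fun a => f (rotC w1 a z)).
    exact: (ccontinuous_rotC (w := w1) (fun z => holomorphic_continuous hf (z := z)) Dz).
  rewrite -(cintZ _ cfr); apply: eq_cint => a _; rewrite /F mulrC; congr (_^* * _).
  by rewrite /coord_power mxE /w1 eqxx mul0r expi0 mul1r.
have cG z : D z -> G @ z --> G z.
  move=> Dz.
  have cs : (fun z : Cm => slice_point (z 0 j)) @ z --> slice_point (z 0 j).
    move=> P /near_rowP[d d0 H].
    have /near_rowP[e e0 He] : nbhs z [set w : Cm | cabs (w 0 j - z 0 j) < d].
      by apply/near_rowP; exists d => // w; exact.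
    apply/near_rowP; exists e => // w /He wz; apply: H => i.
    rewrite !slice_pointE; case: eqVneq => _ //.
    by rewrite subrr cabs0.
  have Ds := slice_point_in Dz.
  exact (ccvgM (ccvgM (ccvg_cst _) (cvg_comp _ _ cs (holomorphic_continuous hf Ds)))
    (ccvg_conj (@continuous_coord_power k z))).
have iG : cintegrable D G.
  case: iF1 => mS1 iR iI; split => //.
    by apply: eq_integrable iR => // t; rewrite inE => St; rewrite F1E.
  by apply: eq_integrable iI => // t; rewrite inE => St; rewrite F1E.
(* Second average: on the circle through [z 0 j] the conjugate power contributes the character of
   index [- k], so the [k]-th Fourier coefficient of [f] on the axis appears. *)
have [_ eG] := integralC_average (reinhardt_rotation w2)
  (fun z Dz => ccontinuous_rotC (w := w2) cG Dz) iG.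
have G1E z : D z -> cint 0 (2 * pi) (fun a => G (rotC w2 a z)) =
    ((2 * pi)%:C * (2 * pi)%:C * c k) * (sqmod (z 0 j) ^+ k)%:C.
  move=> Dz; have zr : cabs (z 0 j) < rho by apply/D_slice; exact: slice_point_in.
  have [/(_ k) hk _] := Hc _ zr.
  transitivity (cint 0 (2 * pi) (fun a => ((2 * pi)%:C * (z 0 j ^+ k)^*) *
     (f (slice_point (z 0 j * expi a)) * (expi a)^-1 ^+ k))).
    apply: eq_cint => a _; rewrite /G /coord_power rotC_this [expi a * _]mulrC.
    have E : ((z 0 j * expi a) ^+ k)^* = (z 0 j ^+ k)^* * (expi a)^-1 ^+ k.
      apply: (etrans (conjX (z 0 j * expi a) k)).
      apply: (etrans (congr1 (fun x => x ^+ k) (conjM (z 0 j) (expi a)))).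
      apply: (etrans (exprMn _ _ _)); congr (_ * _).
        by symmetry; exact: conjX.
      by congr (_ ^+ _); exact: conj_expi.
    transitivity ((2 * pi)%:C * f (slice_point (z 0 j * expi a)) *
      ((z 0 j ^+ k)^* * (expi a)^-1 ^+ k)); first by congr (_ * _); exact: E.
    by ring.
  have cfs : ccontinuous_itv 0 (2 * pi) (fun a => f (slice_point (z 0 j * expi a))).
    have cw := ccontinuous_rotC (w := w2) (fun z => holomorphic_continuous hf (z := z))
      (slice_point_in Dz).
    move=> x xI; have := cw x xI.
    have E a : rotC w2 a (slice_point (z 0 j)) = slice_point (z 0 j * expi a).
      apply/rowP => i; rewrite mxE !slice_pointE /w2.
      rewrite [i == j :> nat](_ : _ = (i == j))//; case: eqVneq => _.
        by rewrite mul1r mulrC.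
      by rewrite mulr0.
    by under eq_fun do rewrite E; rewrite E.
  have cV := ccontinuous_itvX (n := k) (@ccontinuous_expiV R 0 (2 * pi)).
  rewrite (cintZ _ (ccontinuous_itvM cfs cV)).
  have -> : cint 0 (2 * pi) (fun a => f (slice_point (z 0 j * expi a)) *
      (expi a)^-1 ^+ k) = (2 * pi)%:C * (z 0 j ^+ k * c k) by exact: hk.
  have -> : (sqmod (z 0 j) ^+ k)%:C = z 0 j ^+ k * (z 0 j ^+ k)^*.
    apply: (etrans _ (congr1 (fun x => z 0 j ^+ k * x) (esym (conjX (z 0 j) k)))).
    apply: (etrans _ (exprMn _ _ _)).
    by apply: (etrans _ (congr1 (fun x => x ^+ k) (esym (sqmod_mulJ (z 0 j))))); rewrite rmorphXn.
  by ring.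
have p0 := @twopi_neq0 R.
apply: (mulfI p0); apply: (mulfI p0).
rewrite -eF1 (eq_integralC F1E) -eG (eq_integralC G1E).
rewrite (integralC_cstZ _ (u := fun z => sqmod (z 0 j) ^+ k))//.
  by rewrite /coord_moment; ring.
exact: coord_sqmod_integrable.
Qed.

Lemma coord_power_bergman k : bergman_space D (coord_power k).
Proof.
split.
  move=> z _; elim: k => [|k ih].
    rewrite (_ : coord_power 0 = cst 1); first exact: differentiable_cst.
    by apply/funext => w; rewrite /coord_power expr0.
  rewrite (_ : coord_power k.+1 = (fun w : Cm => w 0 j) * coord_power k).
    by apply: differentiableM => //; exact: differentiable_coord.
  by apply/funext => w; rewrite /coord_power exprS.
have h : (fun t => (sqmod (coord_power k (complex_point t)))%:E) =
    (fun t => (sqmod (@complex_point R m.+1 t 0 j) ^+ k)%:E).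
  by apply/funext => t; rewrite -!cabs_sqr cabsX exprAC.
rewrite h; have /integrableP[_] := coord_sqmod_integrable k.
congr (_ < _)%E; apply: eq_integral => t _.
by rewrite gee0_abs// lee_fin exprn_ge0// addr_ge0 ?sqr_ge0.
Qed.

Lemma integralC_conj (f g : Cm -> R[i]) : cintegrable D f ->
  (forall z, D z -> g z = (f z)^*) -> integralC D g = (integralC D f)^*.
Proof.
move=> [_ _ iI] gf; rewrite (eq_integralC gf); apply: complex_ext => /=.
  by apply: eq_Rintegral => t _; case: (f _).
rewrite -mulN1r -RintegralZl//; apply: eq_Rintegral => t _.
by case: (f _) => a b /=; rewrite mulN1r.
Qed.

(** Reproducing the function [z_j ^ k] at the axis point of parameter [s] gives
    [c k * coord_moment k = (s ^ k)^*] for the coefficients of the kernel along the axis; on the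
    diagonal this leaves powers of [sqmod s]. *)
Theorem kernel_series K : is_bergman_kernel D K ->
  (forall k, 0 < coord_moment k) /\
  forall s, cabs s < rho -> exists C r, [/\ 0 <= r, r < 1 & forall n,
    `|complex.Re (K (slice_point s) (slice_point s)) -
      \sum_(k < n) sqmod s ^+ k / coord_moment k| <= C * r ^+ n].
Proof.
move=> HK.
have coef s : cabs s < rho -> exists c : nat -> R[i],
    (forall k, c k * (coord_moment k)%:C = (s ^+ k)^*) /\
    forall s', cabs s' < rho -> exists C r, [/\ 0 <= r, r < 1 &
      forall n, cabs (K (slice_point s') (slice_point s) -
        \sum_(k < n) s' ^+ k * c k) <= C * r ^+ n].
  move=> s1; have Ds : D (slice_point s) by exact/D_slice.
  have [bK rep] := HK _ Ds.
  have [c [Hc Hs]] := pairing_coord_power bK; exists c; split => // k.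
  rewrite -Hc.
  have := rep _ (coord_power_bergman k).
  rewrite {1}/coord_power slice_pointE eqxx => ->.
  have iK := cintegrable_bergman k bK.
  have E : integralC D (fun z => coord_power k z * (K z (slice_point s))^*) =
     (integralC D (fun z => K z (slice_point s) * (coord_power k z)^*))^*.
    apply: integralC_conj => // z _.
    apply: (etrans (mulrC _ _)); apply: (etrans _ (esym (conjM _ _))).
    by congr (_ * _); exact (esym (conjcK _)).
  by rewrite E; exact (esym (conjcK _)).
have mom_ge0 k : 0 <= coord_moment k.
  by apply: Rintegral_ge0 => t _; rewrite exprn_ge0// addr_ge0 ?sqr_ge0.
(* A vanishing moment would make the reproducing identity say [s ^ k = 0] at [s = rho / 2]. *)
have mom_gt0 k : 0 < coord_moment k.
  rewrite lt_neqAle mom_ge0 andbT eq_sym; apply/eqP => m0.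
  have r2 : cabs (rho / 2)%:C < rho.
    by rewrite cabs_ofreal gtr0_norm ?divr_gt0// ltr_pdivrMr// ltr_pMr// ltr1n.
  have [c [/(_ k) Hc _]] := coef _ r2; move: Hc; rewrite m0 mulr0 => /esym/eqP.
  rewrite -cabs_eq0 /cabs norm_conjC -/(cabs _) cabsX expf_eq0 cabs_ofreal.
  by rewrite normr_eq0 mulf_eq0 invr_eq0 gt_eqF ?pnatr_eq0 ?andbF.
split=> // s s1; have [c [Hc Hs]] := coef s s1.
have [C [r [r0 rlt1 H]]] := Hs s s1; exists C, r; split => // n.
apply: le_trans (H n).
have -> : \sum_(k < n) sqmod s ^+ k / coord_moment k =
    complex.Re (\sum_(k < n) s ^+ k * c k).
  have E k : s ^+ k * c k = (sqmod s ^+ k / coord_moment k)%:C.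
    have mk0 : (coord_moment k)%:C != 0.
      by rewrite -cabs_eq0 cabs_ofreal normr_eq0 gt_eqF.
    apply: (mulIf mk0); rewrite -mulrA Hc -rmorphM /= divfK ?gt_eqF//.
    apply: (etrans (congr1 (fun x => s ^+ k * x) (conjX s k))).
    apply: (etrans (esym (exprMn _ _ _))).
    by apply: (etrans (congr1 (fun x => x ^+ k) (sqmod_mulJ s))); rewrite rmorphXn.
  elim: n {H} => [|n ih]; first by rewrite !big_ord0.
  by rewrite !big_ord_recr /= ReD -ih E.
by rewrite -ReB Re_le_cabs.
Qed.

End SliceSeries.

(** * Moments of Hartogs domains *)

Section BetaIntegral.
Context {R : realType}.

Lemma continuous_poly_like (r : R) k p :
  continuous (fun y : R => y ^+ k * (r - y) ^+ p).
Proof.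
move=> y; apply: cvgM; first exact: exprn_continuous.
apply: (@continuous_comp _ _ _ (fun y => r - y) (fun x => x ^+ p)).
  by apply: cvgB; [exact: cvg_cst|exact: cvg_id].
exact: exprn_continuous.
Qed.

Lemma is_derive_expn (u : R -> R) (x du : R) n : is_derive x (1 : R) u du ->
  is_derive x (1 : R) (fun y => u y ^+ n.+1) (n.+1%:R * u x ^+ n * du).
Proof.
by move=> hu; have := is_deriveX n.+1 hu; rewrite exprfctE.
Qed.

Lemma is_derive_mul (u v : R -> R) (x du dv : R) :
  is_derive x (1 : R) u du -> is_derive x (1 : R) v dv ->
  is_derive x (1 : R) (fun y => u y * v y) (u x * dv + v x * du).
Proof. by move=> hu hv; exact: is_deriveM. Qed.

Lemma is_derive_mull (u : R -> R) (c x du : R) : is_derive x (1 : R) u du ->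
  is_derive x (1 : R) (fun y => c * u y) (c * du).
Proof. by move=> hu; exact: is_deriveZ. Qed.

Lemma is_derive_subl (r x : R) : is_derive x (1 : R) (fun y => r - y) (-1).
Proof.
have := is_deriveB (is_derive_cst r x (1 : R)) (is_derive_id x (1 : R)).
by rewrite sub0r.
Qed.

(** Euler's Beta integral, by induction on [p]: integrating the derivative of
    [y ^ (k + 1) (r - y) ^ (p + 1)], which vanishes at both ends, moves one unit from the exponent
    of [r - y] to that of [y]. *)
Lemma beta_integral (r : R) k p : 0 < r ->
  itg 0 r (fun y => y ^+ k * (r - y) ^+ p) =
  k`!%:R * p`!%:R / (k + p).+1`!%:R * r ^+ (k + p).+1.
Proof.
move=> r0.
have cpl k' p' : continuous_itv 0 r (fun y : R => y ^+ k' * (r - y) ^+ p').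
  by move=> x _; exact: continuous_poly_like.
have f0 n : n`!%:R != 0 :> R by rewrite pnatr_eq0 -lt0n fact_gt0.
have n0 n : n.+1%:R != 0 :> R by rewrite pnatr_eq0.
elim: p k => [|p ih] k.
  have dF (x : R) : is_derive x (1 : R) (fun y => k.+1%:R^-1 * y ^+ k.+1)
      (x ^+ k * (r - x) ^+ 0).
    have := is_derive_mull k.+1%:R^-1 (is_derive_expn k (is_derive_id x (1 : R))).
    by rewrite expr0 !mulr1 mulKf.
  rewrite (itg_FTC r0 dF); last exact: continuous_poly_like.
  rewrite expr0n /= mulr0 subr0 addn0 fact0 mulr1 factS natrM.
  move: (f0 k) (n0 k); move: (k`!%:R : R) (k.+1%:R : R) => a c a0 c0.
  by field; rewrite a0 c0.
have dF (x : R) : is_derive x (1 : R) (fun y => y ^+ k.+1 * (r - y) ^+ p.+1)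
    (k.+1%:R * (x ^+ k * (r - x) ^+ p.+1) -
     p.+1%:R * (x ^+ k.+1 * (r - x) ^+ p)).
  have := is_derive_mul (is_derive_expn k (is_derive_id x (1 : R)))
     (is_derive_expn p (is_derive_subl r x)).
  by move=> /is_derive_eq; apply; rewrite /=; ring.
have cc : continuous (fun x : R => k.+1%:R * (x ^+ k * (r - x) ^+ p.+1) -
     p.+1%:R * (x ^+ k.+1 * (r - x) ^+ p)).
  by move=> x; apply: cvgB; apply: cvgM; (exact: cvg_cst || exact: continuous_poly_like).
have := itg_FTC r0 dF cc; rewrite subrr !expr0n /= mulr0 mul0r subrr.
rewrite itgB; last 2 first.
- by apply: continuous_itvM; [exact: continuous_itv_cst|exact: cpl].
- by apply: continuous_itvM; [exact: continuous_itv_cst|exact: cpl].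
rewrite !itgZ; try exact: cpl.
move=> /subr0_eq H; apply: (mulfI (n0 k)); rewrite H ih.
rewrite addSn addnS (factS k) (factS p) !natrM.
by move: ((k + p).+2`!%:R^-1 : R) (k.+1%:R : R) (p.+1%:R : R) => d a c; ring.
Qed.

End BetaIntegral.

Section HartogsMoments.
Context {R : realType}.
Local Notation RR := (measurableTypeR R).
Local Notation mu := (@lebesgue_measure R).
Local Notation lambda n := (@tuple_measure _ RR R mu n).
Local Notation kappa := (@kappa R).

Definition sqsum p (t : p.*2.-tuple RR) : R :=
  \sum_(i < p) sqmod (@complex_point R p t 0 i).

Lemma complex_point_tcons0 p (x y : RR) (t : p.*2.-tuple RR) :
  sqmod (@complex_point R p.+1 (tcons (x, tcons (y, t))) 0 ord0) = sqnorm2 (x, y).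
Proof. by rewrite mxE. Qed.

Lemma complex_point_tconsS p (x y : RR) (t : p.*2.-tuple RR) i :
  @complex_point R p.+1 (tcons (x, tcons (y, t))) 0 (lift ord0 i) =
  complex_point t 0 i.
Proof. by rewrite !mxE. Qed.

Lemma sqsum_tcons p (x y : RR) (t : p.*2.-tuple RR) :
  @sqsum p.+1 (tcons (x, tcons (y, t))) = sqnorm2 (x, y) + sqsum t.
Proof.
rewrite /sqsum big_ord_recl complex_point_tcons0; congr (_ + _).
by apply: eq_bigr => i _; rewrite complex_point_tconsS.
Qed.

Lemma fiber_sqnorm_tcons p (x y : RR) (t : p.*2.-tuple RR) :
  fiber_sqnorm (@complex_point R p.+1 (tcons (x, tcons (y, t)))) = sqsum t.
Proof.
rewrite /fiber_sqnorm big_mkcond big_ord_recl eqxx /= add0r.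
by apply: eq_bigr => i _; rewrite complex_point_tconsS.
Qed.

Lemma measurable_sqsum p : measurable_fun setT (@sqsum p : _ -> RR).
Proof.
apply: measurable_sum => i.
have -> : (fun t : p.*2.-tuple RR => sqmod (complex_point t 0 i)) =
    (fun t : p.*2.-tuple RR => nth 0 t i.*2 ^+ 2 + nth 0 t i.*2.+1 ^+ 2).
  by apply/funext => t; rewrite mxE.
by apply: measurable_funD; apply: measurable_funX; exact: measurable_nth.
Qed.

(** The volume of the ball of squared radius [r] in complex dimension [p], with [kappa] in the role
    of [pi]. The test on [r] matters even for [p = 0], where it yields the indicator of [0 < r]. *)
Definition ball_volume p (r : R) : R :=
  if 0 < r then kappa ^+ p * r ^+ p / p`!%:R else 0.

Lemma ball_volume_ge0 p r : 0 <= ball_volume p r.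
Proof.
rewrite /ball_volume; case: ifP => // r0; rewrite divr_ge0// mulr_ge0//.
  by rewrite exprn_ge0// ltW// kappa_gt0.
by rewrite exprn_ge0// ltW.
Qed.

Lemma measurable_ball_volume p : measurable_fun setT (@ball_volume p : RR -> RR).
Proof.
apply: measurable_fun_ifT.
- by apply: measurable_fun_ltr => //; exact: measurable_cst.
- by apply: measurable_funM => //; apply: measurable_funM => //; exact: measurable_funX.
- exact: measurable_cst.
Qed.

(* The weight [y ^ k] is integrated against the volumes of the fibres of a ball
   over a disc. *)
Lemma integral_weight_ball_volume k p (r : R) :
  (\int[mu]_(y in `[0%R, +oo[) (y ^+ k * ball_volume p (r - y))%:E =
   (if 0 < r then kappa ^+ p * k`!%:R / (k + p).+1`!%:R * r ^+ (k + p).+1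
    else 0)%:E)%E.
Proof.
have [r0|r0] := ltP 0 r; last first.
  apply: integral0_eq => y /=; rewrite in_itv/= andbT => y0.
  rewrite /ball_volume ifF ?mulr0//; apply/negbTE; rewrite -leNgt.
  by rewrite subr_le0 (le_trans r0).
pose g (y : R) := kappa ^+ p / p`!%:R * (y ^+ k * (r - y) ^+ p).
have cg : continuous_itv 0 r g.
  move=> x _; apply: cvgM; first exact: cvg_cst.
  exact: continuous_poly_like.
have ig := continuous_itv_integrable cg.
transitivity (\int[mu]_(y in `[0%R, r[) (g y)%:E)%E.
  rewrite [LHS]integral_mkcond [RHS]integral_mkcond; apply: eq_integral => y _.
  rewrite !patchE !mem_setE !in_itv/= andbT /ball_volume subr_gt0.
  case: (leP 0 y) => //= y0; case: (ltP y r) => yr; last by rewrite mulr0.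
  by rewrite /g; congr EFin; ring.
rewrite integral_itv_bndo_bndc; last first.
  apply/measurable_EFinP; apply: measurable_funS (_ : measurable_fun setT g) => //.
  apply: continuous_measurable_fun => x.
  by apply: cvgM; [exact: cvg_cst|exact: continuous_poly_like].
rewrite -[LHS]fineK; last exact: integrable_fin_num.
rewrite -[fine _]/(itg 0 r g) itgZ; last by move=> x _; exact: continuous_poly_like.
rewrite beta_integral//; congr EFin.
have f0 n : n`!%:R != 0 :> R by rewrite pnatr_eq0 -lt0n fact_gt0.
move: (f0 p) (f0 (k + p).+1); move: (p`!%:R : R) ((k + p).+1`!%:R : R) => a d a0 d0.
by field; rewrite a0 d0.
Qed.

Lemma measurable_ball p (r : R) : measurable [set t : p.*2.-tuple RR | sqsum t < r].
Proof.
rewrite (_ : [set t | _] = @sqsum p @^-1` `]-oo, r[%classic).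
  by rewrite -[X in measurable X]setTI; apply: measurable_sqsum.
by apply/seteqP; split => t /=; rewrite in_itv.
Qed.

(** One complex coordinate is sliced off; the slice over a point of squared modulus [u] is a ball of
    squared radius [r - u], and the radial integral of its volume is a Beta integral. *)
Theorem integral_ball_volume p (r : R) :
  (\int[lambda p.*2]_t (\1_[set t | sqsum t < r] t)%:E = (ball_volume p r)%:E)%E.
Proof.
have m1 q (s : R) : measurable_fun setT
    (fun t : q.*2.-tuple RR => (\1_[set t | sqsum t < s] t)%:E : \bar R).
  by apply/measurable_EFinP; apply: measurable_indic; exact: measurable_ball.
elim: p r => [|p ih] r.
  rewrite [LHS](integral_dirac _ measurableT (m1 0%N r)) diracT mul1e indicE /ball_volume.
  rewrite (_ : ([tuple] \in _) = (0 < r)); last first.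
    by apply/idP/idP; rewrite inE/= /sqsum big_ord0.
  by case: ifP => _; rewrite ?expr0 ?fact0 ?mulr1 ?divr1 ?mul1r.
have p1 (t : p.+1.*2.-tuple RR) :
    (0 <= (\1_[set t : p.+1.*2.-tuple RR | sqsum t < r] t)%:E :> \bar R)%E.
  by rewrite lee_fin.
rewrite [LHS](integral_tuple_cons2 (m1 p.+1 r) p1).
pose f (u : RR) : \bar R := (ball_volume p (r - u))%:E.
have mf : measurable_fun setT f.
  apply/measurable_EFinP; apply: (measurableT_comp (@measurable_ball_volume p)).
  by apply: measurable_funB => //; exact: measurable_cst.
have f0 u : (0 <= f u)%E by rewrite lee_fin ball_volume_ge0.
transitivity (plane_integral (fun z => f (sqnorm2 z))).
  apply: eq_plane_integral => -[x y]; rewrite /f -ih; apply: eq_integral => t _.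
  rewrite !indicE; congr ((nat_of_bool _)%:R%:E).
  by apply/idP/idP; rewrite !inE/= sqsum_tcons ltrBrDl.
rewrite plane_integral_radial//.
have := integral_weight_ball_volume 0 p r.
under eq_integral do rewrite expr0 mul1r.
move=> ->; rewrite -EFinM; congr EFin; rewrite /ball_volume add0n fact0 mulr1.
case: ifP => _; rewrite ?mulr0// (exprS kappa).
by move: (p.+1`!%:R^-1 : R) => d; ring.
Qed.

End HartogsMoments.

Lemma continuous_sqmod_coord {R : realType} {m : nat} (z : 'rV[R[i]]_m.+1) i (e : R) : 0 < e ->
  \forall w \near z, `|sqmod ((w : 'rV[R[i]]_m.+1) 0 i) - sqmod (z 0 i)| < e.
Proof.
move=> e0; pose c := cabs (z 0 i).
have c0 : 0 <= c := cabs_ge0 _.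
pose d := Num.min 1 (e / (2 * c + 1)).
have k0 : 0 < 2 * c + 1 by rewrite ltr_wpDl// mulr_ge0.
have d0 : 0 < d by rewrite lt_min ltr01 divr_gt0.
apply/near_rowP; exists d => // w wz.
have := wz i; set h := cabs _ => hd.
have h0 : 0 <= h := cabs_ge0 _.
have d1 : d <= 1 by rewrite ge_min lexx.
have de : d * (2 * c + 1) <= e.
  by rewrite -ler_pdivlMr// ge_min lexx orbT.
have l1 : cabs (w 0 i) <= c + h.
  by rewrite -[w 0 i](subrK (z 0 i)) addrC (le_trans (ler_cabsD _ _)).
have l2 : c <= cabs (w 0 i) + h.
  rewrite /c -[z 0 i](subrK (w 0 i)) addrC (le_trans (ler_cabsD _ _))// lerD2l.
  by rewrite /h cabs_dist.
have w0 := cabs_ge0 (w 0 i).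
have hd1 : h * (2 * c + h) < e.
  have : h * (2 * c + h) <= h * (2 * c + 1) by rewrite ler_wpM2l// lerD2l ltW// (lt_le_trans hd).
  move=> /le_lt_trans; apply; apply: lt_le_trans de.
  by rewrite ltr_pM2r.
rewrite -!cabs_sqr -/c subr_sqr normrM.
have n1 : `|cabs (w 0 i) - c| <= h by rewrite ler_norml; apply/andP; split; lra.
have n2 : `|cabs (w 0 i) + c| <= 2 * c + h by rewrite ger0_norm ?addr_ge0//; lra.
by apply: le_lt_trans hd1; rewrite ler_pM.
Qed.

(** * Geometry of Hartogs domains *)

Section HartogsDomain.
Context {R : realType} {p : nat}.
Local Notation Cm := 'rV[R[i]]_p.+2.
Variables (b : \bar R) (F : R -> R).
Local Notation I := (base_interval b).
Local Notation D := (hartogs_domain b F : set Cm).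
Hypothesis b_gt0 : (0 < b)%E.
Hypothesis F_gt0 : forall x, I x -> 0 < F x.
Hypothesis F_nincr : forall x y, I x -> I y -> x <= y -> F y <= F x.

Lemma continuous_derivable_within (A : set R) (f : R -> R) x :
  derivable_within A f x -> forall e, 0 < e ->
  exists2 d, 0 < d & forall y, A y -> `|y - x| < d -> `|f y - f x| < e.
Proof.
move=> /cvg_ex[/= l /cvgrPdist_lt/(_ _ ltr01)]; rewrite near_withinE => -[d /= d0 H] e e0.
pose K := `|l| + 1.
have K0 : 0 < K by rewrite ltr_wpDl.
exists (Num.min d (e / K)); first by rewrite lt_min d0 divr_gt0.
move=> y Ay; rewrite lt_min => /andP[yd ye].
have [->|yx] := eqVneq y x; first by rewrite subrr normr0.
have := H y; rewrite /= distrC => /(_ yd yx Ay) h.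
have q : `|difference_quotient f x y| <= K.
  rewrite -[difference_quotient _ _ _](subrK l) addrC.
  by rewrite (le_trans (ler_normD _ _))// lerD2l distrC ltW.
have yx0 : y - x != 0 by rewrite subr_eq0.
have -> : f y - f x = difference_quotient f x y * (y - x).
  by rewrite /difference_quotient divfK.
rewrite normrM (@le_lt_trans _ _ (K * `|y - x|))//; first by rewrite ler_wpM2r.
by rewrite mulrC -ltr_pdivlMr.
Qed.

Lemma sqmod_ge0 (s : R[i]) : 0 <= sqmod s.
Proof. by rewrite addr_ge0 ?sqr_ge0. Qed.

Lemma sqmod0 : sqmod (0 : R[i]) = 0.
Proof. by rewrite /sqmod /= expr0n addr0. Qed.

Lemma fiber_sqnorm_ge0 (z : Cm) : 0 <= fiber_sqnorm z.
Proof. by apply: sumr_ge0 => i _; exact: sqmod_ge0. Qed.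

Lemma base_interval0 : I 0.
Proof. by split. Qed.

Lemma base_interval_le x y : I y -> 0 <= x -> x <= y -> I x.
Proof. by move=> [_ yb] x0 xy; split => //; rewrite (le_lt_trans _ yb)// lee_fin. Qed.

Lemma hartogs_base (z : Cm) : D z -> I (sqmod (z 0 ord0)).
Proof. by move=> [zb _]; split => //; exact: sqmod_ge0. Qed.

(** This is where monotonicity of [F] acts: decreasing the modulus of the base coordinate does not
    shrink the fibre. *)
Lemma hartogs_reinhardt : complete_reinhardt D.
Proof.
move=> z w Dz wz; have [zb zF] := Dz.
have sq i : sqmod (w 0 i) <= sqmod (z 0 i).
  by rewrite -!cabs_sqr lerXn2r ?nnegrE ?cabs_ge0.
have Iw : I (sqmod (w 0 ord0)).
  exact: base_interval_le (hartogs_base Dz) (sqmod_ge0 _) (sq _).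
split; first by case: Iw.
apply: (@le_lt_trans _ _ (fiber_sqnorm z)); first exact: ler_sum.
by apply: lt_le_trans zF _; apply: F_nincr => //; exact: hartogs_base.
Qed.

Definition fiber_index : 'I_p.+2 := lift ord0 ord0.

Lemma hartogs_slice s : D (slice_point fiber_index s) <-> cabs s < Num.sqrt (F 0).
Proof.
have F00 := F_gt0 base_interval0.
have -> : (cabs s < Num.sqrt (F 0)) = (sqmod s < F 0).
  rewrite -cabs_sqr -[X in _ = (_ < X)](sqr_sqrtr (ltW F00)).
  by rewrite ltr_pXn2r ?nnegrE ?cabs_ge0 ?sqrtr_ge0.
have fib : fiber_sqnorm (slice_point fiber_index s) = sqmod s.
  rewrite /fiber_sqnorm (bigD1 fiber_index)//= big1 => [|i /andP[_ ij]].
    by rewrite addr0 slice_pointE eqxx.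
  by rewrite slice_pointE (negbTE ij) sqmod0.
have z0 : sqmod (slice_point fiber_index s 0 ord0) = 0.
  by rewrite slice_pointE /= sqmod0.
by rewrite /hartogs_domain /= z0 fib; split=> [[]|] //; split.
Qed.

Lemma hartogs_bounded : bounded_set D ->
  exists M : R, forall z, D z -> forall i, cabs (z 0 i) <= M.
Proof.
move=> [M0 [M0real H]].
have M1real : M0 + 1 + 1 \is Num.real by rewrite !rpredD// rpred1.
exists (complex.Re (M0 + 1 + 1)) => z Dz i.
have := H (M0 + 1); rewrite ltrDl ltr01 => /(_ isT z Dz) zM.
have : ball (0 : Cm) (M0 + 1 + 1) z.
  by rewrite mx_norm_ball /ball_ /= sub0r normrN (le_lt_trans zM)// ltrDl.
move=> [_ /(_ 0 i)]; rewrite -(@ball_normE R[i] (R[i])^o) /= mxE sub0r normrN.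
by rewrite -cabsE -[X in _ < X](RRe_real M1real) ltcR => /ltW.
Qed.

Hypothesis F_smooth : smooth_within I F.

Lemma hartogs_open : open D.
Proof.
rewrite openE => z Dz; have [zb zF] := Dz; rewrite /interior.
pose u := sqmod (z 0 ord0); pose g := F u - fiber_sqnorm z.
have Iu : I u := hartogs_base Dz.
have g0 : 0 < g by rewrite subr_gt0.
have [d d0 Hd] := continuous_derivable_within (F_smooth (k := 0%N) Iu)
  (divr_gt0 g0 (ltr0n _ 2)).
have nb : \forall w \near (z : Cm), ((sqmod ((w : Cm) 0 ord0))%:E < b)%E.
  case: (b) zb => [r|//|//]; rewrite ?lte_fin => zr.
    have r0 : 0 < r - sqmod (z 0 ord0) by rewrite subr_gt0.
    apply: filterS (continuous_sqmod_coord z ord0 r0) => w.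
    by rewrite lte_fin ltr_distl => /andP[_]; rewrite subrKC.
  by apply/near_rowP; exists 1 => // w _; rewrite ltry.
pose e := g / 2 / p.+2%:R.
have e0 : 0 < e by rewrite !divr_gt0// ltr0n.
have nf : \forall w \near (z : Cm), forall i, `|sqmod ((w : Cm) 0 i) - sqmod (z 0 i)| < e.
  exact (@filter_forall _ _ _ (nbhs z) _ (fun i => continuous_sqmod_coord z i e0)).
have nd := continuous_sqmod_coord z ord0 d0.
apply: filterS3 nb nf nd => w wb wf wd; split => //.
have Iw : I (sqmod (w 0 ord0)) by split => //; exact: sqmod_ge0.
have := Hd _ Iw wd; rewrite ltr_distl => /andP[Fw _].
have fib : fiber_sqnorm w - fiber_sqnorm z <= g / 2.
  rewrite /fiber_sqnorm -sumrB.
  apply: (@le_trans _ _ (\sum_(j : 'I_p.+2 | j != ord0) e)).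
    by apply: ler_sum => i _; have := wf i; rewrite ltr_norml => /andP[_ /ltW].
  apply: (@le_trans _ _ (\sum_(j : 'I_p.+2) e)).
    by rewrite [leLHS]big_mkcond ler_sum// => i _; case: ifP => // _; exact: ltW.
  rewrite sumr_const card_ord.
  have -> : e *+ p.+2 = g / 2 by rewrite -[LHS]mulr_natr /e divfK// pnatr_eq0.
  by [].
move: Fw fib; rewrite /= -/u /g; lra.
Qed.

End HartogsDomain.

Section HartogsMoment.
Context {R : realType} {p : nat}.
Local Notation RR := (measurableTypeR R).
Local Notation mu := (@lebesgue_measure R).
Local Notation lambda n := (@tuple_measure _ RR R mu n).
Local Notation kappa := (@kappa R).
Local Notation Cm := 'rV[R[i]]_p.+2.
Variables (b : \bar R) (F : R -> R).
Local Notation I := (base_interval b).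
Local Notation D := (hartogs_domain b F : set Cm).
Hypothesis b_gt0 : (0 < b)%E.
Hypothesis F_gt0 : forall x, I x -> 0 < F x.
Hypothesis F_nincr : forall x y, I x -> I y -> x <= y -> F y <= F x.
Hypothesis F_smooth : smooth_within I F.

Lemma is_interval_base : is_interval I.
Proof.
move=> x y [x0 xb] [y0 yb] z /andP[xz zy]; split; first exact: le_trans xz.
by rewrite (le_lt_trans _ yb)// lee_fin.
Qed.

Lemma measurable_base : measurable I.
Proof. exact: is_interval_measurable is_interval_base. Qed.

(* With these values outside of [I], the profile stays nonincreasing, hence
   measurable. *)
Definition extended_profile (u : R) : R :=
  if u < 0 then F 0 else if (u%:E < b)%E then F u else 0.

Lemma extended_profileE u : I u -> extended_profile u = F u.
Proof. by move=> [u0 ub]; rewrite /extended_profile ltNge u0 ub. Qed.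

Lemma extended_profile_ge0 u : 0 <= extended_profile u.
Proof.
rewrite /extended_profile; case: ltP => u0; first exact/ltW/F_gt0/base_interval0.
by case: ifP => // ub; apply/ltW/F_gt0.
Qed.

Lemma extended_profile_nincr x y : x <= y -> extended_profile y <= extended_profile x.
Proof.
move=> xy; have I0 := base_interval0 b_gt0.
rewrite {2}/extended_profile; case: ltP => x0.
  rewrite /extended_profile; case: ltP => // y0; case: ifP => [yb|_].
    by apply: F_nincr.
  exact/ltW/F_gt0.
have y0 : 0 <= y := le_trans x0 xy.
rewrite /extended_profile ltNge y0 /=; case: ifP => [yb|_]; last first.
  by case: ifP => // xb; apply/ltW/F_gt0.
have xb : (x%:E < b)%E by rewrite (le_lt_trans _ yb)// lee_fin.
by rewrite xb; exact: F_nincr.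
Qed.

Lemma measurable_extended_profile :
  measurable_fun setT (extended_profile : RR -> RR).
Proof. by apply: nonincreasing_measurable => // x y; exact: extended_profile_nincr. Qed.

(** Beyond [b] the extended profile is 0, and no squared norm is negative; the condition on the base
    is thus absorbed into the condition on the fibre. *)
Lemma hartogs_domainE (z : Cm) :
  D z <-> fiber_sqnorm z < extended_profile (sqmod (z 0 ord0)).
Proof.
rewrite /hartogs_domain /extended_profile [_ < 0]ltNge sqmod_ge0 /=.
case: ifP => zb; split=> [|zF]; [by case| by [] |by case|].
by move: zF; rewrite ltNge fiber_sqnorm_ge0.
Qed.

(** The innermost [p] coordinates give a ball volume, the weighted coordinate a Beta integral, and
    the base coordinate a radial integral. The two radial reductions contribute the two extra
    factors [kappa]. *)
Theorem hartogs_moment k :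
  (\int[lambda p.+2.*2]_(t in @complex_point R p.+2 @^-1` D)
      (sqmod (complex_point t 0 (@fiber_index p)) ^+ k)%:E =
   (kappa ^+ p.+2 * k`!%:R / (k + p).+1`!%:R)%:E *
   \int[mu]_(u in I) (F u ^+ (k + p).+1)%:E)%E.
Proof.
have oD := @hartogs_open R p b F F_smooth.
have mS := measurable_preimage oD.
set S := @complex_point R p.+2 @^-1` D in mS *.
pose f0 (t : p.+2.*2.-tuple RR) : RR := sqmod (complex_point t 0 (@fiber_index p)) ^+ k.
pose f (t : p.+2.*2.-tuple RR) : \bar R := ((f0 \_ S) t)%:E.
have mf : measurable_fun setT f.
  apply/measurable_EFinP; apply/(measurable_restrictT _ mS).
  exact: measurable_coord_sqmod oD k.
have f_ge0 t : (0 <= f t)%E.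
  by rewrite lee_fin patchE; case: ifP => // _; rewrite exprn_ge0 ?sqmod_ge0.
pose G := extended_profile.
have fE x y x' y' (t : p.*2.-tuple RR) :
    f (tcons (x, tcons (y, tcons (x', tcons (y', t))))) =
    (sqnorm2 (x', y') ^+ k *
     \1_[set t | sqsum t < G (sqnorm2 (x, y)) - sqnorm2 (x', y')] t)%:E.
  rewrite /f patchE; congr EFin.
  rewrite (_ : (_ \in S) = (t \in [set t | sqsum t < G (sqnorm2 (x, y)) - sqnorm2 (x', y')])); last first.
    apply/idP/idP; rewrite !inE /S /= hartogs_domainE fiber_sqnorm_tcons.
      by rewrite complex_point_tcons0 sqsum_tcons ltrBrDl.
    by rewrite complex_point_tcons0 sqsum_tcons ltrBrDl.
  rewrite indicE; case: ifP => _; last by rewrite mulr0.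
  by rewrite mulr1 /f0 /fiber_index complex_point_tconsS complex_point_tcons0.
have inner x y x' y' : (\int[lambda p.*2]_t f (tcons (x, tcons (y, tcons (x', tcons (y', t))))) =
    (sqnorm2 (x', y') ^+ k * ball_volume p (G (sqnorm2 (x, y)) - sqnorm2 (x', y')))%:E)%E.
  under eq_integral do rewrite fE EFinM.
  rewrite ge0_integralZl_EFin//.
  - by rewrite integral_ball_volume.
  - apply/measurable_EFinP; apply: measurable_indic; exact: measurable_ball.
  - by rewrite exprn_ge0// addr_ge0 ?sqr_ge0.
pose c : R := kappa ^+ p * k`!%:R / (k + p).+1`!%:R.
have c0 : 0 <= c by rewrite divr_ge0// mulr_ge0// exprn_ge0// ltW// kappa_gt0.
have bv q r : 0 <= ball_volume q r := ball_volume_ge0 q r.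
have middle x y : (\int[lambda p.+1.*2]_t f (tcons (x, tcons (y, t))) =
    (kappa * (c * G (sqnorm2 (x, y)) ^+ (k + p).+1))%:E)%E.
  have mfx : measurable_fun setT (fun t => f (tcons (x, tcons (y, t)))).
    exact (measurableT_comp mf (measurable_tcons2r x y)).
  rewrite [LHS](integral_tuple_cons2 mfx (fun t => f_ge0 _)).
  (* The absolute value makes the radial integrand nonnegative on the whole line; it changes nothing
     at squared norms. *)
  pose g (u : RR) : \bar R := (`|u| ^+ k * ball_volume p (G (sqnorm2 (x, y)) - u))%:E.
  transitivity (plane_integral (fun z => g (sqnorm2 z))).
    apply: eq_plane_integral => -[x' y']; rewrite inner /g ger0_norm//.
    by rewrite addr_ge0 ?sqr_ge0.
  rewrite plane_integral_radial; last 2 first.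
  - apply/measurable_EFinP; apply: measurable_funM.
      by apply: measurable_funX; apply: measurableT_comp; [exact: normr_measurable|exact: measurable_id].
    apply: (measurableT_comp (@measurable_ball_volume R p)).
    by apply: measurable_funB => //; exact: measurable_cst.
  - by move=> u; rewrite lee_fin mulr_ge0 ?bv ?exprn_ge0 ?normr_ge0.
  transitivity (kappa%:E * \int[mu]_(u in `[0%R, +oo[) (u ^+ k * ball_volume p (G (sqnorm2 (x, y)) - u))%:E)%E.
    congr (_ * _)%E; apply: eq_integral => u; rewrite inE/= in_itv/= andbT => u0.
    by rewrite /g (@ger0_norm _ u u0).
  rewrite integral_weight_ball_volume -EFinM; congr (_ * _)%:E.
  case: ltP => // G0; have : G (sqnorm2 (x, y)) = 0.
    by apply/eqP; rewrite eq_le G0 extended_profile_ge0.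
  by move=> ->; rewrite expr0n mulr0.
rewrite [LHS]integral_mkcond.
transitivity (\int[lambda p.+2.*2]_t f t)%E.
  by apply: eq_integral => t _; rewrite /f !patchE; case: ifP.
rewrite [LHS](integral_tuple_cons2 mf f_ge0).
pose h (u : RR) : \bar R := (kappa * (c * G u ^+ (k + p).+1))%:E.
transitivity (plane_integral (fun z => h (sqnorm2 z))).
  by apply: eq_plane_integral => -[x y]; rewrite middle.
have G0 u : 0 <= G u := extended_profile_ge0 u.
have mG e : measurable_fun setT (fun u => (G u ^+ e)%:E).
  by apply/measurable_EFinP/measurable_funX; exact: measurable_extended_profile.
have k0 : 0 <= kappa := ltW kappa_gt0.
rewrite plane_integral_radial; last 2 first.
- rewrite /h; under eq_fun do rewrite mulrA EFinM.
  exact: (measurable_funeM _ (mG _)).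
- by move=> u; rewrite lee_fin !mulr_ge0// exprn_ge0.
rewrite /h; under eq_integral do rewrite mulrA EFinM.
rewrite ge0_integralZl_EFin//; last 3 first.
- by move=> u _; rewrite lee_fin exprn_ge0.
- apply: measurable_funTS; exact: mG.
- by rewrite mulr_ge0.
rewrite muleA -EFinM; congr (_%:E * _)%E.
  by rewrite /c !exprS; ring.
rewrite [LHS]integral_mkcond [RHS]integral_mkcond; apply: eq_integral => u _.
rewrite !patchE; have [uI|uI] := boolP (u \in I).
  move: uI; rewrite inE => uI; have [u0 _] := uI.
  by rewrite mem_setE in_itv/= u0 /G extended_profileE.
case: ifP => //; rewrite mem_setE in_itv/= andbT => u0.
(* Outside the base the profile is 0 and its exponent is positive, so there is no contribution. *)
rewrite /G /extended_profile ltNge u0 /= ifF ?expr0n//.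
by apply/negbTE; apply: contra uI => ub; rewrite inE.
Qed.

End HartogsMoment.

(** * Profiles determined by their moments *)

Section MomentComparison.
Context d {T : measurableType d} {R : realType} (mu : {measure set T -> \bar R}).

Definition bounded_profile (E : set T) (g : T -> R) : Prop :=
  [/\ measurable E, (mu E < +oo)%E, measurable_fun E g &
      forall x, E x -> 0 <= g x <= 1].

Lemma le1_integrable E (h : T -> R) : measurable E -> (mu E < +oo)%E ->
  measurable_fun E h -> (forall x, E x -> 0 <= h x <= 1) ->
  mu.-integrable E (EFin \o h).
Proof.
move=> mE fE mh h1; apply: measurable_bounded_integrable => //.
exists 1; split; first exact: num_real.
move=> r r1 x Ex; have /andP[h0 hx1] := h1 _ Ex.
by rewrite /= ger0_norm// (le_trans hx1)// ltW.
Qed.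

Lemma weight_range (x : R) s n M : 0 <= x <= 1 -> 0 <= x ^+ s * (1 - x ^+ n) ^+ M <= 1.
Proof.
move=> /andP[x0 x1].
have xe e : 0 <= x ^+ e <= 1 by rewrite exprn_ge0//= exprn_ile1.
have y : 0 <= 1 - x ^+ n <= 1 by have := xe n; lra.
have /andP[y0 y1] := y; have /andP[s0 s1] := xe s.
by rewrite mulr_ge0 ?exprn_ge0//= mulr_ile1 ?exprn_ge0 ?exprn_ile1.
Qed.

Section Profile.
Variables (E : set T) (g : T -> R).
Hypothesis Eg : bounded_profile E g.

Lemma weight_integrable s n M :
  mu.-integrable E (EFin \o (fun x => g x ^+ s * (1 - g x ^+ n) ^+ M)).
Proof.
have [mE fE mg g1] := Eg; apply: le1_integrable => //.
  apply: measurable_funM; first exact: measurable_funX.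
  by apply: measurable_funX; apply: measurable_funB => //; exact: measurable_funX.
by move=> x Ex; apply: weight_range; exact: g1.
Qed.

(** Iterated, this expresses the weighted integrals through moments of order at least [s]. *)
Lemma weight_step s n M :
  \int[mu]_(x in E) (g x ^+ s * (1 - g x ^+ n) ^+ M.+1) =
  \int[mu]_(x in E) (g x ^+ s * (1 - g x ^+ n) ^+ M) -
  \int[mu]_(x in E) (g x ^+ (s + n) * (1 - g x ^+ n) ^+ M).
Proof.
have [mE _ _ _] := Eg; rewrite -RintegralB//; try exact: weight_integrable.
by apply: eq_Rintegral => x _; rewrite exprS exprD; ring.
Qed.

Lemma step_range (x : R) n M : 0 <= x <= 1 -> 0 <= 1 - (1 - x ^+ n) ^+ M <= 1.
Proof. by move=> /(weight_range 0 n M); rewrite expr0 mul1r; lra. Qed.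

Lemma step_integrable n M :
  mu.-integrable E (EFin \o (fun x => 1 - (1 - g x ^+ n) ^+ M)).
Proof.
have [mE fE mg g1] := Eg; apply: le1_integrable => //.
  apply: measurable_funB => //; apply: measurable_funX.
  by apply: measurable_funB => //; exact: measurable_funX.
by move=> x Ex; apply: step_range; exact: g1.
Qed.

(** Starting from 0 at [M = 0], this involves moments of order at least [n] only. In particular the
    measure of [E] itself, the moment of order 0, does not enter. *)
Lemma step_recursion n M :
  \int[mu]_(x in E) (1 - (1 - g x ^+ n) ^+ M.+1) =
  \int[mu]_(x in E) (1 - (1 - g x ^+ n) ^+ M) +
  \int[mu]_(x in E) (g x ^+ n * (1 - g x ^+ n) ^+ M).
Proof.
have [mE _ _ _] := Eg; rewrite -RintegralD//;
  [|exact: step_integrable|exact: weight_integrable].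
by apply: eq_Rintegral => x _; rewrite exprS; ring.
Qed.

End Profile.

Lemma bernoulli_lower (y : R) M : 0 <= y <= 1 -> 1 - M%:R * y <= (1 - y) ^+ M.
Proof.
move=> /andP[y0 y1]; elim: M => [|M ih]; first by rewrite mul0r subr0.
rewrite exprS; have : (1 - y) * (1 - M%:R * y) <= (1 - y) * (1 - y) ^+ M.
  by rewrite ler_wpM2l// subr_ge0.
apply: le_trans; rewrite -natr1.
have : 0 <= M%:R * (y * y) by rewrite !mulr_ge0.
lra.
Qed.

Lemma bernoulli_upper (y : R) M : 0 <= y <= 1 -> (1 - y) ^+ M * (1 + M%:R * y) <= 1.
Proof.
move=> /andP[y0 y1]; elim: M => [|M ih]; first by rewrite mul0r addr0 mulr1.
apply: le_trans ih; rewrite exprSr -mulrA ler_wpM2l ?exprn_ge0 ?subr_ge0//.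
rewrite -natr1.
have : 0 <= M%:R * (y * y) by rewrite !mulr_ge0.
have : 0 <= y * y by rewrite mulr_ge0.
lra.
Qed.

(** With [r] between [s] and [t] and [M] about [r ^- n], the product [M * s ^+ n] tends to 0 and
    [M * t ^+ n] to infinity; Bernoulli's inequalities turn this into the two estimates. *)
Lemma steep_exponents (s t e : R) n0 : 0 <= s -> s < t -> t <= 1 -> 0 < e ->
  exists n M, [/\ (n0 <= n)%N, 1 - (1 - s ^+ n) ^+ M <= e & (1 - t ^+ n) ^+ M <= e].
Proof.
move=> s0 st t1 e0.
pose r := (s + t) / 2.
have r0 : 0 < r by rewrite /r; lra.
have t0 : 0 < t by lra.
have rt : r < t by rewrite /r; lra.
have sr : s < r by rewrite /r; lra.
pose q := Num.max (s / r) (r / t).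
have sr0 : 0 <= s / r by rewrite divr_ge0// ltW.
have rt0 : 0 <= r / t by rewrite divr_ge0// ltW.
have srq : s / r <= q by rewrite le_max lexx.
have rtq : r / t <= q by rewrite le_max lexx orbT.
have q0 : 0 <= q := le_trans sr0 srq.
have q1 : q < 1.
  by rewrite /q gt_max; apply/andP; split; rewrite ltr_pdivrMr// mul1r.
have /cvgrPdist_lt/(_ (e / 2)) : (GRing.exp q : R ^nat) @ \oo --> 0.
  by apply: cvg_expr; rewrite ger0_norm.
rewrite divr_gt0//= => /(_ isT)[N _ HN].
pose n := maxn n0 N.
have qn : q ^+ n < e / 2.
  by have := HN n (leq_maxr _ _); rewrite /= sub0r normrN ger0_norm// exprn_ge0.
pose M := (Num.truncn (r ^- n)).+1.
have rn0 : 0 < r ^- n by rewrite invr_gt0 exprn_gt0.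
have /andP[Ml Mu] : (Num.truncn (r ^- n))%:R <= r ^- n < M%:R.
  by rewrite truncn_itv// ltW.
have pw (x : R) : 0 <= x <= 1 -> 0 <= x ^+ n <= 1.
  by move=> /andP[x0 x1]; rewrite exprn_ge0//= exprn_ile1.
have sn : 0 <= s ^+ n <= 1 by apply: pw; lra.
have tn : 0 <= t ^+ n <= 1 by apply: pw; lra.
have r1 : r ^+ n <= 1 by have /andP[] : 0 <= r ^+ n <= 1 by apply: pw; lra.
exists n, M; split; first exact: leq_maxl.
  have h := bernoulli_lower M sn.
  have hs : s ^+ n * r ^- n <= q ^+ n.
    by rewrite -exprVn -exprMn lerXn2r ?nnegrE.
  have hs' : s ^+ n <= s ^+ n * r ^- n.
    by rewrite ler_peMr//; [case/andP: sn|rewrite -invr1 lef_pV2 ?posrE// exprn_gt0].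
  have : M%:R * s ^+ n <= (r ^- n + 1) * s ^+ n.
    by rewrite ler_wpM2r//; [case/andP: sn|rewrite -natr1 lerD2r].
  lra.
have h := bernoulli_upper M tn.
have ht : t ^- n * r ^+ n <= q ^+ n.
  by rewrite mulrC -exprVn -exprMn lerXn2r ?nnegrE.
have tr : r ^- n * t ^+ n <= 1 + M%:R * t ^+ n.
  have : r ^- n * t ^+ n <= M%:R * t ^+ n by rewrite ler_wpM2r//; [case/andP: tn|exact: ltW].
  lra.
have w0 : 0 <= (1 - t ^+ n) ^+ M by rewrite exprn_ge0// subr_ge0; case/andP: tn.
have t0n : 0 < t ^+ n by rewrite exprn_gt0.
have r0n : 0 < r ^+ n by rewrite exprn_gt0.
have : (1 - t ^+ n) ^+ M * (r ^- n * t ^+ n) <= 1.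
  by apply: le_trans h; rewrite ler_wpM2l.
rewrite -ler_pdivlMr ?mulr_gt0// mul1r invfM invrK => w1.
have : (1 - t ^+ n) ^+ M <= t ^- n * r ^+ n by rewrite mulrC.
lra.
Qed.

(* Polynomials [1 - (1 - x ^+ n) ^+ M] approximate the indicator function of
   [s < x], and their integrals are determined by high moments. *)
Theorem moment_superlevel E E1 g E' E1' g' (n0 : nat) (s t : R) :
  bounded_profile E g -> bounded_profile E' g' ->
  (forall n, (n0 <= n)%N ->
     \int[mu]_(x in E) g x ^+ n = \int[mu]_(x in E') g' x ^+ n) ->
  measurable E1 -> E1 `<=` E -> measurable E1' -> E1' `<=` E' ->
  0 <= s -> s < t -> t <= 1 ->
  (forall x, E x -> ~ E1 x -> g x <= s) -> (forall x, E1' x -> t <= g' x) ->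
  (mu E1' <= mu E1)%E.
Proof.
move=> Eg Eg' mom mE1 E1E mE1' E1E' s0 st t1 gs gt.
(* The exponents only grow in the recursion, so moments below [n0] are never called for. *)
have weq n M k : (n0 <= k)%N ->
    \int[mu]_(x in E) (g x ^+ k * (1 - g x ^+ n) ^+ M) =
    \int[mu]_(x in E') (g' x ^+ k * (1 - g' x ^+ n) ^+ M).
  elim: M k => [|M ih] k k0.
    under eq_Rintegral do rewrite expr0 mulr1.
    by rewrite mom//; apply: eq_Rintegral => x _; rewrite expr0 mulr1.
  by rewrite !weight_step// !ih// (leq_trans k0)// leq_addr.
have peq n M : (n0 <= n)%N ->
    \int[mu]_(x in E) (1 - (1 - g x ^+ n) ^+ M) =
    \int[mu]_(x in E') (1 - (1 - g' x ^+ n) ^+ M).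
  move=> nn0; elim: M => [|M ih].
    have z (h : T -> R) A : \int[mu]_(x in A) (1 - (1 - h x ^+ n) ^+ 0) = 0.
      rewrite /Rintegral (_ : 0 = fine (0 : \bar R))//; congr fine; apply: integral0_eq => x _.
      by rewrite expr0 subrr.
    by rewrite !z.
  by rewrite !step_recursion// ih weq.
have [mE fE mg g1] := Eg; have [mE' fE' mg' g1'] := Eg'.
have finE A B : measurable A -> measurable B -> A `<=` B -> (mu B < +oo)%E -> mu A \is a fin_num.
  move=> mA mB AB fB; rewrite ge0_fin_numE//; apply: le_lt_trans fB.
  by apply: le_measure => //; rewrite inE.
have f1 := finE _ _ mE1 mE E1E fE; have f1' := finE _ _ mE1' mE' E1E' fE'.
have fEE := finE _ _ mE mE (@subset_refl _ _) fE.
have iI A B : measurable A -> measurable B -> (mu B < +oo)%E -> mu.-integrable B (EFin \o \1_A).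
  move=> mA mB fB; apply: le1_integrable => //.
  by move=> x _; rewrite indicE; case: (_ \in _); rewrite ?lexx ?ler01.
have intI A B : measurable A -> measurable B -> A `<=` B ->
    \int[mu]_(x in B) (\1_A x) = fine (mu A).
  by move=> mA mB AB; rewrite /Rintegral integral_indic// setIidl.
(* The steep polynomial is at least [1 - e] on [E1'] and at most [e] on [E] outside [E1]; its two
   integrals are equal. *)
have key e : 0 < e -> (1 - e) * fine (mu E1') <= fine (mu E1) + e * fine (mu E).
  move=> e0; have [n [M [nn0 hs ht]]] := steep_exponents n0 s0 st t1 e0.
  have up : \int[mu]_(x in E) (1 - (1 - g x ^+ n) ^+ M) <= fine (mu E1) + e * fine (mu E).
    have ie : mu.-integrable E (EFin \o cst e).
      apply: measurable_bounded_integrable => //.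
      by exists e; split; [exact: num_real|move=> r /ltW er x _; rewrite /= gtr0_norm].
    rewrite -(intI _ _ mE1 mE E1E) -Rintegral_cst// -RintegralD//; last exact: iI.
    apply: le_Rintegral => //; first exact: step_integrable.
      have := integrableD mE (iI _ _ mE1 mE fE) ie.
      by apply: eq_integrable => // x _.
    move=> x Ex; have gx := g1 _ Ex; rewrite indicE /=.
    have [xE1|xE1] /= := boolP (x \in E1).
      by have /andP[_ ?] := step_range n M gx; lra.
    have gxs : g x <= s by apply: gs => // h; move: xE1; rewrite (mem_set h).
    have /andP[gx0 _] := gx.
    have : (1 - s ^+ n) ^+ M <= (1 - g x ^+ n) ^+ M.
      have s1 : s ^+ n <= 1 by rewrite exprn_ile1//; lra.
      have gn : g x ^+ n <= s ^+ n by rewrite lerXn2r ?nnegrE.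
      by rewrite lerXn2r ?nnegrE; lra.
    lra.
  have low : (1 - e) * fine (mu E1') <= \int[mu]_(x in E') (1 - (1 - g' x ^+ n) ^+ M).
    rewrite -(intI _ _ mE1' mE' E1E') -RintegralZl//; last exact: iI.
    apply: le_Rintegral => //; last 2 first.
    - exact: step_integrable.
    - move=> x Ex; have gx := g1' _ Ex; rewrite indicE.
      have /andP[? ?] := step_range n M gx.
      have [xE1|xE1] /= := boolP (x \in E1'); last by rewrite mulr0.
      have gxt : t <= g' x by apply: gt; move: xE1; rewrite inE.
      have /andP[gx0 gx1] := gx; rewrite mulr1.
      have : (1 - g' x ^+ n) ^+ M <= (1 - t ^+ n) ^+ M.
        have s1 : g' x ^+ n <= 1 by rewrite exprn_ile1.
        have gn : t ^+ n <= g' x ^+ n by rewrite lerXn2r ?nnegrE//; lra.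
        by rewrite lerXn2r ?nnegrE; lra.
      lra.
    have := integrableZl mE' (1 - e) (iI _ _ mE1' mE' fE').
    by apply: eq_integrable => // x _.
  by move: up; rewrite (peq n M nn0); exact: le_trans low.
rewrite -(fineK f1) -(fineK f1') lee_fin leNgt; apply/negP => lt.
pose a := fine (mu E1'); pose c := fine (mu E1); pose w := fine (mu E).
have a0 : 0 <= a := fine_ge0 (measure_ge0 _ _).
have w0 : 0 <= w := fine_ge0 (measure_ge0 _ _).
have d0 : 0 < a - c by rewrite subr_gt0.
have k0 : 0 < a + w + 1 by lra.
(* With this value [e * (a + w)] is less than [(a - c) / 2], whereas [key] requires
   [a - c <= e * (a + w)]. *)
have := key ((a - c) / 2 / (a + w + 1)).
rewrite !divr_gt0// => /(_ isT); rewrite -/a -/c -/w.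
set e := _ / (a + w + 1).
have : e * (a + w + 1) = (a - c) / 2 by rewrite /e divfK// gt_eqF.
have : 0 < e by rewrite !divr_gt0.
lra.
Qed.

End MomentComparison.

Section LinearMoments.
Context {R : realType}.
Local Notation mu := (@lebesgue_measure R).

(* Since [r n.+1 - r n = (2 - q) * r n.+1 / (n + 2)], the divergence of the
   harmonic series forces [q = 2]. *)
Lemma harmonic_ratio (r : nat -> R) (c C q : R) n0 : 0 < c ->
  (forall n, (n0 <= n)%N -> c <= r n <= C) ->
  (forall n, (n0 <= n)%N -> r n.+1 * (n%:R + q) = n.+2%:R * r n) -> q = 2.
Proof.
move=> c0 rb rS; apply/eqP; rewrite eq_sym -subr_eq0; apply/negP => /negP e0.
set e := 2 - q in e0.
have e2 : 0 < e * e by rewrite -expr2 exprn_even_gt0.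
have C0 : c <= C by have /andP[h1 h2] := rb _ (leqnn _); exact: le_trans h1 h2.
pose S : nat -> R := series harmonic.
(* Multiplying the increments by [e] makes them positive whatever the sign of [2 - q]. The offset
   [n0.+1] aligns the harmonic terms with the denominators [n + 2]. *)
have grow k : e * e * c * (S (n0.+1 + k)%N - S n0.+1) <= e * (r (n0 + k)%N - r n0).
  elim: k => [|k ih]; first by rewrite !addn0 !subrr !mulr0.
  rewrite !addnS /S seriesSr /= -/S.
  pose h : R := (n0.+1 + k).+1%:R^-1.
  have /andP[rc _] := rb (n0 + k).+1 (leqW (leq_addr _ _)).
  have step : r (n0 + k).+1 - r (n0 + k)%N = e * r (n0 + k).+1 * h.
    have n2 : (n0 + k).+2%:R != 0 :> R by rewrite pnatr_eq0.
    apply: (mulfI n2); rewrite mulrBr -rS ?leq_addr// /h addSn.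
    rewrite [RHS]mulrC divfK// /e -(natr1 (n0 + k).+1) -(natr1 (n0 + k)).
    ring.
  have h0 : 0 < h by rewrite invr_gt0 ltr0n.
  have : e * e * c * h <= e * (e * r (n0 + k).+1 * h).
    rewrite !mulrA ler_wpM2r ?(ltW h0)// ler_wpM2l// ltW//.
  rewrite -step; move: ih; rewrite -/h /harmonic /= -/h.
  lra.
apply: (@dvg_harmonic R); apply: nondecreasing_is_cvgn.
  by apply: nondecreasing_series => n _ _; exact: harmonic_ge0.
exists (S n0.+1 + `|e| * (2 * C) / (e * e * c)) => _ [n _ <-].
have Sn : nondecreasing_seq S.
  by apply: nondecreasing_series => i _ _; exact: harmonic_ge0.
apply: (@le_trans _ _ (S (n0.+1 + n)%N)); first exact/Sn/leq_addl.
have ec : 0 < e * e * c by rewrite mulr_gt0.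
rewrite -lerBlDl ler_pdivlMr// mulrC (le_trans (grow n))//.
rewrite (le_trans (ler_norm _))// normrM ler_wpM2l// ler_norml.
have := rb n0 (leqnn _); have := rb (n0 + n)%N (leq_addr _ _); lra.
Qed.

Lemma linear_moment (A : R) s : 0 < A ->
  \int[mu]_(x in `[0, A]) (1 - x / A) ^+ s = A / s.+1%:R.
Proof.
move=> A0; have := beta_integral 0 s A0; rewrite add0n fact0 mul1r => H.
have cI : continuous_itv 0 A (fun y : R => y ^+ 0 * (A - y) ^+ s).
  by move=> x _; exact: continuous_poly_like.
transitivity (itg 0 A (fun y => A ^- s * (y ^+ 0 * (A - y) ^+ s))).
  apply: eq_Rintegral => x _; rewrite expr0 mul1r -exprVn -exprMn.
  by congr (_ ^+ _); rewrite mulrBr mulVf ?gt_eqF// mulrC.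
rewrite itgZ// H factS natrM exprS.
have f0 : s`!%:R != 0 :> R by rewrite pnatr_eq0 -lt0n fact_gt0.
have n0 : s.+1%:R != 0 :> R by rewrite pnatr_eq0.
have As : A ^+ s != 0 by rewrite expf_neq0// gt_eqF.
move: f0 n0 As; move: (s`!%:R : R) (s.+1%:R : R) (A ^+ s) => x y z x0 y0 z0.
by field; rewrite x0 y0 z0.
Qed.

Lemma linear_profile (A : R) : 0 < A ->
  bounded_profile mu `[0, A]%classic (fun x => 1 - x / A).
Proof.
move=> A0; split.
- exact: measurable_itv.
- by rewrite /= lebesgue_measure_itv/= lte_fin A0 ltry.
- apply: measurable_funB => //; exact: measurable_funM.
- move=> x /=; rewrite in_itv/= => /andP[x0 xA].
  have : x / A <= 1 by rewrite ler_pdivrMr// mul1r.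
  have : 0 <= x / A by rewrite divr_ge0// ltW.
  lra.
Qed.

Lemma le_Rintegral_subset (A B : set R) (g h : R -> R) :
  measurable A -> measurable B -> A `<=` B ->
  mu.-integrable A (EFin \o g) -> mu.-integrable B (EFin \o h) ->
  (forall x, B x -> 0 <= h x) -> (forall x, A x -> g x <= h x) ->
  \int[mu]_(x in A) g x <= \int[mu]_(x in B) h x.
Proof.
move=> mA mB AB ig ih h0 gh.
have ihA : mu.-integrable A (EFin \o h) by exact: integrableS ih.
apply: le_trans (_ : \int[mu]_(x in A) h x <= _); first exact: le_Rintegral.
rewrite fine_le ?integrable_fin_num//.
by apply: ge0_subset_integral => //; case/integrableP: ih.
Qed.

End LinearMoments.

(** * Behaviour of the profile near the origin *)

Section HartogsProfile.
Context {R : realType}.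
Variables (b : \bar R) (F : R -> R).
Local Notation I := (base_interval b).
Hypothesis b_gt0 : (0 < b)%E.
Hypothesis F_gt0 : forall x, I x -> 0 < F x.
Hypothesis F_nincr : forall x y, I x -> I y -> x <= y -> F y <= F x.
Hypothesis F_smooth : smooth_within I F.
Hypothesis F_spc : strong_pseudoconvexity_condition b F.

Lemma base_interval_near0 : exists2 d, 0 < d & forall y, 0 <= y -> y < d -> I y.
Proof.
case: (b) b_gt0 => [r| |]//; rewrite ?lte_fin => r0.
  by exists r => // y y0 yr; split => //; rewrite lte_fin.
by exists 1 => // y y0 _; split => //; rewrite ltry.
Qed.

Local Notation F' := (derive_within I F).

Lemma slope_near0 :
  (fun y => F' y / F y) @ within I 0^' --> F' 0 / F 0.
Proof.
have I0 := base_interval0 b_gt0.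
have cont (f : R -> R) : derivable_within I f 0 -> f @ within I 0^' --> f 0.
  move=> df; apply/cvgrPdist_lt => e e0.
  have [d d0 H] := continuous_derivable_within df e0.
  rewrite near_withinE; exists d => //= y /=; rewrite sub0r normrN => yd _ Iy.
  by rewrite distrC H// subr0.
apply: cvgM; first exact: cont (@F_smooth 1%N 0 I0).
by apply: cvgV; [rewrite gt_eqF ?F_gt0|exact: cont (@F_smooth 0%N 0 I0)].
Qed.

(** At 0 the difference quotient of [t * F' t / F t] is exactly [F' / F], so the pseudoconvexity
    condition there says that [F' 0 / F 0] is negative. *)
Lemma derive_profile0_lt0 : F' 0 < 0.
Proof.
have I0 := base_interval0 b_gt0.
(* The origin is a limit point of the base, so the limit defining the one-sided derivative is
   unique. *)
have pf : ProperFilter (within I (0 : R)^').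
  apply: Build_ProperFilter_ex => P -[d /= d0 H].
  have [d1 d10 Id] := base_interval_near0.
  pose y := Num.min d d1 / 2.
  have m0 : 0 < Num.min d d1 by rewrite lt_min d0.
  have y0 : 0 < y by rewrite divr_gt0.
  have ym : y < Num.min d d1 by rewrite /y; lra.
  exists y; apply: H => /=.
  - by rewrite sub0r normrN gtr0_norm// (lt_le_trans ym)// ge_min lexx.
  - by rewrite gt_eqF.
  - by apply: Id; rewrite ?(ltW y0)// (lt_le_trans ym)// ge_min lexx orbT.
have := F_spc I0; rewrite /derive_within.
rewrite (_ : lim _ = F' 0 / F 0); first by rewrite pmulr_llt0// invr_gt0 F_gt0.
apply: cvg_lim => //; apply: cvg_trans slope_near0; apply: near_eq_cvg.
rewrite near_withinE; exists 1 => //= y _ y0 _.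
by rewrite /difference_quotient mul0r mul0r !subr0 -(mulrA y) (mulrC y) mulfK.
Qed.

(** With [k = - F' 0 / F 0], near 0 the ratio [F x / F 0] lies between the lines of slopes
    [- 3 k / 2] and [- k / 2]. The upper bound extends to the whole bounded base by monotonicity, at
    the price of a flatter line. *)
Lemma profile_bounds : (exists B : R, forall x, I x -> x <= B) ->
  exists a c : R, [/\ 0 < a, 0 < c, `[0, c] `<=` I,
    (forall x, I x -> F x / F 0 <= 1 - x / a) &
    (forall x, 0 <= x <= c -> 1 - x / c <= F x / F 0)].
Proof.
move=> [B0 HB0]; have I0 := base_interval0 b_gt0.
pose B := Num.max B0 1.
have B_gt0 : 0 < B by rewrite lt_max ltr01 orbT.
have HB x : I x -> x <= B by move=> /HB0 h; rewrite le_max h.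
pose k := - F' 0 / F 0.
have F00 : 0 < F 0 := F_gt0 I0.
have k0 : 0 < k by rewrite divr_gt0// oppr_gt0 derive_profile0_lt0.
have : difference_quotient F 0 @ within I (0 : R)^' --> F' 0 := @F_smooth 0%N 0 I0.
have e0 : 0 < F 0 * k / 2 by apply: divr_gt0 => //; exact: mulr_gt0.
move=> /cvgrPdist_lt/(_ _ e0); rewrite near_withinE => -[d /= d_gt0 Hd].
have [d1 d10 Id] := base_interval_near0.
pose c0 := Num.min d d1 / 2.
have m0 : 0 < Num.min d d1 by rewrite lt_min d_gt0.
have c00 : 0 < c0 by rewrite divr_gt0.
have cm : c0 < Num.min d d1 by rewrite /c0; lra.
have [cd cd1] : c0 < d /\ c0 < d1 by move: cm; rewrite lt_min => /andP.
have Ic x : 0 <= x -> x <= c0 -> I x by move=> x0 xc; apply: Id => //; exact: le_lt_trans cd1.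
have near0 x : 0 <= x -> x <= c0 -> 1 - 3 * k / 2 * x <= F x / F 0 <= 1 - k / 2 * x.
  move=> x0 xc; have [->|xn] := eqVneq x 0.
    by rewrite !mulr0 subr0 divff ?lexx// gt_eqF.
  have xp : 0 < x by rewrite lt_neqAle eq_sym xn.
  have := Hd x; rewrite /= sub0r normrN gtr0_norm//.
  move=> /(_ (le_lt_trans xc cd) xn (Ic _ x0 xc)).
  have Fk : F' 0 = - (k * F 0) by rewrite /k divfK ?gt_eqF// opprK.
  rewrite ltr_distl /difference_quotient subr0 Fk => /andP[].
  have xF : 0 < x * F 0 by rewrite mulr_gt0.
  set w := (F x - F 0) / x.
  have Fx : F x / F 0 = 1 + w * x / F 0 by rewrite /w divfK// mulrBl divff ?gt_eqF//; ring.
  have W : w = w / F 0 * F 0 by rewrite divfK// gt_eqF.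
  have -> : F x / F 0 = 1 + w / F 0 * x by rewrite Fx; ring.
  rewrite W; set v := w / F 0; rewrite mulfK ?gt_eqF//.
  have E1 : - (k * F 0) - F 0 * k / 2 = (- (3 * k / 2)) * F 0 by field.
  have E2 : v * F 0 - F 0 * k / 2 = (v - k / 2) * F 0 by ring.
  move=> h1 h2.
  have v1 : v < - (k / 2).
    by rewrite -(ltr_pM2r F00); move: h1 h2; lra.
  have v2 : - (3 * k / 2) < v.
    by rewrite -(ltr_pM2r F00); move: h1 h2; lra.
  have : v * x <= - (k / 2) * x by rewrite ler_wpM2r// ltW.
  have : - (3 * k / 2) * x <= v * x by rewrite ler_wpM2r// ltW.
  by move=> ? ?; apply/andP; split; lra.
have kd : 0 < k / 2 by rewrite divr_gt0.
(* [2 / k] serves on [[0, c0]]; the other value makes the line at [B] still above the bound reached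
   at [c0]. *)
pose a := Num.max (2 / k) (B / (k / 2 * c0)).
have a0 : 0 < a by rewrite lt_max divr_gt0.
(* [c <= 2 / (3 * k)] puts [1 - x / c] below the lower line, and [c <= c0] keeps to its range of
   validity. *)
pose c := Num.min c0 (2 / (3 * k)).
have c_gt0 : 0 < c by rewrite lt_min c00 divr_gt0// mulr_gt0.
have k3 : 0 < 3 * k / 2 by rewrite divr_gt0// mulr_gt0.
exists a, c; split => //.
- move=> x /=; rewrite in_itv/= => /andP[x0 xc]; apply: Ic => //.
  by rewrite (le_trans xc)// ge_min lexx.
- move=> x Ix; have [x0 _] := Ix.
  have aV : a^-1 <= k / 2.
    have h : k / 2 * (2 / k) <= k / 2 * a by rewrite ler_pM2l// le_max lexx.
    rewrite -[leLHS]mul1r ler_pdivrMr//; apply: le_trans h.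
    by rewrite mulrA divfK// divff ?gt_eqF.
  have aB : B / a <= k / 2 * c0.
    rewrite ler_pdivrMr// -ler_pdivrMl; last by rewrite mulr_gt0// divr_gt0.
    by rewrite mulrC le_max lexx orbT.
  have [xc|xc] : x <= c0 \/ c0 <= x by case: (leP x c0) => [|/ltW]; [left|right].
    have /andP[_ h] := near0 _ x0 xc; apply: le_trans h _.
    by rewrite lerD2l lerN2 mulrC ler_wpM2r.
  have /andP[_ h] := near0 _ (ltW c00) (lexx _).
  apply: (@le_trans _ _ (F c0 / F 0)).
    by rewrite ler_pM2r ?invr_gt0// F_nincr//; exact: Ic (ltW c00) (lexx _).
  apply: le_trans h _; rewrite lerD2l lerN2; apply: le_trans aB.
  by rewrite ler_pM2r ?invr_gt0// HB.
- move=> x /andP[x0 xc].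
  have xc0 : x <= c0 by rewrite (le_trans xc)// ge_min lexx.
  have /andP[h _] := near0 _ x0 xc0; apply: le_trans h.
  rewrite lerD2l lerN2 [leRHS]mulrC ler_wpM2r//.
  have h : 3 * k / 2 * c <= 3 * k / 2 * (2 / (3 * k)).
    by rewrite ler_pM2l ?k3// ge_min lexx orbT.
  rewrite -[leRHS]mul1r ler_pdivlMr//; apply: le_trans h _.
  have k3' : 3 * k != 0 by rewrite gt_eqF// mulr_gt0.
  by rewrite mulrA divfK// mulfV.
Qed.

End HartogsProfile.

Section LinearProfile.
Context {R : realType}.
Local Notation mu := (@lebesgue_measure R).
Variables (b : \bar R) (F : R -> R).
Local Notation I := (base_interval b).
Hypothesis b_gt0 : (0 < b)%E.
Hypothesis F_gt0 : forall x, I x -> 0 < F x.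
Hypothesis F_nincr : forall x y, I x -> I y -> x <= y -> F y <= F x.
Hypothesis F_smooth : smooth_within I F.
Hypothesis F_spc : strong_pseudoconvexity_condition b F.
Hypothesis I_bounded : exists B : R, forall x, I x -> x <= B.

Let I0 : I 0 := base_interval0 b_gt0.
Let F00 : 0 < F 0 := F_gt0 I0.

Lemma base_finite_measure : (mu I < +oo)%E.
Proof.
have [B HB] := I_bounded.
apply: (@le_lt_trans _ _ (mu `[0, B]%classic)); last first.
  by rewrite /= lebesgue_measure_itv/= lte_fin; case: ifP => _; rewrite ltry.
apply: le_measure; rewrite ?inE//; first exact: measurable_base.
by move=> x Ix; have [x0 _] := Ix; rewrite /= in_itv/= x0 HB.
Qed.

Lemma measurable_profile : measurable_fun I F.
Proof.
apply: (eq_measurable_fun (extended_profile b F)).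
  by move=> x; rewrite inE => Ix; rewrite extended_profileE.
by apply: measurable_funTS; exact: measurable_extended_profile.
Qed.

Lemma profile_integrable s : mu.-integrable I (EFin \o (fun x => F x ^+ s)).
Proof.
apply: measurable_bounded_integrable.
- exact: measurable_base.
- exact: base_finite_measure.
- by apply: measurable_funX; exact: measurable_profile.
- exists (F 0 ^+ s); split; first exact: num_real.
  move=> r /ltW Fr x Ix; have [x0 _] := Ix.
  rewrite /= ger0_norm ?exprn_ge0 ?(ltW (F_gt0 Ix))// (le_trans _ Fr)//.
  by rewrite lerXn2r ?nnegrE ?(ltW (F_gt0 _))// F_nincr.
Qed.

Lemma hartogs_bounded_profile : bounded_profile mu I (fun x => F x / F 0).
Proof.
split; [exact: measurable_base|exact: base_finite_measure| |].
  by apply: measurable_funM => //; exact: measurable_profile.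
move=> x Ix; have [x0 _] := Ix; have Fx := F_gt0 Ix.
by rewrite divr_ge0 ?(ltW Fx) ?(ltW F00)//= ler_pdivrMr// mul1r F_nincr.
Qed.

Lemma normalized_moment s :
  \int[mu]_(x in I) (F x / F 0) ^+ s = \int[mu]_(x in I) F x ^+ s / F 0 ^+ s.
Proof.
rewrite -RintegralZr; [|exact: measurable_base|exact: profile_integrable].
by apply: eq_Rintegral => x _; rewrite expr_div_n.
Qed.

Variables (q : R) (n0 : nat).
Hypothesis moments : forall s, (n0 <= s)%N ->
  \int[mu]_(x in I) F x ^+ s.+1 * (s%:R + q) =
  s.+1%:R * F 0 * \int[mu]_(x in I) F x ^+ s.

Let n s : R := \int[mu]_(x in I) (F x / F 0) ^+ s.
(** For the linear function [1 - x / A] on [[0, A]] this is the constant [A]. *)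
Let r s : R := s.+1%:R * n s.

Lemma normalized_moment_rec s : (n0 <= s)%N -> r s.+1 * (s%:R + q) = s.+2%:R * r s.
Proof.
move=> n0s; rewrite /r /n !normalized_moment; have := moments n0s.
have Fs : F 0 ^+ s != 0 by rewrite expf_neq0// gt_eqF.
have F0 : F 0 != 0 by rewrite gt_eqF.
set a := \int[mu]_(x in I) F x ^+ s.+1; set c := \int[mu]_(x in I) F x ^+ s.
move=> h; rewrite exprS.
transitivity (s.+2%:R * (a * (s%:R + q)) / (F 0 * F 0 ^+ s)); first by ring.
by rewrite h; move: Fs; move: (F 0 ^+ s) => w w0; field; rewrite w0 F0.
Qed.

Lemma linear_integrable (A : R) s : 0 < A ->
  mu.-integrable `[0, A]%classic (EFin \o (fun x => (1 - x / A) ^+ s)).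
Proof.
move=> A0; have := weight_integrable (linear_profile A0) s 0 0.
by apply: eq_integrable => // x _; rewrite /= expr0 mulr1.
Qed.

(** Integrates the two linear bounds of [profile_bounds], whose moments of order [s] are
    [c / (s + 1)] and [a / (s + 1)]. *)
Lemma normalized_moment_bounds : exists c C : R, 0 < c /\ forall s, c <= r s <= C.
Proof.
have [a [c [a0 c0 cI up low]]] := profile_bounds b_gt0 F_gt0 F_nincr F_smooth F_spc I_bounded.
exists c, a; split => // s.
have mI : measurable I := measurable_base b.
have ni : mu.-integrable I (EFin \o (fun x => (F x / F 0) ^+ s)).
  have := weight_integrable hartogs_bounded_profile s 0 0.
  by apply: eq_integrable => // x _; rewrite /= expr0 mulr1.
have g0 x : I x -> 0 <= F x / F 0.
  by move=> Ix; rewrite divr_ge0 ?(ltW (F_gt0 Ix)) ?(ltW F00).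
have pe (x : R) : 0 < x -> x / s.+1%:R * s.+1%:R = x.
  by move=> _; rewrite divfK// pnatr_eq0.
have lo : c / s.+1%:R <= n s.
  rewrite -linear_moment//; apply: le_Rintegral_subset => //.
  - exact: linear_integrable.
  - by move=> x Ix; rewrite exprn_ge0// g0.
  - move=> x /=; rewrite in_itv/= => /andP[x0 xc].
    have xc1 : x / c <= 1 by rewrite ler_pdivrMr// mul1r.
    have h := low x; rewrite x0 xc in h; have := h isT.
    by move=> ?; rewrite lerXn2r ?nnegrE//; lra.
have hi : n s <= a / s.+1%:R.
  rewrite -linear_moment//; apply: le_Rintegral_subset => //.
  - move=> x Ix; rewrite /= in_itv/=; have [-> _ /=] := Ix.
    have : 0 < 1 - x / a by apply: lt_le_trans (up _ Ix); rewrite divr_gt0// F_gt0.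
    by rewrite subr_gt0 ltr_pdivrMr// mul1r => /ltW.
  - exact: linear_integrable.
  - move=> x /=; rewrite in_itv/= => /andP[x0 xc].
    have xc1 : x / a <= 1 by rewrite ler_pdivrMr// mul1r.
    by rewrite exprn_ge0//; lra.
  - move=> x Ix; have ? := up _ Ix; have ? := g0 _ Ix.
    by rewrite lerXn2r ?nnegrE//; lra.
by rewrite /r mulrC -ler_pdivrMr ?ltr0n// lo -ler_pdivlMr ?ltr0n.
Qed.

(** Once [q = 2] the recursion says that [r] is constant from [n0] on; its value [A] is the only
    candidate. Superlevel sets of [f] and of [1 - x / A] are then compared in both directions. *)
Theorem profile_linear : exists2 A : R, 0 < A &
  forall x, I x -> F x = F 0 * (1 - x / A).
Proof.
have [c [C [c0 rb]]] := normalized_moment_bounds.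
have q2 : q = 2 := harmonic_ratio c0 (fun s _ => rb s) normalized_moment_rec.
pose A := r n0.
have A0 : 0 < A by apply: lt_le_trans c0 _; have /andP[] := rb n0.
have rA s : (n0 <= s)%N -> r s = A.
  move=> /subnK <-; elim: (s - n0)%N => [|k ih]//; rewrite addSn -ih.
  have := normalized_moment_rec (leq_addl k n0); rewrite q2.
  have -> : (k + n0)%:R + 2 = (k + n0).+2%:R :> R by rewrite -natrD addn2.
  by rewrite mulrC; apply: mulfI; rewrite pnatr_eq0.
have nA s : (n0 <= s)%N -> n s = \int[mu]_(x in `[0, A]) (1 - x / A) ^+ s.
  move=> /rA <-; rewrite linear_moment /r; last first.
    by have /andP[h _] := rb s; exact: lt_le_trans h.
  by rewrite (mulrC s.+1%:R) mulfK// pnatr_eq0.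
exists A => // x Ix; have [x0 _] := Ix.
pose f t := F t / F 0.
have fx0 : 0 < f x by rewrite divr_gt0// F_gt0.
have fmono t u : I t -> I u -> t <= u -> f u <= f t.
  by move=> It Iu tu; rewrite ler_pM2r ?invr_gt0// F_nincr.
have fx1 : f x <= 1 by rewrite ler_pdivrMr// mul1r F_nincr.
have lenE (y : R) : 0 <= y -> mu `[0, y]%classic = y%:E.
  move=> y0; rewrite /= lebesgue_measure_itv/= lte_fin; case: ltP => [_|y0'].
    by rewrite oppr0 adde0.
  by congr EFin; apply/eqP; rewrite eq_le y0 y0'.
suff fxA : f x = 1 - x / A by rewrite -fxA /f mulrC divfK// gt_eqF.
have sub (y : R) : y <= x -> `[0, y]%classic `<=` I.
  move=> yx t /=; rewrite in_itv/= => /andP[t0 ty].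
  by apply: (base_interval_le Ix t0); exact: le_trans yx.
(* The abscissa at which the linear function takes the value [f x]. *)
pose w := A * (1 - f x).
have hw y : 1 - y / A = f x + (w - y) / A.
  by rewrite /w; field; rewrite gt_eqF.
have w0 : 0 <= w by rewrite mulr_ge0 ?(ltW A0)// subr_ge0.
have wA : w <= A by rewrite ler_piMr ?(ltW A0)//; lra.
suff : x = w by move=> xw; rewrite hw xw subrr mul0r addr0.
apply/eqP; rewrite eq_le; apply/andP; split; rewrite leNgt; apply/negP => lt.
(* If [w < x]: [f] is at least [f x] on [[0, x]], while beyond [y < x] the linear function is below
   a smaller threshold, so [x] would be at most [y]. *)
- pose y := (w + x) / 2.
  have yA : Num.min y A <= y by rewrite ge_min lexx.
  have y0 : 0 <= Num.min y A by rewrite le_min (ltW A0) andbT /y; lra.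
  (* The maximum keeps the threshold nonnegative, and the minimum of [y] and [A] keeps the set
     inside [[0, A]], since [y] may exceed [A]. *)
  pose s := Num.max 0 (1 - y / A).
  have := @moment_superlevel _ _ R mu `[0, A]%classic `[0, Num.min y A]%classic
    (fun x => 1 - x / A) I `[0, x]%classic f n0 s (f x) (linear_profile A0)
    hartogs_bounded_profile (fun s n0s => esym (nA s n0s)).
  have wy : w < y by rewrite /y; lra.
  have yx : y < x by rewrite /y; lra.
  move=> H; have : (mu `[0%R, x]%classic <= mu `[0%R, Num.min y A]%classic)%E.
    apply: H.
    - exact: measurable_itv.
    - by apply: subset_itvl; rewrite bnd_simp ge_min lexx orbT.
    - exact: measurable_itv.
    - exact: sub.
    - by rewrite le_max lexx.
    - rewrite gt_max fx0 hw /= gtrDl pmulr_llt0 ?invr_gt0//; lra.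
    - by [].
    - move=> t /=; rewrite !in_itv/= => /andP[t0 tA] /negP; rewrite t0 /= -ltNge gt_min.
      rewrite [_ < _ in X in _ || X]ltNge tA orbF => yt.
      by rewrite le_max lerD2l lerN2 ler_pM2r ?invr_gt0// (ltW yt) orbT.
    - move=> t tx; apply: fmono => //; first exact: sub tx.
      by move: tx; rewrite /= in_itv/= => /andP[].
  by rewrite !lenE// lee_fin; lra.
(* If [x < w], the roles are exchanged: the linear function exceeds [f x] on [[0, y]] with [x < y],
   while [f] is at most [f x] beyond [x]. *)
- pose y := (w + x) / 2.
  have y0 : 0 <= y by rewrite /y; lra.
  have wy : y < w by rewrite /y; lra.
  have yx : x < y by rewrite /y; lra.
  have := @moment_superlevel _ _ R mu I `[0, x]%classic f `[0, A]%classic `[0, y]%classic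
    (fun x => 1 - x / A) n0 (f x) (1 - y / A) hartogs_bounded_profile (linear_profile A0) nA.
  move=> H; have : (mu `[0%R, y]%classic <= mu `[0%R, x]%classic)%E.
    apply: H.
    - exact: measurable_itv.
    - exact: sub.
    - exact: measurable_itv.
    - by apply: subset_itvl; rewrite bnd_simp; lra.
    - exact: ltW.
    - by rewrite hw ltrDl divr_gt0// subr_gt0.
    - by rewrite gerBl divr_ge0// ltW.
    - move=> t It /= /negP; rewrite in_itv/=; have [-> _ /=] := It; rewrite -ltNge => /ltW xt.
      exact: fmono.
    - move=> t /=; rewrite in_itv/= => /andP[t0 ty].
      by rewrite lerD2l lerN2 ler_pM2r ?invr_gt0.
  by rewrite !lenE// lee_fin; lra.
Qed.

End LinearProfile.

(** * Radial potentials *)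

Section PowerSeries.
Context {R : realType}.
Implicit Types (a : nat -> R) (rho x : R).

Lemma is_derive_add (u v : R -> R) (x du dv : R) :
  is_derive x (1 : R) u du -> is_derive x (1 : R) v dv ->
  is_derive x (1 : R) (fun y => u y + v y) (du + dv).
Proof. by move=> hu hv; exact: is_deriveD. Qed.

Lemma is_derive_sub (u v : R -> R) (x du dv : R) :
  is_derive x (1 : R) u du -> is_derive x (1 : R) v dv ->
  is_derive x (1 : R) (fun y => u y - v y) (du - dv).
Proof. by move=> hu hv; exact: is_deriveB. Qed.

Lemma is_derive_div (u v : R -> R) (x du dv : R) : v x != 0 ->
  is_derive x (1 : R) u du -> is_derive x (1 : R) v dv ->
  is_derive x (1 : R) (fun y => u y / v y) ((du * v x - u x * dv) / v x ^+ 2).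
Proof.
move=> v0 hu hv; have hV : is_derive x (1 : R) (fun y => (v y)^-1) (- (v x) ^- 2 * dv).
  exact: is_deriveV.
apply: is_derive_eq (is_derive_mul hu hV) _.
by rewrite /=; field.
Qed.

Lemma is_derive_ln (u : R -> R) (x du : R) : 0 < u x ->
  is_derive x (1 : R) u du -> is_derive x (1 : R) (fun y => ln (u y)) (du / u x).
Proof.
move=> u0 hu; have := is_derive1_comp (is_derive1_ln u0) hu.
by rewrite mulrC.
Qed.

(** Convergence at nonnegative points is what the kernel provides, the variable being a squared
    modulus; absolute convergence for [|x| < rho] follows. *)
Definition cvg_below rho a := forall x, 0 <= x -> x < rho -> cvgn (pseries a x).

(** Each of the [k + 1] terms of [1 + q + ... + q ^ k] is at least [q ^ k], and the sum is at most
    that of the full geometric series. *)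
Lemma ler_natM_geometric (q : R) k : 0 <= q -> q < 1 -> k.+1%:R * q ^+ k <= (1 - q)^-1.
Proof.
move=> q0 q1; have d0 : 0 < 1 - q by rewrite subr_gt0.
rewrite -[leRHS]mul1r ler_pdivlMr//.
have E : (1 - q) * (\sum_(i < k.+1) 1 ^+ (k.+1.-1 - i) * q ^+ i) = 1 - q ^+ k.+1.
  by rewrite -subrXX expr1n.
apply: (@le_trans _ _ (1 - q ^+ k.+1)); last by rewrite gerBl exprn_ge0.
rewrite -E [leLHS]mulrC ler_pM2l//.
have -> : k.+1%:R * q ^+ k = \sum_(i < k.+1) q ^+ k.
  by rewrite sumr_const card_ord mulr_natl.
apply: ler_sum => i _; rewrite expr1n mul1r; apply: ler_wiXn2l => //.
  exact: ltW.
by rewrite -ltnS; exact: ltn_ord.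
Qed.

Lemma cvg_below_norm rho a x : cvg_below rho a -> `|x| < rho ->
  cvgn (pseries (fun i => `|a i|) x).
Proof.
move=> ca xr; pose z := (`|x| + rho) / 2.
have x0 := normr_ge0 x.
have zx : `|x| < z by rewrite /z; lra.
have zr : z < rho by rewrite /z; lra.
have z0 : 0 <= z by exact: ltW (le_lt_trans x0 zx).
by apply: (is_cvg_pseries_inside_norm (ca _ z0 zr)); rewrite (ger0_norm z0).
Qed.

(** Comparison with the series at a point [z] between [x] and [rho]: the factor [n + 1] is absorbed
    by [(x / z) ^ n]. *)
Lemma cvg_below_diffs rho a : cvg_below rho a -> cvg_below rho (pseries_diffs a).
Proof.
move=> ca x x0 xr; pose z := (x + rho) / 2.
have zx : x < z by rewrite /z; lra.
have zr : z < rho by rewrite /z; lra.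
have z0 : 0 < z by exact: le_lt_trans x0 zx.
have cz : cvgn (pseries (fun i => `|a i|) z).
  by apply: cvg_below_norm ca _; rewrite gtr0_norm.
apply: normed_cvg.
pose q := x / z; have q0 : 0 <= q by rewrite divr_ge0// ltW.
have q1 : q < 1 by rewrite ltr_pdivrMr// mul1r.
have d0 : 0 < 1 - q by rewrite subr_gt0.
pose M := (1 - q)^-1 / z.
have M0 : 0 <= M by rewrite divr_ge0 ?invr_ge0// ltW.
apply: (@series_le_cvg _ _ (fun n => M * (`|a n.+1| * z ^+ n.+1))).
- by move=> n /=; exact: normr_ge0.
- by move=> n; apply: mulr_ge0 => //; apply: mulr_ge0 => //; apply: exprn_ge0; exact: ltW.
- move=> n; rewrite /pseries_diffs /= !normrM normr_nat normrX (ger0_norm x0).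
  have -> : n.+1%:R * `|a n.+1| * x ^+ n = n.+1%:R * q ^+ n * (`|a n.+1| * z ^+ n).
    by rewrite /q expr_div_n; field; rewrite expf_neq0// gt_eqF.
  have -> : M * (`|a n.+1| * z ^+ n.+1) = (1 - q)^-1 * (`|a n.+1| * z ^+ n).
    by rewrite /M exprS; field; rewrite !gt_eqF.
  by rewrite ler_wpM2r ?ler_natM_geometric// mulr_ge0// exprn_ge0// ltW.
have -> : series (fun n => M * (`|a n.+1| * z ^+ n.+1)) =
    (fun n => M * (pseries (fun i => `|a i|) z n.+1 - `|a 0%N|)).
  apply/funext => n; rewrite /pseries /series /= -mulr_sumr; congr (_ * _).
  by rewrite big_nat_recl// expr0 mulr1 addrC addKr.
apply: is_cvgMr; apply: is_cvgB; last exact: is_cvg_cst.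
by apply/cvg_ex; exists (limn (pseries (fun i => `|a i|) z)); rewrite cvg_shiftS.
Qed.

Lemma is_derive_pseries rho a x : cvg_below rho a -> `|x| < rho ->
  is_derive x (1 : R) (fun y => limn (pseries a y)) (limn (pseries (pseries_diffs a) x)).
Proof.
move=> ca xr; pose z := (`|x| + rho) / 2.
have x0 := normr_ge0 x.
have zx : `|x| < z by rewrite /z; lra.
have zr : z < rho by rewrite /z; lra.
have z0 : 0 <= z by exact: ltW (le_lt_trans x0 zx).
have c1 := cvg_below_diffs ca; have c2 := cvg_below_diffs c1.
apply: (@pseries_snd_diffs _ _ z); [exact: ca|exact: c1|exact: c2|].
by rewrite (ger0_norm z0).
Qed.

Lemma pseries0 a : limn (pseries a 0) = a 0%N.
Proof.
apply: lim_near_cst => //; exists 1%N => // -[//|n] _.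
rewrite /pseries /series /= big_nat_recl//= big1_seq ?addr0 ?expr0 ?mulr1//.
by move=> i _; rewrite expr0n mulr0.
Qed.

End PowerSeries.

Section LogarithmicDerivative.
Context {R : realType}.
Implicit Types (a : nat -> R) (rho : R).

(** Continuity at 0 gives the first coefficient; the differentiated series vanishes on the same
    interval, whence induction. *)
Lemma pseries_eq0 rho a : 0 < rho -> cvg_below rho a ->
  (forall y, 0 < y -> y < rho -> limn (pseries a y) = 0) -> forall n, a n = 0.
Proof.
move=> rho0 ca za n; elim: n a ca za => [|n ih] a ca za.
  apply/eqP/negPn/negP => a0.
  have r0 : `|0 : R| < rho by rewrite normr0.
  have [d0 _] := is_derive_pseries ca r0.
  have : (fun y => limn (pseries a y)) @ (0 : R) --> limn (pseries a 0).
    by apply: differentiable_continuous; exact/derivable1_diffP.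
  have e0 : 0 < `|a 0%N| by rewrite normr_gt0.
  rewrite pseries0 => /cvgrPdist_lt/(_ _ e0) [d /= d_gt0 H].
  pose y := Num.min d rho / 2.
  have m0 : 0 < Num.min d rho by rewrite lt_min d_gt0.
  have y0 : 0 < y by rewrite divr_gt0.
  have ym : y < Num.min d rho by rewrite /y; lra.
  have [yd yr] : y < d /\ y < rho by move: ym; rewrite lt_min => /andP.
  have := H y; rewrite /= sub0r normrN gtr0_norm// => /(_ yd).
  by rewrite za// subr0 ltxx.
have : pseries_diffs a n = 0.
  apply: ih; first exact: cvg_below_diffs.
  move=> y y0 yr; have yn : `|y| < rho by rewrite gtr0_norm.
  have h1 := is_derive_pseries ca yn.
  have h2 : is_derive y (1 : R) (fun y => limn (pseries a y)) 0.
    apply: (@near_eq_is_derive _ _ _ (cst 0)).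
    have yI : y \in `]0, rho[ by rewrite in_itv/= y0 yr.
    apply: filterS (near_in_itvoo yI) => t; rewrite in_itv/= => /andP[t0 tr].
    by rewrite za.
  by rewrite -(@derive_val _ _ _ _ _ _ _ h1) (@derive_val _ _ _ _ _ _ _ h2).
by move=> /eqP; rewrite mulf_eq0 pnatr_eq0 => /eqP.
Qed.

Lemma pseries_gt0 rho a y : (forall n, 0 < a n) -> cvg_below rho a -> 0 <= y -> y < rho ->
  0 < limn (pseries a y).
Proof.
move=> a0 ca y0 yr; apply: lt_le_trans (a0 0%N) _.
have -> : a 0%N = pseries a y 1%N.
  by rewrite /pseries /series /= big_nat1 expr0 mulr1.
apply: nondecreasing_cvgn_le; last exact: ca.
by apply: nondecreasing_series => i _ _; rewrite mulr_ge0 ?exprn_ge0// ltW.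
Qed.

(* The equation integrates to [(rho - y) * S0' = lam * S0]. *)
Theorem log_pseries_recursion rho a (lam : R) : 0 < rho -> cvg_below rho a ->
  (forall n, 0 < a n) ->
  let S0 y := limn (pseries a y) in
  let S1 y := limn (pseries (pseries_diffs a) y) in
  let S2 y := limn (pseries (pseries_diffs (pseries_diffs a)) y) in
  (forall y, 0 < y -> y < rho ->
    S1 y / S0 y + y * ((S2 y * S0 y - S1 y * S1 y) / S0 y ^+ 2) =
    lam * (rho / (rho - y) ^+ 2)) ->
  forall k, rho * (k.+1%:R * a k.+1) = (k%:R + lam) * a k.
Proof.
move=> rho0 ca a0 S0 S1 S2 H.
have ca1 := cvg_below_diffs ca.
have S0p y : 0 <= y -> y < rho -> 0 < S0 y by exact: pseries_gt0.
(* The primitive of the difference of the two sides. It vanishes at 0 and the hypothesis says that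
   its derivative is 0. *)
pose u y := y * (S1 y / S0 y) - lam * (y / (rho - y)).
pose du y := (y * ((S2 y * S0 y - S1 y * S1 y) / S0 y ^+ 2) + S1 y / S0 y * 1) -
   lam * ((1 * (rho - y) - y * (-1)) / (rho - y) ^+ 2).
have dS y : 0 <= y -> y < rho -> is_derive y (1 : R) u (du y).
  move=> y0 yr; have yn : `|y| < rho by rewrite ger0_norm.
  have h0 : is_derive y (1 : R) S0 (S1 y) := is_derive_pseries ca yn.
  have h1 : is_derive y (1 : R) S1 (S2 y) := is_derive_pseries ca1 yn.
  have s0 : S0 y != 0 by rewrite gt_eqF// S0p.
  have ry : rho - y != 0 by rewrite subr_eq0 gt_eqF.
  have hi := is_derive_id y (1 : R).
  exact (is_derive_sub (is_derive_mul hi (is_derive_div s0 h1 h0))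
    (is_derive_mull lam (@is_derive_div _ id (fun y => rho - y) _ _ _ ry hi (is_derive_subl rho y)))).
have ode y : 0 < y -> y < rho -> (rho - y) * S1 y = lam * S0 y.
  move=> y0 yr.
  have du_itv x : x \in `]0, y[%R -> is_derive x (1 : R) u (du x).
    rewrite in_itv/= => /andP[x0 xy]; apply: dS; first exact: ltW.
    exact: lt_trans yr.
  have cu : {within `[0, y], continuous u}.
    apply: derivable_within_continuous => x; rewrite in_itv/= => /andP[x0 xy].
    by have [h _] := dS x x0 (le_lt_trans xy yr).
  have [t tI uE] := MVT y0 du_itv cu.
  have [t0 tr] : 0 < t /\ t < rho.
    by move: tI; rewrite in_itv/= => /andP[? ty]; split => //; exact: lt_trans yr.
  have du0 : du t = 0.
    have := H t t0 tr; rewrite /du => h.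
    have -> : 1 * (rho - t) - t * -1 = rho by ring.
    by rewrite -h mulr1 [X in X - _]addrC subrr.
  have : u y = 0.
    have -> : u y = u y - u 0 by rewrite /u !mul0r mulr0 !subr0.
    by rewrite uE du0 mul0r.
  have s0 : S0 y != 0 by rewrite gt_eqF// S0p// ltW.
  have ry : rho - y != 0 by rewrite subr_eq0 gt_eqF.
  have yn : y != 0 by rewrite gt_eqF.
  rewrite /u => /subr0_eq h; apply: (mulfI yn).
  transitivity (y * (S1 y / S0 y) * (S0 y * (rho - y))); first by field.
  by rewrite h; field.
(* The coefficients of the power series of [(rho - y) * S1 y - lam * S0 y]. *)
pose e k := rho * pseries_diffs a k - (k%:R + lam) * a k.
have ce y : 0 <= y -> y < rho -> pseries e y @ \oo --> rho * S1 y - (y * S1 y + lam * S0 y).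
  move=> y0 yr; have c0 := ca y y0 yr; have c1 := ca1 y y0 yr.
  have -> : pseries e y = (fun n => rho * pseries (pseries_diffs a) y n -
     (y * series (fun i => i%:R * a i * y ^+ i.-1) n + lam * pseries a y n)).
    apply/funext => n; rewrite /pseries /series /= !mulr_sumr -big_split -sumrB /=.
    apply: eq_bigr => i _; rewrite /e; case: i => [|i] /=; first by rewrite !expr0; ring.
    by rewrite (exprS y i); ring.
  apply: cvgB; first by apply: cvgM; [exact: cvg_cst|exact: c1].
  apply: cvgD; apply: cvgM; try exact: cvg_cst.
    exact: pseries_diffs_equiv c1.
  exact: c0.
have e0 : forall k, e k = 0.
  apply: (@pseries_eq0 rho) => //.
    by move=> y y0 yr; apply/cvg_ex; eexists; exact: ce y0 yr.
  move=> y y0 yr; rewrite (cvg_lim _ (ce y (ltW y0) yr))//.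
  by rewrite -(ode y y0 yr); ring.
by move=> k; have := e0 k; rewrite /e => /subr0_eq.
Qed.

End LogarithmicDerivative.

(** * Wirtinger derivatives and complex Hessians *)

Section Wirtinger.
Context {R : realType} {m : nat}.
Local Notation Cm := 'rV[R[i]]_m.+1.
Implicit Types (f : Cm -> R[i]) (z : Cm) (j k : 'I_m.+1).

Definition coord_direction j (ex ey : R) : Cm := (ex +i* ey) *: delta_mx 0 j.

Lemma coord_lineE z j k (ex ey t : R) :
  (z + t%:C *: coord_direction j ex ey) 0 k =
  if k == j then (complex.Re (z 0 k) + t * ex) +i* (complex.Im (z 0 k) + t * ey) else z 0 k.
Proof.
rewrite !mxE eqxx /=; case: eqP => [->|_] /=; last by rewrite !mulr0 addr0.
rewrite mulr1; case: (z 0 j) => x y /=; apply/eqP; rewrite eq_complex /=.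
by apply/andP; split; apply/eqP; ring.
Qed.

Lemma near_coord_line z j (ex ey : R) (P : set Cm) : (\forall w \near z, P w) ->
  \forall t \near (0 : R), P (z + t%:C *: coord_direction j ex ey).
Proof.
move=> /near_rowP[d d0 H].
have k0 : 0 < cabs (ex +i* ey) + 1 by rewrite ltr_wpDl// cabs_ge0.
exists (d / (cabs (ex +i* ey) + 1)) => /=; first by rewrite divr_gt0.
move=> t; rewrite /= sub0r normrN ltr_pdivlMr// => td; apply: H => k.
have -> : (z + t%:C *: coord_direction j ex ey) 0 k - z 0 k =
    t%:C * ((ex +i* ey) * (delta_mx 0 j : Cm) 0 k).
  by rewrite !mxE addrC addKr.
apply: le_lt_trans td; rewrite cabsM cabs_ofreal ler_wpM2l// cabsM mxE eqxx /=.
have c0 : 0 <= cabs (ex +i* ey) := cabs_ge0 _.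
by case: (k == j); rewrite ?cabs1 ?cabs0 ?mulr1 ?mulr0 ?lerDl ?addr_ge0.
Qed.

Lemma real_deriveE f v z (g h : R -> R) (a c : R) :
  (\forall t \near (0 : R), f (z + t%:C *: v) = g t +i* h t) ->
  is_derive (0 : R) (1 : R) g a -> is_derive (0 : R) (1 : R) h c ->
  real_derive v f z = a +i* c.
Proof.
move=> fgh dg dh; rewrite /real_derive !derive1E.
have hg : is_derive (0 : R) (1 : R) (fun t => complex.Re (f (z + t%:C *: v))) a.
  by apply: (near_eq_is_derive _ dg); apply: filterS fgh => t ->.
have hh : is_derive (0 : R) (1 : R) (fun t => complex.Im (f (z + t%:C *: v))) c.
  by apply: (near_eq_is_derive _ dh); apply: filterS fgh => t ->.
by rewrite (@derive_val _ _ _ _ _ _ _ hg) (@derive_val _ _ _ _ _ _ _ hh).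
Qed.

Lemma coord_direction1 j : delta_mx 0 j = coord_direction j 1 0 :> Cm.
Proof. by rewrite /coord_direction (_ : 1 +i* 0 = 1)// scale1r. Qed.

Lemma dzE f j z (a b c d : R) :
  real_derive (coord_direction j 1 0) f z = a +i* b ->
  real_derive (coord_direction j 0 1) f z = c +i* d ->
  dz j f z = ((a + d) / 2) +i* ((b - c) / 2).
Proof.
move=> h1 h2; rewrite /dz coord_direction1 h1.
rewrite /coord_direction (_ : 1 +i* 0 = 1)// scale1r h2.
have -> : (2 : R[i]) = (2 : R)%:C by rewrite rmorphMn rmorph1.
rewrite -[(2%:R)%:C^-1]fmorphV.
by apply/eqP; rewrite eq_complex /=; apply/andP; split; apply/eqP; field.
Qed.

Lemma dzbarE f j z (a b c d : R) :
  real_derive (coord_direction j 1 0) f z = a +i* b ->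
  real_derive (coord_direction j 0 1) f z = c +i* d ->
  dzbar j f z = ((a - d) / 2) +i* ((b + c) / 2).
Proof.
move=> h1 h2; rewrite /dzbar coord_direction1 h1.
rewrite /coord_direction (_ : 1 +i* 0 = 1)// scale1r h2.
have -> : (2 : R[i]) = (2 : R)%:C by rewrite rmorphMn rmorph1.
rewrite -[(2%:R)%:C^-1]fmorphV.
by apply/eqP; rewrite eq_complex /=; apply/andP; split; apply/eqP; field.
Qed.

End Wirtinger.

Section Hessians.
Context {R : realType} {m : nat}.
Local Notation Cm := 'rV[R[i]]_m.+1.
Implicit Types (z : Cm) (j k : 'I_m.+1).

Lemma is_derive_quadratic (p q r : R) :
  is_derive (0 : R) (1 : R) (fun t => p + t * q + t ^+ 2 * r) q.
Proof.
have hi := is_derive_id (0 : R) (1 : R).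
have h := is_derive_add (is_derive_add (is_derive_cst p (0 : R) (1 : R))
  (is_derive_mul hi (is_derive_cst q (0 : R) (1 : R))))
  (is_derive_mul (is_derive_expn 1 hi) (is_derive_cst r (0 : R) (1 : R))).
by apply: is_derive_eq h _; rewrite /=; ring.
Qed.

Lemma is_derive_line (p q : R) : is_derive (0 : R) (1 : R) (fun t => p + t * q) q.
Proof.
have := is_derive_quadratic p q 0.
by under eq_fun do rewrite mulr0 addr0.
Qed.

Section LogPotential.
Variables (a : 'I_m.+1 -> R) (c : R).

(** Both [g_F] for a linear profile and the hyperbolic metric ([a = 1], [c = 1]) have the potential
    [- ln] of such a function. *)
Definition log_weight (w : Cm) : R := c - \sum_i a i * sqmod (w 0 i).

Lemma log_weight_line z j (ex ey t : R) :
  log_weight (z + t%:C *: coord_direction j ex ey) =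
  log_weight z + t * (- 2 * a j * (complex.Re (z 0 j) * ex + complex.Im (z 0 j) * ey)) +
  t ^+ 2 * (- a j * (ex ^+ 2 + ey ^+ 2)).
Proof.
rewrite /log_weight (bigD1 j)//= [in RHS](bigD1 j)//= coord_lineE eqxx.
rewrite (eq_bigr (fun i => a i * sqmod (z 0 i))) => [|i ij]; last first.
  by rewrite coord_lineE (negbTE ij).
by rewrite /sqmod /=; ring.
Qed.

Lemma is_derive_log_weight z j (ex ey : R) :
  is_derive (0 : R) (1 : R) (fun t => log_weight (z + t%:C *: coord_direction j ex ey))
  (- 2 * a j * (complex.Re (z 0 j) * ex + complex.Im (z 0 j) * ey)).
Proof. by under eq_fun do rewrite log_weight_line; exact: is_derive_quadratic. Qed.

Lemma log_weight_line0 z j (ex ey : R) :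
  log_weight (z + (0 : R)%:C *: coord_direction j ex ey) = log_weight z.
Proof. by rewrite log_weight_line mul0r expr0n mul0r !addr0. Qed.

(** The form [k0 + k1 * ln] covers both the potential and the logarithm of the determinant of its
    Hessian. *)
Lemma dzbar_log (phi : Cm -> R) (k0 k1 : R) z k : 0 < log_weight z ->
  (\forall w \near z, phi w = k0 + k1 * ln (log_weight w)) ->
  dzbar k (fun w => (phi w)%:C) z =
  (- k1 * a k / log_weight z * complex.Re (z 0 k)) +i*
  (- k1 * a k / log_weight z * complex.Im (z 0 k)).
Proof.
move=> Q0 phiE; have Qn : log_weight z != 0 by rewrite gt_eqF.
have D ex ey : real_derive (coord_direction k ex ey) (fun w => (phi w)%:C) z =
    (k1 * (- 2 * a k * (complex.Re (z 0 k) * ex + complex.Im (z 0 k) * ey) / log_weight z)) +i* 0.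
  apply: (real_deriveE (g := fun t => k0 + k1 * ln (log_weight (z + t%:C *: coord_direction k ex ey)))
    (h := cst 0)).
  - by apply: filterS (near_coord_line k ex ey phiE) => t ->.
  - have Qd := is_derive_log_weight z k ex ey.
    have Q0' : 0 < log_weight (z + (0 : R)%:C *: coord_direction k ex ey).
      by rewrite log_weight_line0.
    have h := is_derive_add (is_derive_cst k0 (0 : R) (1 : R))
      (is_derive_mull k1 (@is_derive_ln _
        (fun t => log_weight (z + t%:C *: coord_direction k ex ey)) _ _ Q0' Qd)).
    by apply: is_derive_eq h _; rewrite log_weight_line0 add0r.
rewrite (dzbarE (D 1 0) (D 0 1)); apply/eqP; rewrite eq_complex /=.
by apply/andP; split; apply/eqP; field.
Qed.

Lemma near_log_weight_gt0 z : 0 < log_weight z -> \forall w \near z, 0 < log_weight w.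
Proof.
move=> Q0; pose e := log_weight z / (\sum_i `|a i| + 1).
have s0 : 0 <= \sum_i `|a i| by apply: sumr_ge0.
have s1 : 0 < \sum_i `|a i| + 1 by rewrite ltr_wpDl.
have e0 : 0 < e by rewrite divr_gt0.
have nf : \forall w \near (z : Cm), forall i, `|sqmod ((w : Cm) 0 i) - sqmod (z 0 i)| < e.
  exact (@filter_forall _ _ _ (nbhs z) _ (fun i => continuous_sqmod_coord z i e0)).
apply: filterS nf => w H.
have : `|log_weight w - log_weight z| < log_weight z.
  rewrite /log_weight opprB addrC addrA subrK -sumrB.
  apply: (@le_lt_trans _ _ (\sum_i `|a i| * e)).
    apply: le_trans (ler_norm_sum _ _ _) _; apply: ler_sum => i _.
    by rewrite -mulrBr normrM ler_wpM2l// ltW// distrC.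
  rewrite -mulr_suml /e mulrA ltr_pdivrMr// mulrC ltr_pM2l//.
  by rewrite ltrDl.
by rewrite ltr_distl subrr => /andP[].
Qed.

Lemma hessian_log (phi : Cm -> R) (k0 k1 : R) z j k : 0 < log_weight z ->
  (\forall w \near z, phi w = k0 + k1 * ln (log_weight w)) ->
  complex_hessian phi z j k =
  (- k1)%:C * ((a k / log_weight z * (j == k)%:R)%:C +
     (a j * a k / log_weight z ^+ 2)%:C * ((z 0 j)^* * z 0 k)).
Proof.
move=> Q0 phiE; have Qn : log_weight z != 0 by rewrite gt_eqF.
rewrite mxE.
have near_dz : \forall w \near z, dzbar k (fun w => (phi w)%:C) w =
  (- k1 * a k * complex.Re (w 0 k) / log_weight w) +i*
  (- k1 * a k * complex.Im (w 0 k) / log_weight w).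
  apply: filterS2 (near_log_weight_gt0 Q0) (near_join phiE) => w Qw phiw.
  by rewrite (dzbar_log _ Qw phiw); congr (_ +i* _); rewrite mulrAC.
pose b : R := (j == k)%:R.
have D ex ey : real_derive (coord_direction j ex ey) (dzbar k (fun w => (phi w)%:C)) z =
    ((- k1 * a k * (b * ex) * log_weight z - - k1 * a k * complex.Re (z 0 k) *
      (- 2 * a j * (complex.Re (z 0 j) * ex + complex.Im (z 0 j) * ey))) / log_weight z ^+ 2) +i*
    ((- k1 * a k * (b * ey) * log_weight z - - k1 * a k * complex.Im (z 0 k) *
      (- 2 * a j * (complex.Re (z 0 j) * ex + complex.Im (z 0 j) * ey))) / log_weight z ^+ 2).
  pose Q t := log_weight (z + t%:C *: coord_direction j ex ey).
  have Qd : is_derive (0 : R) (1 : R) Q _ := is_derive_log_weight z j ex ey.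
  have Q00 : Q 0 = log_weight z := log_weight_line0 z j ex ey.
  have Q0n : Q 0 != 0 by rewrite Q00.
  have quot (x y : R) : is_derive (0 : R) (1 : R)
      (fun t => - k1 * a k * (x + t * (b * y)) / Q t)
      ((- k1 * a k * (b * y) * log_weight z - - k1 * a k * x *
       (- 2 * a j * (complex.Re (z 0 j) * ex + complex.Im (z 0 j) * ey))) / log_weight z ^+ 2).
    have := is_derive_div Q0n (is_derive_mull (- k1 * a k) (is_derive_line x (b * y))) Qd.
    by rewrite Q00 mul0r addr0.
  apply: (real_deriveE _ (quot (complex.Re (z 0 k)) ex) (quot (complex.Im (z 0 k)) ey)).
  apply: filterS (near_coord_line j ex ey near_dz) => t ->.
  rewrite coord_lineE -/(Q t) eq_sym /b; case: eqP => _ /=; first by rewrite !mul1r.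
  by rewrite !mul0r !mulr0 !addr0.
rewrite (dzE (D 1 0) (D 0 1)); apply/eqP; rewrite eq_complex /=.
rewrite /b; have [jk|_] := eqVneq j k; last first.
  move: (z 0 j) (z 0 k) => [xj yj] [xk yk] /=.
  by apply/andP; split; apply/eqP; field.
rewrite -jk; move: (z 0 j) => [xj yj] /=.
by apply/andP; split; apply/eqP; field.
Qed.

End LogPotential.

Section RadialPotential.
Variables (j : 'I_m.+1) (rho : R) (phi : Cm -> R) (psi psi1 psi2 : R -> R).
Local Notation pt := (slice_point j).
Hypothesis phiE : forall s, cabs s < rho -> phi (pt s) = psi (sqmod s).
Hypothesis psi_d : forall s : R[i], cabs s < rho ->
  is_derive (sqmod s) (1 : R) psi (psi1 (sqmod s)).
Hypothesis psi1_d : forall s : R[i], cabs s < rho ->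
  is_derive (sqmod s) (1 : R) psi1 (psi2 (sqmod s)).

Let cline (s : R[i]) (ex ey t : R) : R[i] := s + t%:C * (ex +i* ey).

Lemma slice_point_line s ex ey t :
  pt s + t%:C *: coord_direction j ex ey = pt (cline s ex ey t).
Proof. by rewrite /slice_point /coord_direction scalerA -scalerDl. Qed.

Lemma near_cline s ex ey : cabs s < rho -> \forall t \near (0 : R), cabs (cline s ex ey t) < rho.
Proof.
move=> sr; have k0 : 0 < cabs (ex +i* ey) + 1 by rewrite ltr_wpDl// cabs_ge0.
exists ((rho - cabs s) / (cabs (ex +i* ey) + 1)) => /=.
  by rewrite divr_gt0// subr_gt0.
move=> t; rewrite /= sub0r normrN ltr_pdivlMr// => td.
apply: le_lt_trans (ler_cabsD _ _) _; rewrite cabsM cabs_ofreal.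
have : 0 <= `|t| by [].
lra.
Qed.

Lemma is_derive_sqmod_line s ex ey :
  is_derive (0 : R) (1 : R) (fun t => sqmod (cline s ex ey t))
    (2 * (complex.Re s * ex + complex.Im s * ey)).
Proof.
have -> : (fun t => sqmod (cline s ex ey t)) =
    (fun t => sqmod s + t * (2 * (complex.Re s * ex + complex.Im s * ey)) + t ^+ 2 * (ex ^+ 2 + ey ^+ 2)).
  by apply/funext => t; rewrite /cline /sqmod; case: s => x y /=; ring.
exact: is_derive_quadratic.
Qed.

Lemma cline0 s ex ey : cline s ex ey 0 = s.
Proof. by rewrite /cline mul0r addr0. Qed.

Lemma dzbar_radial s : cabs s < rho ->
  dzbar j (fun w => (phi w)%:C) (pt s) =
  (psi1 (sqmod s) * complex.Re s) +i* (psi1 (sqmod s) * complex.Im s).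
Proof.
move=> sr.
have D ex ey : real_derive (coord_direction j ex ey) (fun w => (phi w)%:C) (pt s) =
    (psi1 (sqmod s) * (2 * (complex.Re s * ex + complex.Im s * ey))) +i* 0.
  apply: (real_deriveE (g := psi \o (fun t => sqmod (cline s ex ey t))) (h := cst 0)).
  - apply: filterS (near_cline ex ey sr) => t ts.
    by rewrite slice_point_line phiE.
  - apply: is_derive1_comp (is_derive_sqmod_line s ex ey).
    by rewrite cline0; exact: psi_d.
rewrite (dzbarE (D 1 0) (D 0 1)); apply/eqP; rewrite eq_complex /=.
by apply/andP; split; apply/eqP; field.
Qed.

(** Both derivatives are taken along the axis, so the values of [phi] there suffice. *)
Lemma hessian_radial s : cabs s < rho ->
  complex_hessian phi (pt s) j j =
  (psi1 (sqmod s) + sqmod s * psi2 (sqmod s))%:C.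
Proof.
move=> sr; rewrite mxE.
have D ex ey : real_derive (coord_direction j ex ey) (dzbar j (fun w => (phi w)%:C)) (pt s) =
    (psi1 (sqmod s) * ex + complex.Re s * (psi2 (sqmod s) * (2 * (complex.Re s * ex + complex.Im s * ey)))) +i*
    (psi1 (sqmod s) * ey + complex.Im s * (psi2 (sqmod s) * (2 * (complex.Re s * ex + complex.Im s * ey)))).
  have d1 : is_derive (0 : R) (1 : R) (psi1 \o (fun t => sqmod (cline s ex ey t)))
      (psi2 (sqmod s) * (2 * (complex.Re s * ex + complex.Im s * ey))).
    apply: is_derive1_comp (is_derive_sqmod_line s ex ey).
    by rewrite cline0; exact: psi1_d.
  have dl (x y : R) : is_derive (0 : R) (1 : R)
      (fun t => psi1 (sqmod (cline s ex ey t)) * (x + t * y))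
      (psi1 (sqmod s) * y + x * (psi2 (sqmod s) * (2 * (complex.Re s * ex + complex.Im s * ey)))).
    have := is_derive_mul d1 (is_derive_line x y).
    by rewrite /= cline0 mul0r addr0.
  apply: (real_deriveE _ (dl _ _) (dl _ _)).
  apply: filterS (near_cline ex ey sr) => t ts.
  rewrite slice_point_line dzbar_radial//.
  have -> : complex.Re (cline s ex ey t) = complex.Re s + t * ex.
    by rewrite /cline; case: (s) => x y /=; ring.
  suff -> : complex.Im (cline s ex ey t) = complex.Im s + t * ey by [].
  by rewrite /cline; case: (s) => x y /=; ring.
rewrite (dzE (D 1 0) (D 0 1)); apply/eqP; rewrite eq_complex /= /sqmod.
by apply/andP; split; apply/eqP; field.
Qed.

End RadialPotential.
End Hessians.

(** * From proportional metrics to a linear profile *)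

Section BergmanProfile.
Context {R : realType} {p : nat}.
Local Notation RR := (measurableTypeR R).
Local Notation mu := (@lebesgue_measure R).
Local Notation lambda n := (@tuple_measure _ RR R mu n).
Local Notation kappa := (@kappa R).
Local Notation Cm := 'rV[R[i]]_p.+2.
Variables (b : \bar R) (F : R -> R).
Local Notation I := (base_interval b).
Local Notation D := (hartogs_domain b F : set Cm).
Local Notation j := (@fiber_index p).
Hypothesis b_gt0 : (0 < b)%E.
Hypothesis F_gt0 : forall x, I x -> 0 < F x.
Hypothesis F_nincr : forall x y, I x -> I y -> x <= y -> F y <= F x.
Hypothesis F_smooth : smooth_within I F.
Hypothesis F_spc : strong_pseudoconvexity_condition b F.
Hypothesis D_bounded : bounded_set D.

Let F00 : 0 < F 0 := F_gt0 (base_interval0 b_gt0).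

Lemma sqmod_ofreal_sqrt (x : R) : 0 <= x -> sqmod (Num.sqrt x)%:C = x.
Proof. by move=> x0; rewrite /sqmod /= expr0n addr0 sqr_sqrtr. Qed.

(** The points with [z_0 = sqrt x] and all other coordinates 0 belong to [D]. *)
Lemma base_bounded : exists B : R, forall x, I x -> x <= B.
Proof.
have [M HM] := hartogs_bounded D_bounded; exists (M ^+ 2) => x Ix.
have [x0 xb] := Ix.
pose z : Cm := slice_point ord0 (Num.sqrt x)%:C.
have z0 : z 0 ord0 = (Num.sqrt x)%:C by rewrite slice_pointE eqxx.
have Dz : D z.
  rewrite /hartogs_domain /= z0 sqmod_ofreal_sqrt//; split => //.
  rewrite /fiber_sqnorm big1 ?F_gt0// => i i0.
  by rewrite slice_pointE (negbTE i0) sqmod0.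
have := HM z Dz ord0; rewrite z0 => h.
have c0 := cabs_ge0 ((Num.sqrt x)%:C).
rewrite -[x]sqmod_ofreal_sqrt// -cabs_sqr lerXn2r ?nnegrE//.
exact: le_trans h.
Qed.

(** The volume is the moment of order 0, and powers of the profile are integrable over the bounded
    base. *)
Lemma hartogs_finite : (lambda p.+2.*2 (@complex_point R p.+2 @^-1` D) < +oo)%E.
Proof.
have mS := measurable_preimage (@hartogs_open R p b F F_smooth).
have := @hartogs_moment R p b F b_gt0 F_gt0 F_nincr F_smooth 0.
under eq_integral do rewrite expr0.
rewrite integral_cst// mul1e => ->.
have mI : measurable (I : set RR) by exact: measurable_base.
have fE := fineK (integrable_fin_num mI
  (profile_integrable b_gt0 F_gt0 F_nincr base_bounded p.+1)).
rewrite add0n -[X in (_ * X)%E]fE.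
by rewrite -EFinM ltry.
Qed.

Lemma coord_momentE k : coord_moment D j k =
  kappa ^+ p.+2 * k`!%:R / (k + p).+1`!%:R * \int[mu]_(u in I) F u ^+ (k + p).+1.
Proof.
have := @hartogs_moment R p b F b_gt0 F_gt0 F_nincr F_smooth k.
have mI : measurable (I : set RR) by exact: measurable_base.
have fE := fineK (integrable_fin_num mI
  (profile_integrable b_gt0 F_gt0 F_nincr base_bounded (k + p).+1)).
by rewrite /coord_moment /Rintegral => ->; rewrite -[X in fine (_ * X)%E]fE -EFinM.
Qed.

Lemma potential_metric_delta (phi : Cm -> R) z k :
  potential_metric phi z (delta_mx 0 k) (delta_mx 0 k) =
  2 * complex.Re (complex_hessian phi z k k).
Proof.
have dE i : (delta_mx 0 k : Cm) 0 i = (i == k)%:R by rewrite mxE eqxx.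
have c0 (h : R[i]) : h * (0 : R[i])^* = 0 by case: h => x y; apply: complex_ext => /=; ring.
have c1 (h : R[i]) : h * (1 : R[i])^* = h by case: h => x y; apply: complex_ext => /=; ring.
rewrite /potential_metric (bigD1 k)//= (bigD1 k)//= !big1 => [|i ik|i ik].
- rewrite !dE eqxx /= mulr1 !addr0.
  exact (congr1 (fun x => 2 * complex.Re x) (c1 _)).
- by rewrite big1// => l _; rewrite dE (negbTE ik) mulr0 mul0r.
- have vi : (delta_mx 0 k : Cm) 0 i = 0 by rewrite dE (negbTE ik).
  by rewrite vi; exact (c0 _).
Qed.

Variables (K : Cm -> Cm -> R[i]) (lam : R).
Hypothesis K_bergman : is_bergman_kernel D K.
Hypothesis gB_eq : forall z, D z -> forall u v,
  bergman_metric K z u v = lam * hartogs_metric F z u v.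

Local Notation pt := (slice_point j).
Local Notation rho := (Num.sqrt (F 0)).

Lemma sqmod_lt s : cabs s < rho -> sqmod s < F 0.
Proof.
move=> sr; rewrite -[ltRHS](sqr_sqrtr (ltW F00)) -cabs_sqr.
by rewrite ltrXn2r ?nnegrE ?cabs_ge0 ?sqrtr_ge0.
Qed.

(** The diagonal entry of the metric identity in the axis direction is the logarithmic equation for
    the series with coefficients the inverse moments. *)
Lemma coord_moment_recursion :
  (forall k, 0 < coord_moment D j k) /\
  forall k, F 0 * (k.+1%:R * (coord_moment D j k.+1)^-1) =
    (k%:R + lam) * (coord_moment D j k)^-1.
Proof.
have rho0 : 0 < rho by rewrite sqrtr_gt0.
have [c0 cK] := kernel_series (@hartogs_open R p b F F_smooth)
  (hartogs_reinhardt F_nincr) rho0 (hartogs_slice b_gt0 F_gt0)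
  (hartogs_bounded D_bounded) hartogs_finite K_bergman.
split=> //.
pose a k := (coord_moment D j k)^-1.
have a0 k : 0 < a k by rewrite invr_gt0.
have limK s : cabs s < rho -> pseries a (sqmod s) @ \oo --> complex.Re (K (pt s) (pt s)).
  move=> /cK[C [r [r0 r1 H]]].
  have Cr : (fun n => C * r ^+ n) @ \oo --> (0 : R).
    rewrite -[X in _ --> X](mulr0 C); apply: cvgM; first exact: cvg_cst.
    by apply: cvg_expr; rewrite ger0_norm.
  apply/cvgrPdist_lt => e e0; have /cvgrPdist_lt/(_ e e0) := Cr.
  apply: filterS => n; rewrite sub0r normrN => Ce.
  apply: le_lt_trans Ce; apply: le_trans (ler_norm _).
  rewrite /pseries /series /= big_mkord.
  suff -> : \sum_(k < n) a k * sqmod s ^+ k = \sum_(k < n) sqmod s ^+ k / coord_moment D j k.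
    exact: H.
  by apply: eq_bigr => k _; rewrite mulrC.
have sq y : 0 <= y -> y < F 0 -> cabs (Num.sqrt y)%:C < rho.
  by move=> y0 yF; rewrite cabs_ofreal ger0_norm ?sqrtr_ge0// ltr_sqrt.
have ca : cvg_below (F 0) a.
  move=> y y0 yF; apply/cvg_ex; exists (complex.Re (K (pt (Num.sqrt y)%:C) (pt (Num.sqrt y)%:C))).
  by have := limK _ (sq y y0 yF); rewrite sqmod_ofreal_sqrt.
pose S0 y := limn (pseries a y).
pose S1 y := limn (pseries (pseries_diffs a) y).
pose S2 y := limn (pseries (pseries_diffs (pseries_diffs a)) y).
have KS s : cabs s < rho -> complex.Re (K (pt s) (pt s)) = S0 (sqmod s).
  by move=> sr; rewrite /S0 (cvg_lim _ (limK s sr)).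
apply: (log_pseries_recursion (lam := lam) F00 ca a0) => y y0 yF.
rewrite -/(S0 y) -/(S1 y) -/(S2 y).
pose s : R[i] := (Num.sqrt y)%:C.
have sr : cabs s < rho := sq y (ltW y0) yF.
have sy : sqmod s = y by rewrite sqmod_ofreal_sqrt// ltW.
have S0_gt0 s' : cabs s' < rho -> 0 < S0 (sqmod s').
  by move=> s'r; apply: pseries_gt0 a0 ca (sqmod_ge0 _) (sqmod_lt s'r).
have S0_d s' : cabs s' < rho -> is_derive (sqmod s') (1 : R) S0 (S1 (sqmod s')).
  move=> s'r; apply: (is_derive_pseries ca).
  by rewrite ger0_norm ?sqmod_ge0// sqmod_lt.
have S1_d s' : cabs s' < rho -> is_derive (sqmod s') (1 : R) S1 (S2 (sqmod s')).
  move=> s'r; apply: (is_derive_pseries (cvg_below_diffs ca)).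
  by rewrite ger0_norm ?sqmod_ge0// sqmod_lt.
have hB : complex_hessian (fun z => ln (complex.Re (K z z))) (pt s) j j =
    (S1 y / S0 y + y * ((S2 y * S0 y - S1 y * S1 y) / S0 y ^+ 2))%:C.
  rewrite -sy; apply: (@hessian_radial _ _ j rho _ (fun y => ln (S0 y))
    (fun y => S1 y / S0 y) (fun y => (S2 y * S0 y - S1 y * S1 y) / S0 y ^+ 2)) sr => s' s'r.
  - by rewrite KS.
  - exact: is_derive_ln (S0_gt0 _ s'r) (S0_d _ s'r).
  - have Sn : S0 (sqmod s') != 0 by rewrite gt_eqF// S0_gt0.
    exact: is_derive_div Sn (S1_d _ s'r) (S0_d _ s'r).
have Ds s' : cabs s' < rho -> D (pt s') by move=> s'r; exact/(hartogs_slice b_gt0 F_gt0).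
(* On the axis the base coordinate is 0, so the potential is [- ln (F 0 - y)]: only the value [F 0]
   of the profile enters. *)
have hF : complex_hessian (hartogs_potential F) (pt s) j j =
    ((F 0 - y)^-1 + y * ((F 0 - y)^-1 ^+ 2))%:C.
  rewrite -sy; apply: (@hessian_radial _ _ j rho _ (fun y => - ln (F 0 - y))
    (fun y => (F 0 - y)^-1) (fun y => (F 0 - y)^-1 ^+ 2)) sr => s' s'r.
  - rewrite /hartogs_potential slice_pointE /= sqmod0; congr (- ln (_ - _)).
    rewrite /fiber_sqnorm (bigD1 j)//= big1 => [|i /andP[_ ij]].
      by rewrite addr0 slice_pointE eqxx.
    by rewrite slice_pointE (negbTE ij) sqmod0.
  - have h : 0 < F 0 - sqmod s' by rewrite subr_gt0 sqmod_lt.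
    have := is_derive_mull (-1) (@is_derive_ln _ (fun y => F 0 - y) _ _ h (is_derive_subl (F 0) (sqmod s'))).
    under eq_fun do rewrite mulN1r.
    by move=> /is_derive_eq; apply; rewrite !mulN1r opprK.
  - have h : F 0 - sqmod s' != 0 by rewrite gt_eqF// subr_gt0 sqmod_lt.
    have := @is_derive_div _ (cst 1) (fun y => F 0 - y) _ _ _ h
      (is_derive_cst (1 : R) (sqmod s') (1 : R)) (is_derive_subl (F 0) (sqmod s')).
    under eq_fun do rewrite div1r.
    by move=> /is_derive_eq; apply; rewrite /=; field.
have E1 := etrans (potential_metric_delta (fun z => ln (complex.Re (K z z))) (pt s) j)
  (congr1 (fun h => 2 * complex.Re h) hB).
have E2 := etrans (potential_metric_delta (hartogs_potential F) (pt s) j)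
  (congr1 (fun h => 2 * complex.Re h) hF).
have gE : 2 * (S1 y / S0 y + y * ((S2 y * S0 y - S1 y * S1 y) / S0 y ^+ 2)) =
    lam * (2 * ((F 0 - y)^-1 + y * ((F 0 - y)^-1 ^+ 2))) := etrans (esym E1) (etrans (gB_eq (Ds s sr) (delta_mx 0 j) (delta_mx 0 j))
  (congr1 (fun x => lam * x) E2)).
move: gE; rewrite [RHS]mulrCA.
have two0 : 2 != 0 :> R by rewrite pnatr_eq0.
move=> /(mulfI two0) ->.
congr (lam * _).
have yn : F 0 - y != 0 by rewrite subr_eq0 gt_eqF.
by field.
Qed.

(** For [s = k + p + 1] the factorials in the moments of [D] leave the ratio [(k + 1) / (s + 1)],
    and [k + lam = s + (lam - (p + 1))]; this gives the values of [q] and [n0]. *)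
Theorem hartogs_profile_linear : exists2 A : R, 0 < A &
  forall x, I x -> F x = F 0 * (1 - x / A).
Proof.
have [c0 cS] := coord_moment_recursion.
apply: (profile_linear b_gt0 F_gt0 F_nincr F_smooth F_spc base_bounded
  (q := lam - p.+1%:R) (n0 := p.+1)) => s.
move=> /subnK; set k := (s - p.+1)%N => <-; rewrite addnS.
have := cS k; have ck0 := c0 k; have cS0 := c0 k.+1.
have n0 i : i.+1%:R != 0 :> R by rewrite pnatr_eq0.
have f0 i : i`!%:R != 0 :> R by rewrite pnatr_eq0 -lt0n fact_gt0.
have H : F 0 * (k.+1%:R * (coord_moment D j k.+1)^-1) = (k%:R + lam) * (coord_moment D j k)^-1 ->
    F 0 * k.+1%:R * coord_moment D j k = (k%:R + lam) * coord_moment D j k.+1.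
  have x0 : coord_moment D j k != 0 by rewrite gt_eqF.
  have y0 : coord_moment D j k.+1 != 0 by rewrite gt_eqF.
  move=> h.
  transitivity (F 0 * (k.+1%:R * (coord_moment D j k.+1)^-1) * (coord_moment D j k * coord_moment D j k.+1)).
    by field.
  by rewrite h; field.
move=> /H; rewrite !coord_momentE addSn.
set N1 := \int[mu]_(u in I) F u ^+ (k + p).+2; set N0 := \int[mu]_(u in I) F u ^+ (k + p).+1.
rewrite (factS (k + p).+1) (factS k) (natrM _ (k + p).+2) (natrM _ k.+1) => h.
have K0 : kappa ^+ p.+2 != 0 by rewrite expf_neq0// gt_eqF// kappa_gt0.
have -> : (k + p).+1%:R + (lam - p.+1%:R) = k%:R + lam.
  by rewrite -addnS natrD; ring.
move: h (f0 k) (f0 (k + p).+1) (n0 k) (n0 (k + p).+1) K0.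
move: (kappa ^+ p.+2) (k`!%:R : R) ((k + p).+1`!%:R : R) (k.+1%:R : R) ((k + p).+2%:R : R).
move=> w x y u v h x0 y0 u0 v0 w0.
apply: (mulfI (mulf_neq0 (mulf_neq0 w0 x0) u0)).
transitivity ((k%:R + lam) * (w * (u * x) / (v * y) * N1) * (v * y)); first by field; rewrite y0 v0.
by rewrite -h; field.
Qed.

End BergmanProfile.

(** * Linear profiles *)

Section EinsteinPotential.
Context {R : realType} {m : nat}.
Local Notation Cm := 'rV[R[i]]_m.+1.

(* Both sides are the determinant of [[1, v], [-u, 1]]. *)
Lemma det_rank1_update (n : nat) (S : comNzRingType) (u : 'cV[S]_n) (v : 'rV[S]_n) :
  \det (1%:M + u *m v) = 1 + \sum_k v 0 k * u k 0.
Proof.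
pose B := block_mx (1%:M : 'M[S]_1) v (- u) (1%:M : 'M[S]_n).
have B1 : B = block_mx 1%:M 0 (- u) 1%:M *m block_mx 1%:M v 0 (1%:M + u *m v).
  rewrite mulmx_block !mul1mx !mulmx1 ?mul0mx ?mulmx0 ?addr0 /B.
  by congr block_mx; rewrite mulNmx addrCA addNr addr0.
have B2 : B = block_mx 1%:M v 0 1%:M *m block_mx (1%:M + v *m u) 0 (- u) 1%:M.
  rewrite mulmx_block !mul1mx !mulmx1 ?mul0mx ?mulmx0 ?add0r /B.
  by congr block_mx; rewrite mulmxN addrK.
have := congr1 (fun M => \det M) B1; rewrite {1}B2 !det_mulmx !det_ublock !det_lblock !det1 !mul1r !mulr1.
by move=> <-; rewrite det_mx11 !mxE eqxx.
Qed.

Variables (a : 'I_m.+1 -> R) (c : R).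
Hypothesis a_gt0 : forall i, 0 < a i.
Hypothesis c_gt0 : 0 < c.
Local Notation Q := (log_weight a c).

Lemma potential_metricZ (phi1 phi2 : Cm -> R) z (k : R) :
  (forall i l, complex_hessian phi1 z i l = k%:C * complex_hessian phi2 z i l) ->
  forall u v, potential_metric phi1 z u v = k * potential_metric phi2 z u v.
Proof.
move=> H u v.
have G (x h y w : R[i]) : x * h * y * w = h * y * w * x by ring.
have E : \sum_j \sum_k0 complex_hessian phi1 z j k0 * u 0 j * (v 0 k0)^* =
   (\sum_j \sum_k0 complex_hessian phi2 z j k0 * u 0 j * (v 0 k0)^*) * k%:C.
  rewrite mulr_suml; apply: eq_bigr => i _; rewrite mulr_suml; apply: eq_bigr => l _.
  exact (etrans (congr1 (fun h => h * u 0 i * (v 0 l)^*) (H i l))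
    (G k%:C (complex_hessian phi2 z i l) (u 0 i) (v 0 l)^*)).
have F (s : R[i]) : 2 * complex.Re (s * k%:C) = k * (2 * complex.Re s).
  by rewrite ReMr; ring.
exact (etrans (congr1 (fun x => 2 * complex.Re x) E) (F _)).
Qed.

(** The Hessian is a diagonal matrix times a rank one perturbation of the identity. The trace of the
    perturbation is [(c - Q z) / Q z], which contributes the last factor [c / Q z]. *)
Lemma det_hessian_log (phi : Cm -> R) z : 0 < Q z ->
  (\forall w \near z, phi w = - ln (Q w)) ->
  \det (complex_hessian phi z) = (c * (\prod_i a i) / Q z ^+ m.+2)%:C.
Proof.
move=> Q0 phiE; have Qn : Q z != 0 by rewrite gt_eqF.
have phiE' : \forall w \near z, phi w = 0 + -1 * ln (Q w).
  by apply: filterS phiE => w ->; rewrite add0r mulN1r.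
pose d : 'rV[R[i]]_m.+1 := \row_k (a k / Q z)%:C.
pose u : 'cV[R[i]]_m.+1 := \col_k (z 0 k)^*.
pose v : 'rV[R[i]]_m.+1 := \row_k ((a k / Q z)%:C * z 0 k).
have -> : complex_hessian phi z = diag_mx d *m (1%:M + u *m v).
  apply/matrixP => j k; rewrite (hessian_log _ _ Q0 phiE') opprK mul1r mul_diag_mx !mxE.
  rewrite big_ord1 !mxE; case: eqP => [->|_]; move: (z 0 j) (z 0 k) => [xj yj] [xk yk].
    by apply: complex_ext => /=; field.
  by apply: complex_ext => /=; field.
rewrite det_mulmx det_diag det_rank1_update.
have -> : \prod_i d 0 i = ((\prod_i a i) / Q z ^+ m.+1)%:C.
  rewrite (eq_bigr (fun i => (a i / Q z)%:C)) => [|i _]; last by rewrite mxE.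
  by rewrite -rmorph_prod prodf_div prodr_const card_ord.
have -> : \sum_k v 0 k * u k 0 = ((c - Q z) / Q z)%:C.
  rewrite {1}/log_weight subKr mulr_suml rmorph_sum; apply: eq_bigr => k _; rewrite !mxE.
  move: (z 0 k) => [x y]; rewrite /sqmod.
  by apply: complex_ext => /=; field.
have Qm : Q z ^+ m.+1 != 0 by rewrite expf_neq0.
rewrite (exprS (Q z) m.+1); move: (Q z ^+ m.+1) Qm => q q0.
by apply: complex_ext => /=; field; rewrite ?Qn ?q0.
Qed.

(** Minus the logarithm of the determinant is a constant plus [(m + 2) * ln Q], that is a constant
    minus [m + 2] times the potential. *)
Lemma kahler_einstein_log (D : set Cm) (phi : Cm -> R) : open D ->
  (forall z, D z -> 0 < Q z) -> (forall z, D z -> phi z = - ln (Q z)) ->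
  kahler_einstein D phi.
Proof.
move=> oD Q0 phiE; exists (- m.+2%:R) => z Dz.
have nD : \forall w \near z, D w by exact: open_nbhs_nbhs.
have nphi : \forall w \near z, phi w = - ln (Q w) by apply: filterS nD => w /phiE.
have nphi' : \forall w \near z, phi w = 0 + -1 * ln (Q w).
  by apply: filterS nphi => w ->; rewrite add0r mulN1r.
pose P := c * \prod_i a i.
have P0 : 0 < P by rewrite mulr_gt0// prodr_gt0.
have nricci : \forall w \near z, - ln (complex.Re (\det (complex_hessian phi w))) =
    - ln P + m.+2%:R * ln (Q w).
  apply: filterS2 nD (near_join nphi) => w Dw phiw.
  have Qw := Q0 w Dw.
  rewrite (det_hessian_log Qw phiw) /= ln_div ?posrE ?exprn_gt0// lnXn//.
  by rewrite opprB addrC mulr_natl.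
have G (x h y : R[i]) : h = (- (-1 : R))%:C * y -> x * y = x * h.
  by move=> ->; rewrite opprK mul1r.
apply: potential_metricZ => i l.
exact (etrans (hessian_log i l (Q0 z Dz) nricci) (G _ _ _ (hessian_log i l (Q0 z Dz) nphi'))).
Qed.

End EinsteinPotential.

(** * Rescaling to the complex hyperbolic metric *)

Section DiagonalIsometry.
Context {R : realType} {m : nat}.
Local Notation Cm := 'rV[R[i]]_m.+1.

Definition diag_scale (s : 'I_m.+1 -> R) : Cm -> Cm :=
  mulmxr (diag_mx (\row_i (s i)%:C)).

Lemma diag_scaleE s z i : diag_scale s z 0 i = (s i)%:C * z 0 i.
Proof. by rewrite /diag_scale /= mul_mx_diag !mxE mulrC. Qed.

Lemma continuous_diag_scale s : continuous (diag_scale s).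
Proof.
move=> z P /near_rowP[d d0 H]; apply/near_rowP.
have s0 : 0 <= \sum_i `|s i| by apply: sumr_ge0.
have M0 : 0 < \sum_i `|s i| + 1 by rewrite ltr_wpDl.
exists (d / (\sum_i `|s i| + 1)); first by rewrite divr_gt0.
move=> w wz; apply: H => i; rewrite !diag_scaleE -mulrBr cabsM cabs_ofreal.
have := wz i; rewrite ltr_pdivlMr//; apply: le_lt_trans.
rewrite mulrC ler_wpM2l ?cabs_ge0//.
rewrite (bigD1 i)//= -addrA lerDl addr_ge0//; apply: sumr_ge0 => //.
Qed.

Lemma differentiable_diag_scale s z : differentiable (diag_scale s) z.
Proof. exact: linear_differentiable (@continuous_diag_scale s). Qed.

Lemma diff_diag_scale s z u : 'd (diag_scale s) z u = diag_scale s u.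
Proof. exact (congr1 (fun f => f u) (diff_lin z (@continuous_diag_scale s))). Qed.

Lemma sqmodM_ofreal (r : R) (z : R[i]) : sqmod (r%:C * z) = r ^+ 2 * sqmod z.
Proof. by rewrite /sqmod; case: z => x y /=; ring. Qed.

Lemma log_weight_unit (w : Cm) :
  log_weight (fun=> 1) 1 w = 1 - sqmod (w 0 ord0) - fiber_sqnorm w.
Proof.
rewrite /log_weight (bigD1 ord0)//= mul1r opprD addrA; congr (_ - _).
by apply: eq_bigr => i _; rewrite mul1r.
Qed.

Variables (a : 'I_m.+1 -> R) (c : R).
Hypothesis a_gt0 : forall i, 0 < a i.
Hypothesis c_gt0 : 0 < c.
Local Notation Q := (log_weight a c).

(** Chosen so that [Q] becomes [c] times the weight of the unit ball; the constant [ln c] disappears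
    from the Hessian. *)
Let s i := Num.sqrt (a i / c).

Let s_gt0 i : 0 < s i.
Proof. by rewrite sqrtr_gt0 divr_gt0. Qed.

Let s_sqr i : a i = c * s i ^+ 2.
Proof. by rewrite sqr_sqrtr ?divr_ge0 ?ltW// mulrC divfK// gt_eqF. Qed.

Lemma log_weight_scale z : Q z = c * log_weight (fun=> 1) 1 (diag_scale s z).
Proof.
rewrite /log_weight mulrBr mulr1 mulr_sumr; congr (_ - _).
apply: eq_bigr => i _; rewrite diag_scaleE sqmodM_ofreal mul1r mulrA.
by congr (_ * _); exact: s_sqr.
Qed.

(** One term of the Hermitian sum on each side. The boolean [e] stands for equality of the two
    indices, the only case in which the two scaling factors must agree. *)
Lemma hessian_term_scale (q si sl ai al : R) (e : bool) (zi zl wi wl u v x y : R[i]) :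
  q != 0 -> c != 0 -> ai = c * si ^+ 2 -> al = c * sl ^+ 2 -> (e -> si = sl) ->
  wi = si%:C * zi -> wl = sl%:C * zl -> x = si%:C * u -> y = sl%:C * v ->
  (- (-1 : R))%:C * ((1 / q * e%:R)%:C + (1 * 1 / q ^+ 2)%:C * (wi^* * wl)) * x * y^* =
  (- (-1 : R))%:C * ((al / (c * q) * e%:R)%:C +
     (ai * al / (c * q) ^+ 2)%:C * (zi^* * zl)) * u * v^*.
Proof.
move=> q0 k0 -> -> es -> -> -> ->.
case: e es => [/(_ isT)->|_]; move: zi zl u v => [x1 y1] [x2 y2] [x3 y3] [x4 y4].
  by apply: complex_ext => /=; field; rewrite k0 q0.
by apply: complex_ext => /=; field; rewrite k0 q0.
Qed.

(** The open subset is the image of [D], written as a preimage under the inverse scaling. Being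
    linear, the scaling is its own differential, and the two Hermitian sums agree term by term. *)
Theorem isometric_log (D : set Cm) (phi : Cm -> R) : open D ->
  (forall z, D z -> 0 < Q z) -> (forall z, D z -> phi z = - ln (Q z)) ->
  holomorphically_isometric_to_open_subset D (potential_metric phi)
    unit_ball hyperbolic_metric.
Proof.
move=> oD Q0 phiE; pose t i := (s i)^-1.
have stK : cancel (diag_scale t) (diag_scale s).
  move=> w; apply/rowP => i; rewrite !diag_scaleE mulrA -rmorphM.
  by rewrite /t mulfV ?gt_eqF// rmorph1 mul1r.
have tsK : cancel (diag_scale s) (diag_scale t).
  move=> w; apply/rowP => i; rewrite !diag_scaleE mulrA -rmorphM.
  by rewrite /t mulVf ?gt_eqF// rmorph1 mul1r.
exists (diag_scale t @^-1` D), (diag_scale s), (diag_scale t); split.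
- split.
    by apply: open_comp => // w _; exact: continuous_diag_scale.
  move=> w /Q0; rewrite log_weight_scale stK pmulr_rgt0// /log_weight subr_gt0 /unit_ball /=.
  by rewrite (eq_bigr (fun i => sqmod (w 0 i))) => // i _; rewrite mul1r.
- by split=> z _; exact: differentiable_diag_scale.
- by move=> z Dz; split; rewrite /= tsK.
- by move=> w Dw; split => //; rewrite stK.
move=> z Dz u v; rewrite !diff_diag_scale.
have nD : \forall w \near z, D w by exact: open_nbhs_nbhs.
have nphi : \forall w \near z, phi w = 0 + -1 * ln (Q w).
  by apply: filterS nD => w /phiE ->; rewrite add0r mulN1r.
pose w := diag_scale s z.
have Qw : 0 < log_weight (fun=> 1) 1 w by have := Q0 z Dz; rewrite log_weight_scale pmulr_rgt0.
have nhyp : \forall w' \near w, hartogs_potential (fun x => 1 - x) w' =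
    0 + -1 * ln (log_weight (fun=> 1) 1 w').
  apply: filterE => w'; rewrite /hartogs_potential log_weight_unit add0r mulN1r.
  by [].
have T (h1 h1' h2 h2' x y u' v' : R[i]) : h1 = h1' -> h2 = h2' ->
    h1' * x * y^* = h2' * u' * v'^* -> h1 * x * y^* = h2 * u' * v'^*.
  by move=> -> ->.
have E : \sum_i \sum_l complex_hessian (hartogs_potential (fun x => 1 - x)) w i l *
      diag_scale s u 0 i * (diag_scale s v 0 l)^* =
    \sum_i \sum_l complex_hessian phi z i l * u 0 i * (v 0 l)^*.
  apply: eq_bigr => i _; apply: eq_bigr => l _.
  have cn : c != 0 by rewrite gt_eqF.
  have qn : log_weight (fun=> 1) 1 w != 0 by rewrite gt_eqF.
  have il : i == l -> s i = s l by move=> /eqP ->.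
  have h2 := hessian_log i l (Q0 z Dz) nphi; rewrite log_weight_scale -/w in h2.
  exact (T _ _ _ _ _ _ _ _ (hessian_log i l Qw nhyp) h2
    (hessian_term_scale qn cn (s_sqr i) (s_sqr l) il (diag_scaleE s z i)
      (diag_scaleE s z l) (diag_scaleE s u i) (diag_scaleE s v l))).
exact (congr1 (fun x => 2 * complex.Re x) E).
Qed.

End DiagonalIsometry.


Theorem theorem1p3 (R : realType) (m : nat) (n_ge2 : (2 <= m.+1)%N)
    (b : \bar R) (b_gt0 : (0 < b)%E) (F : R -> R)
    (F_gt0 : forall x, base_interval b x -> 0 < F x)
    (F_nincr : forall x y, base_interval b x -> base_interval b y ->
       x <= y -> F y <= F x)
    (F_smooth : smooth_within (base_interval b) F)
    (F_spc : strong_pseudoconvexity_condition b F)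
    (D_bounded : bounded_set (hartogs_domain b F : set 'rV[R[i]]_m.+1))
    (K : 'rV[R[i]]_m.+1 -> 'rV[R[i]]_m.+1 -> R[i])
    (K_bergman : is_bergman_kernel (hartogs_domain b F) K)
    (lambda : R) (lambda_gt0 : 0 < lambda)
    (gB_eq : forall z, hartogs_domain b F z -> forall u v,
       bergman_metric K z u v = lambda * hartogs_metric F z u v) :
  kahler_einstein (hartogs_domain b F : set 'rV[R[i]]_m.+1)
    (hartogs_potential F) /\
  holomorphically_isometric_to_open_subset
    (hartogs_domain b F : set 'rV[R[i]]_m.+1) (hartogs_metric F)
    unit_ball hyperbolic_metric.
Proof.
(* Dimension at least 2 provides a fibre coordinate, hence an axis. *)
case: m n_ge2 K D_bounded K_bergman gB_eq => [//|p] _ K D_bounded K_bergman gB_eq.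
have [A A0 FA] := hartogs_profile_linear b_gt0 F_gt0 F_nincr F_smooth F_spc
  D_bounded K_bergman gB_eq.
have F00 : 0 < F 0 := F_gt0 _ (base_interval0 b_gt0).
(* From [F x - |z|^2 = F 0 - (F 0 / A) x - |z|^2] with [x = |z_0|^2]. *)
pose a (i : 'I_p.+2) := if i == ord0 then F 0 / A else 1.
have a0 i : 0 < a i by rewrite /a; case: eqP => // _; exact: divr_gt0.
have QE z : hartogs_domain b F z ->
    log_weight a (F 0) z = F (sqmod (z 0 ord0)) - fiber_sqnorm z.
  move=> Dz; rewrite (FA _ (hartogs_base Dz)) /log_weight (bigD1 ord0)//= /a eqxx.
  rewrite (eq_bigr (fun i => sqmod (z 0 i))) => [|i /negbTE ->]; last by rewrite mul1r.
  by rewrite /fiber_sqnorm; field; rewrite gt_eqF.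
have oD := hartogs_open (p := p) F_smooth.
have Q0 z : hartogs_domain b F z -> 0 < log_weight a (F 0) z.
  by move=> Dz; rewrite QE//; have [_] := Dz; rewrite subr_gt0.
have phiE (z : 'rV[R[i]]_p.+2) : hartogs_domain b F z ->
    hartogs_potential F z = - ln (log_weight a (F 0) z).
  by move=> Dz; rewrite QE.
split; first exact (kahler_einstein_log a0 F00 oD Q0 phiE).
exact (isometric_log a0 F00 oD Q0 phiE).
Qed.
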